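(* Let $\phi$ be a proper parametrization of degree $d$ of a rational plane curve $C$. If $\mu=2$ and all the singularities of $C$ have multiplicity $2$, then the following family of $\frac{(d+1)(d-4)}{2}+5$ polynomials $$\{\mathcal E_d(\underline X),\,P_{2,1}(\underline T,\underline X),\,Q_{d-2,1}(\underline T,\underline X),\,\Delta^{(1,0)}(\underline T,\underline X),\,\Delta^{(0,1)}(\underline T,\underline X)\}\ \cup\ \{\Delta^{\underline v}_{i,d-1-i}(\underline T,\underline X)\}_{1\le i\le d-4,\ |\underline v|=d-2-i}$$ is a minimal set of generators of $\mathcal K$.
   Context: Let $\mathbb K$ be an algebraically closed field, $\underline T=(T_0,T_1)$, $\underline X=(X_0,X_1,X_2)$, and let $u_0,u_1,u_2\in\mathbb K[\underline T]$ be homogeneous of the same degree $d\ge1$ without common factors; $I=\langle u_0,u_1,u_2\rangle\subset\mathbb K[\underline T]$. $\mathrm{Rees}(I)=\bigoplus_{n\ge0}I^nZ^n$ and $\mathcal K$ is the kernel of the $\mathbb K[\underline T]$-algebra epimorphism $\mathbb K[\underline T][\underline X]\to\mathrm{Rees}(I)$, $X_i\mapsto u_i(\underline T)Z$; it is a bihomogeneous ideal, with bidegree-$(i,j)$ component $\mathcal K_{i,j}$ ($i$ in $\underline T$, $j$ in $\underline X$). A double subscript $i,j$ on a polynomial in $\underline T,\underline X$ denotes its bidegree. $\mathcal K_{*,1}\cong\mathrm{Syz}(I)$ is a free $\mathbb K[\underline T]$-module of rank 2; fix a basis $P_{\mu,1},Q_{d-\mu,1}$ of bidegrees $(\mu,1),(d-\mu,1)$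 with $0\le\mu\le d/2$ ($\mu$ is determined by $I$). The map $\phi:\mathbb P^1\to\mathbb P^2$, $(t_0:t_1)\mapsto(u_0:u_1:u_2)(t_0,t_1)$, is proper if it is birational onto its image, the curve $C$. $\mathcal E_d(\underline X)$ is the irreducible homogeneous polynomial of degree $d$ defining $C$. Let $\mu=2$ and write $P_{2,1}=T_0^2L^0_1(\underline X)+T_1^2L^1_1(\underline X)+T_0T_1L^*_1(\underline X)$. For $\underline v=(v_0,v_1)\in\mathbb N^2$, $|\underline v|=v_0+v_1$. Sylvester forms: for $\underline v\in\{(1,0),(0,1)\}$ write $$P_{2,1}=T_0^{1+v_0}P^{0,\underline v}_{1-v_0,1}+T_1^{1+v_1}P^{1,\underline v}_{1-v_1,1},\qquad Q_{d-2,1}=T_0^{1+v_0}Q^{0,\underline v}_{d-3-v_0,1}+T_1^{1+v_1}Q^{1,\underline v}_{d-3-v_1,1},$$ and set $\Delta^{\underline v}(\underline T,\underline X)=P^{0,\underline v}_{1-v_0,1}Q^{1,\underline v}_{d-3-v_1,1}-P^{1,\underline v}_{1-v_1,1}Q^{0,\underline v}_{d-3-v_0,1}$, of bidegree $(d-3,2)$ (any such decomposition may be chosen). Morley forms: let $\underline S=(S_0,S_1)$ be new variables and write $$P_{2,1}(\underline T,\underline X)-P_{2,1}(\underline S,\underline X)=P^0(\underline S,\underline T,\underline X)(T_0-S_0)+P^1(\underline S,\underline T,\underline X)(T_1-S_1),$$ $$Q_{d-2,1}(\underline T,\underline X)-Q_{d-2,1}(\underline S,\underline X)=Q^0(\underline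 S,\underline T,\underline X)(T_0-S_0)+Q^1(\underline S,\underline T,\underline X)(T_1-S_1)$$ with $P^0,P^1,Q^0,Q^1$ homogeneous in $(\underline S,\underline T)$ (of degrees $1,1,d-3,d-3$) and linear in $\underline X$. Set $\mathrm{Mor}(\underline S,\underline T,\underline X)=P^0Q^1-P^1Q^0=\sum_{|\underline v|\le d-2}F^{\underline v}_{d-2-|\underline v|,2}(\underline T,\underline X)\,\underline S^{\underline v}$. For $1\le i\le d-2$ let $\mathbb M_i$ be the $(d-1-i)\times(d-2-i)$ matrix whose rows are indexed by the exponents $\underline v$ with $|\underline v|=d-2-i$, in the order $(d-2-i,0),(d-3-i,1),\ldots,(0,d-2-i)$; its $m$-th column, for $1\le m\le d-3-i$, has entries $L^0_1,L^*_1,L^1_1$ in rows $m,m+1,m+2$ and zeros elsewhere; its last column has the entry $F^{\underline v}_{i,2}(\underline T,\underline X)$ in the row indexed by $\underline v$. For $|\underline v|=d-2-i$, $\Delta^{\underline v}_{i,d-1-i}(\underline T,\underline X)$ is the signed maximal minor of $\mathbb M_i$ obtained by eliminating the row indexed by $\underline v$; it has bidegree $(i,d-1-i)$. *)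

(* Defs.v *)
From HB Require Import structures.
From mathcomp Require Import all_boot all_order all_algebra.
From mathcomp Require Export mpoly.

Set Implicit Arguments.
Unset Strict Implicit.
Unset Printing Implicit Defensive.

Import GRing.Theory.
Local Open Scope ring_scope.

(* Polynomials in T, X are polynomials in X = (X_0, X_1, X_2) over K[T_0, T_1],
   and polynomials in S, T, X are polynomials in S = (S_0, S_1) over those. *)
Notation KT K := {mpoly K[2]} (only parsing).
Notation KX K := {mpoly K[3]} (only parsing).
Notation KTX K := {mpoly {mpoly K[2]}[3]} (only parsing).
Notation KSTX K := {mpoly {mpoly {mpoly K[2]}[3]}[2]} (only parsing).

Section IdealsAndFactors.

Definition in_ideal (R : comNzRingType) (s : seq R) (p : R) : Prop :=
  exists c : 'I_(size s) -> R, p = \sum_(i < size s) c i * s`_i.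

Definition generates (R : comNzRingType) (J : R -> Prop) (s : seq R) : Prop :=
  forall p, J p <-> in_ideal s p.

Definition minimal_generating_set (R : comNzRingType) (J : R -> Prop)
    (s : seq R) : Prop :=
  generates J s /\
  forall s' : seq R,
    {subset s' <= s} -> generates J s' -> {subset s <= s'}.

Definition irreducible_elt (R : unitRingType) (p : R) : Prop :=
  [/\ p != 0, p \isn't a GRing.unit
    & forall a b, p = a * b -> a \is a GRing.unit \/ b \is a GRing.unit].

Definition no_common_factor (R : unitRingType) (n : nat) (u : 'I_n -> R) : Prop :=
  forall p, (forall i, exists q, u i = q * p) -> p \is a GRing.unit.

End IdealsAndFactors.

Section ProjectiveMaps.

Variable K : fieldType.

(* Points of a projective space are nonzero row vectors up to [proj_eq]. *)
Definition proj_eq (n : nat) (x y : 'rV[K]_n) : Prop :=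
  exists2 c : K, c != 0 & y = c *: x.

Definition form_map (m n : nat) (f : 'I_n -> {mpoly K[m]}) (x : 'rV[K]_m) :
    'rV[K]_n :=
  \row_i (f i).@[x 0].

Definition in_image (u : 'I_3 -> KT K) (x : 'rV[K]_3) : Prop :=
  exists2 t : 'rV[K]_2, t != 0 & proj_eq (form_map u t) x.

(* The inverse is a rational map C --> P^1, given by two forms v_0, v_1 of the
   same degree which do not both vanish identically on the (irreducible) curve
   C; both composites are the identity wherever v is defined. *)
Definition birational_onto_image (u : 'I_3 -> KT K) : Prop :=
  exists (e : nat) (v : 'I_2 -> KX K),
    [/\ forall i, v i \is e.-homog,
        exists2 t : 'rV[K]_2, t != 0 & form_map v (form_map u t) != 0,
        forall t : 'rV[K]_2, t != 0 -> form_map v (form_map u t) != 0 ->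
          proj_eq t (form_map v (form_map u t))
      & forall x : 'rV[K]_3, in_image u x -> form_map v x != 0 ->
          proj_eq x (form_map u (form_map v x))].

Definition defines_image (u : 'I_3 -> KT K) (d : nat) (E : KX K) : Prop :=
  [/\ E \is d.-homog,
      irreducible_elt E
    & forall x : 'rV[K]_3, x != 0 -> (E.@[x 0] = 0 <-> in_image u x)].

(* Least degree of a monomial of f (0 if f = 0). *)
Definition order_at_origin (n : nat) (f : {mpoly K[n]}) : nat :=
  \big[minn/msize f]_(m <- msupp f) mdeg m.

(* Equation of V(E) in the chart X_i = 1, translated so that the point x, with
   x_i != 0, becomes the origin; the variable X_i does not occur in it. *)
Definition local_equation (E : KX K) (x : 'rV[K]_3) (i : 'I_3) : KX K :=
  E \mPo [tuple (x 0 j / x 0 i)%:MP + (if j == i then 0 else 'X_j) | j < 3].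

Definition multiplicity (E : KX K) (x : 'rV[K]_3) (i : 'I_3) : nat :=
  order_at_origin (local_equation E x i).

(* A point is singular iff its multiplicity is at least 2. *)
Definition singularities_are_double (E : KX K) : Prop :=
  forall (x : 'rV[K]_3) (i : 'I_3), x 0 i != 0 ->
    (2 <= multiplicity E x i)%N -> multiplicity E x i = 2.

End ProjectiveMaps.

Section ReesAlgebra.

Variable K : fieldType.

Definition bihomog (i j : nat) (p : KTX K) : Prop :=
  p \is j.-homog /\ forall m, p@_m \is i.-homog.

(* The variable of {poly KT K} is Z. *)
Definition rees_map (u : 'I_3 -> KT K) : KTX K -> {poly (KT K)} :=
  mmap (@polyC (KT K)) (fun i => u i *: 'X).

Definition rees_ker (u : 'I_3 -> KT K) (p : KTX K) : Prop := rees_map u p = 0.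

Definition syz (u : 'I_3 -> KT K) (p : KTX K) : Prop :=
  rees_ker u p /\ p \is 1.-homog.

Definition mu_basis (u : 'I_3 -> KT K) (d mu : nat) (P Q : KTX K) : Prop :=
  [/\ (mu.*2 <= d)%N,
      bihomog mu 1 P /\ bihomog (d - mu) 1 Q,
      syz u P /\ syz u Q
    & forall p, syz u p ->
        exists! ab : KT K * KT K, p = ab.1 *: P + ab.2 *: Q].

Definition tvar (i : 'I_2) : KTX K := ('X_i)%:MP.

Definition x_poly (E : KX K) : KTX K := map_mpoly (@mpolyC 2 K) E.

Definition sylvester_form (d : nat) (P Q : KTX K) (v0 v1 : nat) (D : KTX K) :
    Prop :=
  exists P0 P1 Q0 Q1 : KTX K,
    [/\ [/\ bihomog (1 - v0) 1 P0, bihomog (1 - v1) 1 P1,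
            bihomog (d - 3 - v0) 1 Q0 & bihomog (d - 3 - v1) 1 Q1],
        P = tvar 0 ^+ v0.+1 * P0 + tvar 1 ^+ v1.+1 * P1,
        Q = tvar 0 ^+ v0.+1 * Q0 + tvar 1 ^+ v1.+1 * Q1
      & D = P0 * Q1 - P1 * Q0].

(* p(T,X) |-> p(S,X) *)
Definition to_S (p : KTX K) : KSTX K :=
  mmap (mmap (fun c : K => c%:MP%:MP%:MP) (fun i => 'X_i))
       (fun j => ('X_j)%:MP) p.

(* Homogeneous of degree e in (S,T) and of degree j in X. *)
Definition st_bihomog (e j : nat) (A : KSTX K) : Prop :=
  forall v, v \in msupp A -> (mdeg v <= e)%N /\ bihomog (e - mdeg v) j A@_v.

Definition morley_form (d : nat) (P Q : KTX K) (M : KSTX K) : Prop :=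
  exists P0 P1 Q0 Q1 : KSTX K,
    [/\ [/\ st_bihomog 1 1 P0, st_bihomog 1 1 P1,
            st_bihomog (d - 3) 1 Q0 & st_bihomog (d - 3) 1 Q1],
        P%:MP - to_S P
          = P0 * ((tvar 0)%:MP - 'X_0) + P1 * ((tvar 1)%:MP - 'X_1),
        Q%:MP - to_S Q
          = Q0 * ((tvar 0)%:MP - 'X_0) + Q1 * ((tvar 1)%:MP - 'X_1)
      & M = P0 * Q1 - P1 * Q0].

Definition morley_coef (M : KSTX K) (v0 v1 : nat) : KTX K :=
  M@_(U_(0%R) *+ v0 + U_(1%R) *+ v1)%MM.

(* With n = d - 2 - i this is the (n+1) x n matrix M_i. Rows and columns are
   numbered from 0; row k corresponds to the exponent v = (n - k, k). *)
Definition morley_matrix (n : nat) (L0 Ls L1 : KTX K) (M : KSTX K) :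
    'M[KTX K]_(n.+1, n) :=
  \matrix_(k < n.+1, m < n)
    if m.+1 == n then morley_coef M (n - k) k
    else if k == m :> nat then L0
    else if k == m.+1 :> nat then Ls
    else if k == m.+2 :> nat then L1
    else 0.

Definition morley_minor (n : nat) (L0 Ls L1 : KTX K) (M : KSTX K)
    (k : 'I_n.+1) : KTX K :=
  (-1) ^+ k * \det (row' k (morley_matrix n L0 Ls L1 M)).

(* The minors Delta^v_{i,d-1-i} for 1 <= i <= d - 4 and |v| = d - 2 - i. *)
Definition morley_minors (d : nat) (L0 Ls L1 : KTX K) (M : KSTX K) :
    seq (KTX K) :=
  [seq morley_minor L0 Ls L1 M k
    | i <- iota 1 (d - 4), k <- enum 'I_(d - 2 - i).+1].

End ReesAlgebra.

(* Main.v *)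
Require Import Defs.
From HB Require Import structures.
From mathcomp Require Import all_boot all_order all_algebra.
From mathcomp Require Import perm ring zify.
From Stdlib Require Import Classical_Prop.

(** Let (P, Q) be the ideal of the two basis syzygies. The kernel is computed
    modulo (P, Q), T-degree by T-degree, by duality. As the u_i generate powers
    of T_0 and T_1, every p in the kernel is multiplied into (P, Q) by
    f = T_0^N and g = T_1^N for large N. Both (P, Q) and (f, g) are regular
    sequences, so p has a residue e, determined modulo (f, g), which vanishes
    only if p lies in (P, Q); moreover e P and e Q lie in (f, g) ([residue],
    [residue_exists], [mem2_residue], [residue_mem2]). For p of T-degree i the
    residue has T-degree 2 N + i - d. It vanishes for i >= d - 1, and for
    i = d - 2 - n it is a combination of the n + 1 monomials T^(N - 1 - v) with
    |v| = n, with coefficients lam_k in K[X] ([ker_tres]). That e P lies in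
    (f, g) means that the coefficients lam_k satisfy the recurrence
    L0 lam_k + Ls lam_(k+1) + L1 lam_(k+2) = 0 ([residue_band_rec]).

    Hence everything is about the kernel of the band matrix of this recurrence.
    The hypothesis on the singularities implies that L0, Ls, L1 are linearly
    independent when d >= 5: the curve is given by the resultant of P and Q, and
    a common zero of the three forms would be a point of multiplicity at least
    d - 2 ([coefficients_independent]). The forms are then a regular sequence,
    and the solutions of the recurrence are generated by its obvious solutions,
    the rows of maximal minors of the band ([band_kernel]).

    The generators realize these residues. Applied to the Morley form in the
    variables S, the functional with values lam_k yields an element of the
    kernel with residue lam ([residue_morley], [residue_morley_form]). Expanding
    a Morley minor along its last column shows that it is, up to sign, the value
    of the functional given by a row of band minors ([residue_minor]), so these
    minors generate T-degrees 1 to d - 4 modulo (P, Q) ([ker_minors]). The two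
    Sylvester forms have monomial residues by Cramer's rule and account for the
    T-degrees d - 3 and d - 2. In T-degree 0 the kernel is the ideal of the
    curve, which the irreducible equation generates ([curve_ker_principal]),
    by division with respect to one variable and Gauss's lemma.

    For minimality, a relation expressing a generator by the others may be
    restricted to its bidegree. There it becomes a linear relation over K,
    modulo (P, Q), among generators of the same bidegree. Taking residues, it
    is excluded by the independence of two monomials for the Sylvester forms,
    and by that of the rows of band minors modulo (L0, Ls, L1) for the Morley
    minors ([minors_independent]); the equation and the pair P, Q are treated
    directly. *)

Set Implicit Arguments.
Unset Strict Implicit.
Unset Printing Implicit Defensive.

Import GRing.Theory.
Local Open Scope ring_scope.

(** * Polynomials in several variables *)

Lemma mpoly_ring_ind (R : nzRingType) (n : nat) (P : {mpoly R[n]} -> Prop) :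
  (forall c, P c%:MP) -> (forall i, P 'X_i) ->
  (forall p q, P p -> P q -> P (p + q)) ->
  (forall p q, P p -> P q -> P (p * q)) -> forall p, P p.
Proof.
move=> PC PX PD PM p; rewrite [p]mpolyE.
apply: (big_ind P) => [||m _]; rewrite -?(mpolyC0 n R) //.
rewrite -mul_mpolyC; apply: (PM); first exact: PC.
rewrite mpolyXE_id; apply: (big_ind P) => [||i _]; rewrite -?(mpolyC1 n R) //.
elim: (m i) => [|k IHk]; first by rewrite expr0 -(mpolyC1 n R).
by rewrite exprS; apply: PM.
Qed.

(** Two substitutions that agree modulo an ideal on the variables agree modulo
    it everywhere. *)
Lemma rmorph_congr (R S : comNzRingType) (n : nat)
    (f g : {rmorphism {mpoly R[n]} -> S}) (J : S -> Prop) :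
  J 0 -> (forall x y, J x -> J y -> J (x + y)) ->
  (forall a x, J x -> J (a * x)) ->
  (forall c, f c%:MP = g c%:MP) -> (forall i, J (f 'X_i - g 'X_i)) ->
  forall p, J (f p - g p).
Proof.
move=> J0 JD JM fgC fgX; elim/mpoly_ring_ind => [c|i|p q Jp Jq|p q Jp Jq] //.
- by rewrite fgC subrr.
- rewrite !rmorphD; have -> : f p + f q - (g p + g q)
    = (f p - g p) + (f q - g q) by ring.
  exact: JD.
- rewrite !rmorphM; have -> : f p * f q - g p * g q
    = f q * (f p - g p) + g p * (f q - g q) by ring.
  by apply: JD; apply: JM.
Qed.

Lemma rmorph_mpoly_ext (R S : comNzRingType) (n : nat)
    (f g : {rmorphism {mpoly R[n]} -> S}) :
  (forall c, f c%:MP = g c%:MP) -> (forall i, f 'X_i = g 'X_i) -> f =1 g.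
Proof.
move=> fgC fgX p; apply/subr0_eq.
apply: (rmorph_congr (J := fun x => x = 0)) => //.
- by move=> x y -> ->; rewrite addr0.
- by move=> a x ->; rewrite mulr0.
- by move=> i; rewrite fgX subrr.
Qed.

Lemma pihomog_sum_comps (R : nzRingType) (n : nat) (p : {mpoly R[n]}) :
  p = \sum_(k < msize p) pihomog mdeg k p.
Proof. exact: pihomog_partitionE. Qed.

Lemma homog_comps (R : nzRingType) (n : nat) (p : {mpoly R[n]}) :
  (forall k, pihomog mdeg k p = 0) -> p = 0.
Proof. by move=> p0; rewrite [p]pihomog_sum_comps big1. Qed.

(** Only the part of x of degree k - i contributes to the part of degree k. *)
Lemma pihomogMr (R : nzRingType) (n i k : nat) (x h : {mpoly R[n]}) :
  h \is i.-homog ->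
  pihomog mdeg k (x * h)
    = if (i <= k)%N then pihomog mdeg (k - i) x * h else 0.
Proof.
move=> hh; rewrite {1}[x]pihomog_sum_comps mulr_suml raddf_sum /=.
have xh j : pihomog mdeg j x * h \is (j + i).-homog.
  exact: dhomogM (pihomogP _ _ _) hh.
have [ik|ki] := leqP i k; last first.
  apply: big1 => j _; apply: pihomog_ne0 (xh j); apply/eqP; lia.
have [lt|ge] := ltnP (k - i) (msize x).
  rewrite (bigD1 (Ordinal lt)) //= big1 ?addr0 => [|j neq].
    by apply: pihomog_dE; rewrite -{2}(subnK ik).
  apply: pihomog_ne0 (xh j); apply: contra neq => /eqP eq.
  by apply/eqP/val_inj => /=; rewrite -eq addnK.
have -> : pihomog mdeg (k - i) x = 0.
  rewrite pihomogE big_seq_cond big_pred0 // => m.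
  apply/negbTE/negP => /andP[/msize_mdeg_lt mx /eqP eq].
  by move: mx; rewrite eq ltnNge ge.
rewrite mul0r; apply: big1 => j _; apply: pihomog_ne0 (xh j); apply/eqP.
by have := ltn_ord j; lia.
Qed.

Lemma mcoeff_homog (R : nzRingType) (n i : nat) (p : {mpoly R[n]}) m :
  p \is i.-homog -> mdeg m != i -> p@_m = 0.
Proof. exact: dhomog_nemf_coeff. Qed.

Lemma mdeg_homog (R : nzRingType) (n i : nat) (p : {mpoly R[n]}) m :
  p \is i.-homog -> m \in msupp p -> mdeg m = i.
Proof. by move=> hp mp; exact: (dhomog_mf hp mp). Qed.

Lemma homog_gt0_at0 (R : comNzRingType) (n d : nat) (p : {mpoly R[n]})
    (v : 'I_n -> R) :
  p \is d.-homog -> (0 < d)%N -> (forall i, v i = 0) -> p.@[v] = 0.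
Proof.
move=> hp d_gt0 v0; rewrite mevalE big_seq big1 // => m mp.
have [i mi] : exists i, m i != 0%N.
  apply/existsP; apply: contraTT d_gt0; rewrite negb_exists => /forallP m0.
  rewrite -(mdeg_homog hp mp) mdegE big1 // => i _.
  by apply/eqP; have := m0 i; rewrite negbK.
by rewrite (bigD1 i) //= v0 expr0n (negbTE mi) mul0r mulr0.
Qed.

Lemma homog0_const (R : nzRingType) (n : nat) (p : {mpoly R[n]}) :
  p \is 0.-homog -> p = (p@_0%MM)%:MP.
Proof.
move=> hp; apply/mpolyP => m; rewrite mcoeffC.
have [->|m0] := eqVneq m 0%MM; first by rewrite mulr1.
by rewrite mulr0 (mcoeff_homog hp) // mdeg_eq0.
Qed.

Lemma homog_mpolyX (R : nzRingType) (n : nat) m :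
  ('X_[m] : {mpoly R[n]}) \is (mdeg m).-homog.
Proof. by rewrite dhomogX. Qed.

Lemma homog_var (R : nzRingType) (n : nat) (i : 'I_n) :
  ('X_i : {mpoly R[n]}) \is 1.-homog.
Proof. by rewrite dhomogX /= mdeg1. Qed.

Lemma homog_mpolyC (R : nzRingType) (n : nat) (c : R) :
  (c%:MP : {mpoly R[n]}) \is 0.-homog.
Proof. by rewrite -[c%:MP]mulr1 mul_mpolyC rpredZ // dhomog1. Qed.

Lemma homog_mulC (R : nzRingType) (n d : nat) (c : R) (p : {mpoly R[n]}) :
  p \is d.-homog -> c%:MP * p \is d.-homog.
Proof. by move=> hp; rewrite mul_mpolyC rpredZ. Qed.

Lemma homog_varX (R : nzRingType) (n k : nat) (i : 'I_n) :
  ('X_i ^+ k : {mpoly R[n]}) \is k.-homog.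
Proof. by rewrite -[k in k.-homog]mul1n; apply: dhomogMn (homog_var R i). Qed.

Lemma homog_rmorph (R S : comNzRingType) (n l e k d : nat)
    (g : {rmorphism {mpoly R[n]} -> {mpoly S[l]}}) (p : {mpoly R[n]}) :
  (forall m, g (p@_m)%:MP \is e.-homog) -> (forall i, g 'X_i \is k.-homog) ->
  p \is d.-homog -> g p \is (e + k * d).-homog.
Proof.
move=> gC gX hp; rewrite [p in g p]mpolyE rmorph_sum big_seq /=.
apply: rpred_sum => m mp; rewrite -mul_mpolyC rmorphM dhomogM //.
rewrite mpolyXE_id rmorph_prod -(mdeg_homog hp mp) mdegE big_distrr /=.
apply: (big_ind2 (fun q j => q \is j.-homog)) => [|q1 d1 q2 d2 h1 h2|i _].
- exact: dhomog1.
- exact: dhomogM.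
- by rewrite rmorphXn; apply: dhomogMn (gX i).
Qed.

Lemma mcoeff_pihomog (R : nzRingType) (n k : nat) (p : {mpoly R[n]}) m :
  (pihomog mdeg k p)@_m = if mdeg m == k then p@_m else 0.
Proof.
have [mk|mk] := eqVneq (mdeg m) k; last first.
  by rewrite (mcoeff_homog (pihomogP _ _ _) mk).
have -> : p@_m = \sum_(j < msize p) (pihomog mdeg j p)@_m.
  by rewrite -raddf_sum -pihomog_sum_comps.
have other j : j != k -> (pihomog mdeg j p)@_m = 0.
  by move=> jk; rewrite (mcoeff_homog (pihomogP _ _ _)) // mk eq_sym.
have [lt|ge] := ltnP k (msize p).
  rewrite (bigD1 (Ordinal lt)) //= [X in _ + X]big1 ?addr0 // => j neq.
  by apply: other; apply: contra neq => /eqP eq; apply/eqP/val_inj.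
rewrite [RHS]big1 => [|j _]; last first.
  by apply: other; apply/eqP; have := ltn_ord j; lia.
rewrite pihomogE big_seq_cond big_pred0 ?mcoeff0 // => m'.
apply/negbTE/negP => /andP[/msize_mdeg_lt m'p /eqP eq].
by move: m'p; rewrite eq ltnNge ge.
Qed.

(** * Polynomials in two variables *)

Definition bmon (a b : nat) : 'X_{1..2} := (U_(0%R) *+ a + U_(1%R) *+ b)%MM.

Lemma bmon0 a b : bmon a b 0 = a.
Proof. by rewrite mnmDE !mulmnE !mnm1E /= mul1n mul0n addn0. Qed.

Lemma bmon1 a b : bmon a b 1 = b.
Proof. by rewrite mnmDE !mulmnE !mnm1E /= mul1n mul0n add0n. Qed.

Lemma forall_I2 (P : 'I_2 -> Prop) : P 0 -> P 1 -> forall i, P i.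
Proof.
move=> P0 P1 [[|[|i]] lti] //.
- by rewrite (_ : Ordinal lti = 0) //; apply/val_inj.
- by rewrite (_ : Ordinal lti = 1) //; apply/val_inj.
Qed.

Lemma forall_I3 (P : 'I_3 -> Prop) : P 0 -> P 1 -> P 2 -> forall i, P i.
Proof.
move=> P0 P1 P2 [[|[|[|i]]] lti] //.
- by rewrite (_ : Ordinal lti = 0) //; apply/val_inj.
- by rewrite (_ : Ordinal lti = 1) //; apply/val_inj.
- by rewrite (_ : Ordinal lti = 2) //; apply/val_inj.
Qed.

Lemma bmonE (m : 'X_{1..2}) : m = bmon (m 0) (m 1).
Proof. by apply/mnmP; apply: forall_I2; rewrite ?bmon0 ?bmon1. Qed.

Lemma mdeg_bmon a b : mdeg (bmon a b) = (a + b)%N.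
Proof. by rewrite mdegD !mdegMn !mdeg1 !mul1n. Qed.

Lemma bmonD a b c d : (bmon a b + bmon c d)%MM = bmon (a + c) (b + d).
Proof.
by rewrite [LHS]bmonE !mnmDE -!/(bmon _ _) !mulmnE !mnm1E /= !mul1n !mul0n
  !addn0 !add0n.
Qed.

Lemma bmon_eq a b c d : (bmon a b == bmon c d) = (a == c) && (b == d).
Proof.
apply/eqP/andP => [eq|[/eqP-> /eqP->] //].
by rewrite -(bmon0 a b) -[in X in _ /\ X](bmon1 a b) eq bmon0 bmon1.
Qed.

Lemma mpolyX_bmon (R : nzRingType) a b :
  'X_[bmon a b] = 'X_0 ^+ a * 'X_1 ^+ b :> {mpoly R[2]}.
Proof. by rewrite mpolyXD !mpolyXn. Qed.

Lemma bmon_split a b k l : (k <= a)%N -> (l <= b)%N ->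
  bmon a b = (bmon k l + bmon (a - k) (b - l))%MM.
Proof. by move=> ka lb; rewrite bmonD !subnKC. Qed.

Lemma mcoeff_MX_bmon (R : comNzRingType) (p : {mpoly R[2]}) k l a b :
  (p * 'X_[bmon k l])@_(bmon a b)
    = if (k <= a)%N && (l <= b)%N then p@_(bmon (a - k) (b - l)) else 0.
Proof.
case: ifP => [/andP[ka lb]|nle].
  by rewrite (bmon_split ka lb) mcoeffMX.
rewrite [p]mpolyE mulr_suml raddf_sum /= big1 // => m _.
rewrite -scalerAl mcoeffZ -mpolyXD mcoeffX; case: eqP => [eq|_]; last first.
  by rewrite mulr0.
have e0 : (m 0%R + k)%N = a by rewrite -(bmon0 a b) -eq mnmDE bmon0.
have e1 : (m 1%R + l)%N = b by rewrite -(bmon1 a b) -eq mnmDE bmon1.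
by rewrite -e0 -e1 !leq_addl in nle.
Qed.

Lemma mpoly2P (R : nzRingType) (p q : {mpoly R[2]}) :
  (forall a b, p@_(bmon a b) = q@_(bmon a b)) -> p = q.
Proof. by move=> eq; apply/mpolyP => m; rewrite (bmonE m). Qed.

Lemma bform_sum (R : comNzRingType) (e : nat) (p : {mpoly R[2]}) :
  p \is e.-homog ->
  p = \sum_(b < e.+1) (p@_(bmon (e - b) b))%:MP * 'X_[bmon (e - b) b].
Proof.
move=> hp; apply: mpoly2P => a b; rewrite raddf_sum /=.
have [ab|ab] := eqVneq (a + b)%N e; last first.
  rewrite (mcoeff_homog hp) ?mdeg_bmon // big1 // => i _.
  rewrite mcoeffCM mcoeffX bmon_eq; case: andP => [[/eqP ea /eqP eb]|].
    by move: ab; rewrite -ea -eb subnK ?eqxx // -ltnS.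
  by rewrite mulr0.
have lt : (b < e.+1)%N by rewrite ltnS -ab leq_addl.
rewrite (bigD1 (Ordinal lt)) //= big1 ?addr0 => [|i neq].
  by rewrite mcoeffCM mcoeffX -ab addnK eqxx mulr1.
rewrite mcoeffCM mcoeffX bmon_eq; case: andP => [[_ /eqP eb]|].
  by case/eqP: neq; apply/val_inj.
by rewrite mulr0.
Qed.

(** Division of the exponents is truncated, so this is a quotient only if X_0^k
    X_1^l divides every monomial of p. *)
Definition bquot (R : nzRingType) (k l : nat) (p : {mpoly R[2]}) :=
  \sum_(m <- msupp p) p@_m *: 'X_[m - bmon k l].

Lemma bquotK (R : comNzRingType) (k l : nat) (p : {mpoly R[2]}) :
  (forall a b, (a < k)%N || (b < l)%N -> p@_(bmon a b) = 0) ->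
  bquot k l p * 'X_[bmon k l] = p.
Proof.
move=> p0; rewrite [RHS]mpolyE mulr_suml; apply: eq_big_seq => m.
rewrite mcoeff_msupp => mp; rewrite -scalerAl -mpolyXD submK //.
apply/mnm_lepP; apply: forall_I2; rewrite ?bmon0 ?bmon1 leqNgt;
  apply: contra mp => lt; rewrite (bmonE m) p0 ?lt ?orbT //.
Qed.

(** The powers of the two variables form a regular sequence. *)
Lemma powX_coprime (R : comNzRingType) (N : nat) (x y : {mpoly R[2]}) :
  'X_0 ^+ N * x = 'X_1 ^+ N * y ->
  exists z, x = 'X_1 ^+ N * z /\ y = 'X_0 ^+ N * z.
Proof.
have -> : 'X_0 ^+ N = 'X_[bmon N 0] :> {mpoly R[2]}.
  by rewrite mpolyX_bmon mulr1.
have -> : 'X_1 ^+ N = 'X_[bmon 0 N] :> {mpoly R[2]}.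
  by rewrite mpolyX_bmon mul1r.
move=> eq.
have eqc a b : (x * 'X_[bmon N 0])@_(bmon a b) = (y * 'X_[bmon 0 N])@_(bmon a b).
  by rewrite mulrC eq mulrC.
exists (bquot 0 N x).
have xE : x = 'X_[bmon 0 N] * bquot 0 N x.
  rewrite mulrC bquotK // => a b /= lt.
  have := eqc (a + N)%N b; rewrite !mcoeff_MX_bmon leq_addl addnK subn0 leq0n /= => ->.
  by rewrite leqNgt lt.
split=> //; apply: mpoly2P => a b; rewrite [in RHS]mulrC.
have := eqc a (b + N)%N.
rewrite !mcoeff_MX_bmon leq_addl addnK !subn0 andbT /= => <-.
case: ifP => // _; rewrite {1}xE mulrC mcoeff_MX_bmon leq_addl addnK subn0 /=.
by [].
Qed.

(** * Binary forms over an algebraically closed field *)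

Lemma unit_meval_neq0 (K : fieldType) (n : nat) (p : {mpoly K[n]})
    (v : 'I_n -> K) : p \is a GRing.unit -> p.@[v] != 0.
Proof. by move=> up; rewrite -unitfE; exact: (rmorph_unit (meval v)). Qed.

Section BinaryForms.

Variable K : closedFieldType.
Implicit Types (p q : {mpoly K[2]}) (e : nat) (r : K).

(** Forms of a given degree are handled through their dehomogenizations X_0 =
    1, for which roots are available. *)
Definition dehom : {mpoly K[2]} -> {poly K} :=
  mmap (@polyC K) (fun i => if i == 0 then 1 else 'X).

HB.instance Definition _ := GRing.RMorphism.copy dehom
  (mmap (@polyC K) (fun i : 'I_2 => if i == 0 then 1 else 'X)).

Lemma dehomC c : dehom c%:MP = c%:P.
Proof. exact: mmapC. Qed.

Lemma dehomX0 : dehom 'X_0 = 1.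
Proof. by rewrite /dehom mmapX mmap1U. Qed.

Lemma dehomX1 : dehom 'X_1 = 'X.
Proof. by rewrite /dehom mmapX mmap1U. Qed.

Lemma dehom_form e p : p \is e.-homog ->
  dehom p = \poly_(b < e.+1) p@_(bmon (e - b) b).
Proof.
move=> hp; rewrite {1}(bform_sum hp) rmorph_sum poly_def; apply: eq_bigr => b _.
rewrite rmorphM /= dehomC mpolyX_bmon rmorphM !rmorphXn /= dehomX0 dehomX1.
by rewrite expr1n mul1r mul_polyC.
Qed.

Lemma dehom_inj e p : p \is e.-homog -> dehom p = 0 -> p = 0.
Proof.
move=> hp p0; rewrite (bform_sum hp) big1 // => b _.
move/(congr1 (fun f : {poly K} => f`_b)): p0.
by rewrite (dehom_form hp) coef_poly ltn_ord coef0 => ->; rewrite mul0r.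
Qed.

Lemma dehom_root_factor e p r : p \is e.-homog -> (dehom p).[r] = 0 ->
  exists q, p = ('X_1 - r%:MP * 'X_0) * q.
Proof.
move=> hp p0.
pose g : {rmorphism {mpoly K[2]} -> {mpoly K[2]}} :=
  mmap (@mpolyC 2 K) (fun i : 'I_2 => if i == 0 then 'X_0 else r%:MP * 'X_0).
have gX i : g 'X_i = if i == 0 then 'X_0 else r%:MP * 'X_0.
  by rewrite /g /= mmapX mmap1U.
have gC c : g c%:MP = c%:MP by exact: mmapC.
have g0 : g p = 0.
  transitivity ((dehom p).[r]%:MP * 'X_0 ^+ e : {mpoly K[2]}); last first.
    by rewrite p0 mpolyC0 mul0r.
  rewrite (dehom_form hp) horner_poly {1}(bform_sum hp) !rmorph_sum mulr_suml.
  apply: eq_bigr => b _.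
  rewrite rmorphM /= gC mpolyX_bmon rmorphM !rmorphXn /= !gX /= rmorphM rmorphXn.
  rewrite -!mulrA; congr (_ * _); rewrite exprMn mulrCA -exprD subnK //.
  by rewrite -ltnS.
have [|||||q] := rmorph_congr (f := idfun) (g := g)
   (J := fun x => exists q, x = ('X_1 - r%:MP * 'X_0) * q) _ _ _ _ _ p.
- by exists 0; rewrite mulr0.
- by move=> _ _ [a ->] [b ->]; exists (a + b); rewrite mulrDr.
- by move=> a _ [b ->]; exists (a * b); rewrite mulrCA.
- by move=> c; rewrite gC.
- apply: forall_I2; rewrite /= gX /=; first by exists 0; rewrite subrr mulr0.
  by exists 1; rewrite mulr1.
by rewrite g0 subr0 /= => ->; exists q.
Qed.

Definition lform (al be : K) : {mpoly K[2]} := al%:MP * 'X_0 + be%:MP * 'X_1.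

Lemma lform_homog al be : lform al be \is 1.-homog.
Proof.
by rewrite rpredD // homog_mulC // homog_var.
Qed.

Lemma form_linear_factor e p : p \is e.+1.-homog ->
  exists al be q, [/\ (al, be) != 0, q \is e.-homog & p = lform al be * q].
Proof.
move=> hp.
suff [al [be [q [nz pE]]]] : exists al be q, (al, be) != 0 /\ p = lform al be * q.
  exists al, be, (pihomog mdeg e q); split=> //; first exact: pihomogP.
  rewrite -[LHS](pihomog_dE hp) {1}pE mulrC (pihomogMr _ _ (lform_homog _ _)).
  by rewrite subn1 /= mulrC.
have [/closed_rootP [r /eqP pr]|] := boolP (size (dehom p) != 1%N).
  have [q pE] := dehom_root_factor hp pr.
  exists (- r), 1, q; split; first by rewrite xpair_eqE oner_eq0 andbF.
  by rewrite {1}pE /lform mpolyC1 mul1r mpolyCN mulNr addrC.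
rewrite negbK => /size_poly1P [c _ pc].
exists 1, 0, (c%:MP * 'X_0 ^+ e); split; first by rewrite xpair_eqE oner_eq0.
apply/subr0_eq/(dehom_inj (e := e.+1)).
  rewrite rpredB // /lform mpolyC1 mpolyC0 mul0r mul1r addr0 mulrCA -exprS.
  by rewrite homog_mulC // homog_varX.
rewrite rmorphB /= pc /lform !rmorphM /= rmorphD !rmorphM !rmorphXn /= !dehomC.
by rewrite dehomX0 expr1n !mulr1 mul0r addr0 mul1r subrr.
Qed.

(** A binary form is a product of linear ones, so a morphism to a domain that
    kills no linear form kills no form. *)
Lemma form_prod_neq0 e p : p \is e.-homog -> p != 0 ->
  forall (S : idomainType) (f : {rmorphism {mpoly K[2]} -> S}),
  (forall al be, (al, be) != 0 -> f (lform al be) != 0) -> f p != 0.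
Proof.
move=> hp p_neq0 S f fl; elim: e p hp p_neq0 => [|e IHe] p hp p_neq0.
  move: p_neq0; rewrite (homog0_const hp) mpolyC_eq0 -unitfE => unit_p.
  have := rmorph_unit f (rmorph_unit (@mpolyC 2 K) unit_p).
  by apply: contraTneq => ->; rewrite unitr0.
have [al [be [q [nz hq pE]]]] := form_linear_factor hp.
rewrite pE rmorphM mulf_neq0 ?fl // IHe //.
by apply: contraNneq p_neq0 => q0; rewrite pE q0 mulr0.
Qed.

Lemma gcdp_bezout (p q : {poly K}) : exists u v, gcdp p q = u * p + v * q.
Proof.
have [[u v] /=] := Bezoutp p q; rewrite eqp_sym => /eqpf_eq [c _ ->].
by exists (c *: u), (c *: v); rewrite scalerDr !scalerAl.
Qed.

Lemma bezout_poly3 (g : 'I_3 -> {poly K}) :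
  (forall r, exists i, (g i).[r] != 0) ->
  exists a : 'I_3 -> {poly K}, \sum_i a i * g i = 1.
Proof.
move=> g_neq0.
have [u0 [u1 hu]] := gcdp_bezout (g 0) (g 1).
have [v0 [v1]] := gcdp_bezout (gcdp (g 0) (g 1)) (g 2).
set h := gcdp (gcdp _ _) _ => hv.
have hdvd i : exists c, g i = c * h.
  have [h1 h2] : h %| gcdp (g 0) (g 1) /\ h %| g 2.
    by rewrite dvdp_gcdl dvdp_gcdr.
  suff /dvdpP[c ->] : h %| g i by exists c.
  move: i; apply: forall_I3 => //; apply: dvdp_trans h1 _.
    by rewrite dvdp_gcdl.
  by rewrite dvdp_gcdr.
have /eqP/size_poly1P [k k_neq0 hk] : size h = 1%N.
  apply/eqP; apply: contraT => /closed_rootP [r /eqP hr].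
  have [i] := g_neq0 r; have [c ->] := hdvd i.
  by rewrite hornerM hr mulr0 eqxx.
exists (fun i => k^-1%:P * (if i == 0 then v0 * u0 else
                            if i == 1 then v0 * u1 else v1)).
rewrite !big_ord_recl big_ord0 /= addr0.
have -> : lift 0 0 = 1 :> 'I_3 by apply/val_inj.
have -> : lift 0 (lift 0 0) = 2 :> 'I_3 by apply/val_inj.
rewrite /= -!mulrA -!mulrDr addrA -mulrDr -hu -hv hk -polyCM mulVf //.
Qed.

(** A right inverse of dehomogenization. *)
Definition rehom e (a : {poly K}) : {mpoly K[2]} :=
  \sum_(b < e.+1) (a`_b)%:MP * 'X_[bmon (e - b) b].

Lemma rehom_homog e a : rehom e a \is e.-homog.
Proof.
apply: rpred_sum => b _; apply: homog_mulC; rewrite -[X in X.-homog](subnK (ltn_ord b : (b <= e)%N)).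
by rewrite -mdeg_bmon homog_mpolyX.
Qed.

Lemma rehomK e (a : {poly K}) : (size a <= e.+1)%N -> dehom (rehom e a) = a.
Proof.
move=> size_a; apply/polyP => k.
rewrite (dehom_form (rehom_homog _ _)) coef_poly; case: ltnP => [lt|ge].
  rewrite raddf_sum /= (bigD1 (Ordinal lt)) //= big1 ?addr0 => [|b neq].
    by rewrite mcoeffCM mcoeffX eqxx mulr1.
  rewrite mcoeffCM mcoeffX bmon_eq [b == k :> nat](negbTE neq) andbF mulr0 //.
by rewrite nth_default // (leq_trans size_a).
Qed.

(** The dehomogenizations have no common root, hence generate the unit ideal;
    homogenizing a Bezout relation yields a power of X_0. *)
Lemma forms_bezout_X0 e (f : 'I_3 -> {mpoly K[2]}) :
  (forall i, f i \is e.-homog) -> no_common_factor f ->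
  exists M (c : 'I_3 -> {mpoly K[2]}), 'X_0 ^+ M = \sum_i c i * f i.
Proof.
move=> hf coprime_f.
have [|a Ea] := bezout_poly3 (g := fun i => dehom (f i)).
  move=> r; apply/existsP; apply: contraT; rewrite negb_exists => /forallP f0.
  have u1 : 'X_1 - r%:MP * 'X_0 \is a @GRing.unit {mpoly K[2]}.
    apply: coprime_f => i; have := f0 i; rewrite negbK => /eqP fr.
    have [q ->] := dehom_root_factor (hf i) fr.
    by exists q; rewrite mulrC.
  have := unit_meval_neq0 (fun i => if i == 0 then 1 else r) u1.
  by rewrite mevalB mevalM mevalC !mevalXU mulr1 subrr eqxx.
pose m := \max_i size (a i).
exists (m + e)%N, (fun i => rehom m (a i)).
apply/subr0_eq/(dehom_inj (e := m + e)).
  rewrite rpredB ?homog_varX // rpred_sum // => i _.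
  exact: dhomogM (rehom_homog _ _) (hf i).
rewrite rmorphB rmorphXn /= dehomX0 expr1n rmorph_sum /= -Ea.
apply/eqP; rewrite subr_eq0; apply/eqP/eq_bigr => i _.
by rewrite rmorphM /= rehomK // ltnW // ltnS leq_bigmax.
Qed.
Let swap : {rmorphism {mpoly K[2]} -> {mpoly K[2]}} :=
  mmap (@mpolyC 2 K) (fun i : 'I_2 => if i == 0 then 'X_1 else 'X_0).

Let swapC c : swap c%:MP = c%:MP.
Proof. exact: mmapC. Qed.

Let swapX i : swap 'X_i = if i == 0 then 'X_1 else 'X_0.
Proof. by rewrite /swap /= mmapX mmap1U. Qed.

Let swapX0 : swap 'X_0 = 'X_1.
Proof. exact: swapX. Qed.

Let swapX1 : swap 'X_1 = 'X_0.
Proof. exact: swapX. Qed.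

Let swapK : involutive swap.
Proof.
apply: (rmorph_mpoly_ext (f := swap \o swap) (g := idfun)) => [c|i] /=.
  by rewrite !swapC.
by move: i; apply: forall_I2; rewrite ?swapX0 ?swapX1 ?swapX0.
Qed.

Let swap_homog e p : p \is e.-homog -> swap p \is e.-homog.
Proof.
move=> hp; have := homog_rmorph (e := 0) (k := 1) (g := swap) _ _ hp.
rewrite add0n mul1n; apply=> [m|i]; first by rewrite swapC homog_mpolyC.
by rewrite swapX; case: ifP; rewrite homog_var.
Qed.

(** Forms without a common factor have no common zero on the projective line,
    hence generate an ideal containing a power of each variable. *)
Lemma forms_bezout e (f : 'I_3 -> {mpoly K[2]}) (k : 'I_2) :
  (forall i, f i \is e.-homog) -> no_common_factor f ->
  exists M (c : 'I_3 -> {mpoly K[2]}), 'X_k ^+ M = \sum_i c i * f i.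
Proof.
move=> hf coprime_f; move: k; apply: forall_I2; first exact: forms_bezout_X0 hf _.
have [i||M [c Ec]] := @forms_bezout_X0 e (fun i => swap (f i)).
- exact: swap_homog.
- move=> p Ep; rewrite -[p]swapK; apply: rmorph_unit; apply: coprime_f => i.
  by have [q Eq] := Ep i; exists (swap q); rewrite -rmorphM /= -Eq swapK.
exists M, (fun i => swap (c i)); rewrite -[LHS]swapK.
have -> : swap ('X_1 ^+ M) = 'X_0 ^+ M by rewrite rmorphXn; congr (_ ^+ M).
rewrite Ec.
by rewrite rmorph_sum; apply: eq_bigr => i _; rewrite rmorphM /= swapK.
Qed.

End BinaryForms.

(** * The ring of polynomials in T and X, seen as polynomials in T over K[X] *)

Section BigradedRing.

Variable K : fieldType.
Local Notation A := {mpoly {mpoly K[2]}[3]}.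
Local Notation B := {mpoly {mpoly K[3]}[2]}.
Implicit Types (x : A) (y : {mpoly K[3]}) (a b k l : nat).

HB.instance Definition _ :=
  GRing.RMorphism.copy (@x_poly K) (map_mpoly (@mpolyC 2 K)).

(** Exchanges the roles of T and X. Degrees in T are read off on the
    polynomials in T over K[X]. *)
Definition toB : A -> B := mmap (map_mpoly (@mpolyC 3 K)) (fun j => ('X_j)%:MP).
HB.instance Definition _ := GRing.RMorphism.copy toB
  (mmap (map_mpoly (@mpolyC 3 K)) (fun j : 'I_3 => ('X_j)%:MP : B)).

Lemma toBM x x' : toB (x * x') = toB x * toB x'.
Proof. exact: (rmorphM toB). Qed.

Lemma toBD x x' : toB (x + x') = toB x + toB x'.
Proof. exact: (rmorphD toB). Qed.

Definition toA : B -> A := mmap (@x_poly K) (tvar K).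
HB.instance Definition _ := GRing.RMorphism.copy toA
  (mmap (@x_poly K) (tvar K)).

Lemma x_polyC c : x_poly c%:MP = (c%:MP)%:MP :> A.
Proof. exact: map_mpolyC. Qed.

Lemma x_polyX j : x_poly 'X_j = 'X_j :> A.
Proof. by rewrite /x_poly map_mpolyX. Qed.

Lemma mcoeff_x_poly y w : (x_poly y : A)@_w = (y@_w)%:MP.
Proof. exact: mcoeff_map_mpoly. Qed.

Lemma x_poly_inj : injective (@x_poly K).
Proof.
move=> y1 y2 eq; apply/mpolyP => w.
by apply: (can_inj (@mpolyCK 2 K)); rewrite -!mcoeff_x_poly eq.
Qed.

Lemma x_poly_homog j y : y \is j.-homog -> (x_poly y : A) \is j.-homog.
Proof.
move=> hy; apply/dhomogP => w; rewrite mcoeff_msupp mcoeff_x_poly mpolyC_eq0.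
by rewrite -mcoeff_msupp; apply: mdeg_homog hy.
Qed.

Lemma toB_C (c : {mpoly K[2]}) : toB c%:MP = map_mpoly (@mpolyC 3 K) c.
Proof. exact: mmapC. Qed.

Lemma toB_X j : toB 'X_j = ('X_j)%:MP.
Proof. by rewrite /toB mmapX mmap1U. Qed.

Lemma toB_t i : toB (tvar K i) = 'X_i.
Proof. by rewrite toB_C map_mpolyX. Qed.

Lemma toA_C y : toA y%:MP = x_poly y.
Proof. exact: mmapC. Qed.

Lemma toA_X i : toA 'X_i = tvar K i.
Proof. by rewrite /toA mmapX mmap1U. Qed.

Lemma toB_x y : toB (x_poly y) = y%:MP.
Proof.
apply: (rmorph_mpoly_ext (f := toB \o @x_poly K) (g := @mpolyC 2 _)) => [c|j] /=.
  by rewrite x_polyC toB_C map_mpolyC.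
by rewrite x_polyX toB_X.
Qed.

Lemma toBK : cancel toB toA.
Proof.
apply: (rmorph_mpoly_ext (f := toA \o toB) (g := idfun)) => [c|j] /=.
  apply: (rmorph_mpoly_ext (f := toA \o toB \o @mpolyC 3 _) (g := @mpolyC 3 _)
    _ _ c) => [k|i] /=.
    by rewrite toB_C map_mpolyC toA_C x_polyC.
  by rewrite toB_t toA_X.
by rewrite toB_X toA_C x_polyX.
Qed.

Lemma toAK : cancel toA toB.
Proof.
apply: (rmorph_mpoly_ext (f := toB \o toA) (g := idfun)) => [c|j] /=.
  by rewrite toA_C toB_x.
by rewrite toA_X toB_t.
Qed.

Lemma mcoeff_toB x m w : (toB x)@_m@_w = x@_w@_m.
Proof.
rewrite [x]mpolyE rmorph_sum !raddf_sum /=.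
apply: eq_bigr => w' _; rewrite -mul_mpolyC rmorphM /= toB_C.
have -> : toB 'X_[w'] = 'X_[w']%:MP.
  rewrite !mpolyXE_id !rmorph_prod; apply: eq_bigr => j _.
  by rewrite !rmorphXn /= toB_X.
rewrite [X in X@_m@_w]mulrC [X in X@_w]mcoeffCM mcoeff_map_mpoly.
rewrite [X in X@_w]mulrC !mcoeffCM !mcoeffX.
by case: eqP => _; rewrite ?mulr1 ?mulr0 ?mcoeff0.
Qed.

Lemma toB_homogP i x :
  (forall w, x@_w \is i.-homog) <-> toB x \is i.-homog.
Proof.
split=> [hx|hx w].
  apply/dhomogP => m; rewrite mcoeff_msupp => xm.
  have [w] : exists w, (toB x)@_m@_w != 0.
    by exists (mlead (toB x)@_m); rewrite mleadc_eq0.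
  by rewrite mcoeff_toB -mcoeff_msupp; apply: mdeg_homog.
apply/dhomogP => m; rewrite mcoeff_msupp -mcoeff_toB => xm.
have : m \in msupp (toB x).
  by rewrite mcoeff_msupp; apply: contraNneq xm => ->; rewrite mcoeff0.
exact: mdeg_homog.
Qed.

Definition thomog i x : Prop := forall w, x@_w \is i.-homog.

Lemma toB_homog i x : thomog i x -> toB x \is i.-homog.
Proof. by move/toB_homogP. Qed.

Lemma thomog_toA i (z : B) : z \is i.-homog -> thomog i (toA z).
Proof. by move=> hz; apply/toB_homogP; rewrite toAK. Qed.

Lemma thomogM i i' x x' : thomog i x -> thomog i' x' -> thomog (i + i') (x * x').
Proof.
move=> /toB_homog h /toB_homog h'; apply/toB_homogP; rewrite (rmorphM toB).
exact: dhomogM h h'.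
Qed.

Lemma thomogD i x x' : thomog i x -> thomog i x' -> thomog i (x + x').
Proof. by move=> h h' w; rewrite mcoeffD; apply: rpredD (h w) (h' w). Qed.

Lemma thomogN i x : thomog i x -> thomog i (- x).
Proof. by move=> h w; rewrite mcoeffN rpredN; apply: h. Qed.

Lemma thomog0 i : thomog i 0.
Proof. by move=> w; rewrite mcoeff0 rpred0. Qed.

Lemma thomog_x y : thomog 0 (x_poly y).
Proof. by move=> w; rewrite mcoeff_x_poly homog_mpolyC. Qed.

Lemma thomog_tvar i : thomog 1 (tvar K i).
Proof. by apply/toB_homogP; rewrite toB_t homog_var. Qed.

Lemma thomog_sum (I : Type) (r : seq I) (F : I -> A) i :
  (forall s, thomog i (F s)) -> thomog i (\sum_(s <- r) F s).
Proof.
by move=> hF; apply: big_ind => //; [exact: thomog0|exact: thomogD].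
Qed.

Lemma bihomogM i j i' j' x x' :
  bihomog i j x -> bihomog i' j' x' -> bihomog (i + i') (j + j') (x * x').
Proof.
by move=> [h1 h2] [h1' h2']; split; [apply: dhomogM|apply: thomogM].
Qed.

Lemma bihomogD i j x x' :
  bihomog i j x -> bihomog i j x' -> bihomog i j (x + x').
Proof.
by move=> [h1 h2] [h1' h2']; split; [apply: rpredD|apply: thomogD].
Qed.

Lemma bihomogN i j x : bihomog i j x -> bihomog i j (- x).
Proof. by move=> [h1 h2]; split; [rewrite rpredN|apply: thomogN]. Qed.

Lemma bihomogB i j x x' :
  bihomog i j x -> bihomog i j x' -> bihomog i j (x - x').
Proof. by move=> h h'; apply: bihomogD => //; apply: bihomogN. Qed.

Lemma bihomog0 i j : bihomog i j (0 : A).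
Proof. by split; [exact: rpred0|exact: thomog0]. Qed.

Lemma bihomog_x j y : y \is j.-homog -> bihomog 0 j (x_poly y).
Proof. by move=> hy; split; [exact: x_poly_homog|exact: thomog_x]. Qed.

Lemma bihomog1 : bihomog 0 0 (1 : A).
Proof. by rewrite -(rmorph1 (@x_poly K)); apply: bihomog_x; rewrite dhomog1. Qed.

Lemma bihomog_cast i j i' j' x :
  bihomog i j x -> i = i' -> j = j' -> bihomog i' j' x.
Proof. by move=> hx <- <-. Qed.

Lemma bihomogX i j x n : bihomog i j x -> bihomog (i * n) (j * n) (x ^+ n).
Proof.
move=> hx; elim: n => [|n IHn]; first by rewrite !muln0; apply: bihomog1.
by rewrite exprS !mulnS; apply: bihomogM.
Qed.

Lemma bihomog_sum (I : Type) (r : seq I) (F : I -> A) i j :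
  (forall s, bihomog i j (F s)) -> bihomog i j (\sum_(s <- r) F s).
Proof.
move=> hF; apply: big_ind => //; [exact: bihomog0|exact: bihomogD].
Qed.

Lemma bihomog_tvar i : bihomog 1 0 (tvar K i).
Proof. by split; [exact: homog_mpolyC|exact: thomog_tvar]. Qed.

Definition tmon a b : A := tvar K 0 ^+ a * tvar K 1 ^+ b.

Lemma toB_tmon a b : toB (tmon a b) = 'X_[bmon a b].
Proof. by rewrite rmorphM !rmorphXn /= !toB_t mpolyX_bmon. Qed.

Lemma tmonM a b k l : tmon a b * tmon k l = tmon (a + k) (b + l).
Proof. by rewrite /tmon !exprD; ring. Qed.

Lemma bihomog_tmon a b : bihomog (a + b) 0 (tmon a b).
Proof.
have := bihomogM (bihomogX a (bihomog_tvar 0)) (bihomogX b (bihomog_tvar 1)).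
by rewrite !mul1n !mul0n.
Qed.

(** The coefficient of T_0^a T_1^b; it is kept in the ring of polynomials in T
    and X, so that expansions in T are identities of that ring. *)
Definition cf a b x : A := x_poly (toB x)@_(bmon a b).

Lemma cf_is_additive a b : additive (cf a b).
Proof. by move=> x x'; rewrite /cf rmorphB mcoeffB rmorphB. Qed.

HB.instance Definition _ a b :=
  GRing.isAdditive.Build A A (cf a b) (cf_is_additive a b).

Lemma cf_Mtmon a b k l x : cf a b (x * tmon k l)
  = if (k <= a)%N && (l <= b)%N then cf (a - k) (b - l) x else 0.
Proof.
rewrite /cf rmorphM /= toB_tmon mcoeff_MX_bmon.
by case: ifP => // _; rewrite rmorph0.
Qed.

Lemma cf_x a b y : cf a b (x_poly y) = if (a == 0)%N && (b == 0)%N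
  then x_poly y else 0.
Proof.
rewrite /cf toB_x mcoeffC.
have -> : 0%MM = bmon 0 0 by rewrite [LHS]bmonE !mnm0E.
rewrite bmon_eq; case: ifP => _; first by rewrite mulr1.
by rewrite mulr0 rmorph0.
Qed.

Lemma cf_sum D x : thomog D x ->
  x = \sum_(b < D.+1) cf (D - b) b x * tmon (D - b) b.
Proof.
move=> /toB_homog hx; apply: (can_inj toBK).
rewrite rmorph_sum /= {1}(bform_sum hx).
by apply: eq_bigr => b _; rewrite rmorphM /= toB_tmon /cf toB_x.
Qed.

Lemma thomog_cf x a b : thomog 0 (cf a b x).
Proof. exact: thomog_x. Qed.

Lemma cf0_id x : thomog 0 x -> x = cf 0 0 x.
Proof. by move=> /cf_sum {1}->; rewrite big_ord1 /tmon !expr0 !mulr1. Qed.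

Lemma tconstP x : thomog 0 x -> exists y, x = x_poly y.
Proof. by move=> /cf0_id ->; exists (toB x)@_(bmon 0 0). Qed.

Definition tcomp k x : A := toA (pihomog mdeg k (toB x)).

Lemma tcomp_is_additive k : additive (tcomp k).
Proof. by move=> x x'; rewrite /tcomp !rmorphB raddfB rmorphB. Qed.

HB.instance Definition _ k :=
  GRing.isAdditive.Build A A (tcomp k) (tcomp_is_additive k).

Lemma thomog_tcomp k x : thomog k (tcomp k x).
Proof. exact: thomog_toA (pihomogP _ _ _). Qed.

Lemma tcomp_id k x : thomog k x -> tcomp k x = x.
Proof. by move=> /toB_homog hx; rewrite /tcomp pihomog_dE // toBK. Qed.

Lemma tcomp_Mr i k x h : thomog i h ->
  tcomp k (x * h) = if (i <= k)%N then tcomp (k - i) x * h else 0.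
Proof.
move=> /toB_homog hh; rewrite /tcomp (rmorphM toB) (pihomogMr _ _ hh).
case: ifP => _; last exact: (rmorph0 toA).
by rewrite -[in RHS](toBK h); apply: (rmorphM toA).
Qed.

Lemma tcomp_homog j k x : x \is j.-homog -> tcomp k x \is j.-homog.
Proof.
move=> hx; apply/dhomogP => w; rewrite mcoeff_msupp => xw.
apply: (mdeg_homog hx); rewrite mcoeff_msupp; apply: contraNneq xw => x0.
apply/eqP/mpolyP => m; rewrite -mcoeff_toB /tcomp toAK mcoeff_pihomog mcoeff0.
by case: ifP => _; rewrite ?mcoeff0 // mcoeff_toB x0 mcoeff0.
Qed.

Lemma tcomp_sum x : x = \sum_(k < msize (toB x)) tcomp k x.
Proof.
by rewrite -{1}(toBK x) {1}[toB x]pihomog_sum_comps (rmorph_sum toA).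
Qed.

Definition bicomp i j x : A := tcomp i (pihomog mdeg j x).

Lemma bicomp_is_additive i j : additive (bicomp i j).
Proof. by move=> x x'; rewrite /bicomp !raddfB. Qed.

HB.instance Definition _ i j :=
  GRing.isAdditive.Build A A (bicomp i j) (bicomp_is_additive i j).

Lemma bihomog_bicomp i j x : bihomog i j (bicomp i j x).
Proof.
by split; [exact: tcomp_homog (pihomogP _ _ _)|exact: thomog_tcomp].
Qed.

Lemma bicomp_id i j x : bihomog i j x -> bicomp i j x = x.
Proof. by move=> [hx hx']; rewrite /bicomp pihomog_dE // tcomp_id. Qed.

Lemma bicomp_Mr i j k l x h : bihomog k l h ->
  bicomp i j (x * h)
    = if (k <= i)%N && (l <= j)%N then bicomp (i - k) (j - l) x * h else 0.
Proof.
move=> [hh hh']; rewrite /bicomp (pihomogMr _ _ hh) andbC.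
by case: ifP => _ /=; rewrite ?raddf0 ?(tcomp_Mr _ _ hh') //; case: ifP.
Qed.

Lemma bicomp_sum x : exists N,
  x = \sum_(j < msize x) \sum_(i < N) bicomp i j x.
Proof.
pose N := \max_(j : 'I_(msize x)) msize (toB (pihomog mdeg j x)); exists N.
rewrite {1}[x]pihomog_sum_comps; apply: eq_bigr => j _.
rewrite {1}[pihomog mdeg j x]tcomp_sum.
rewrite (big_ord_widen N (fun i => tcomp i (pihomog mdeg j x))); last first.
  exact: (leq_bigmax_cond (F := fun j : 'I__ => msize (toB (pihomog mdeg j x)))).
rewrite big_mkcond /=; apply: eq_bigr => i _; case: ltnP => // ge.
rewrite /bicomp /tcomp pihomogE big_seq_cond big_pred0 ?rmorph0 // => m.
apply/negbTE/negP => /andP[/msize_mdeg_lt lt /eqP eq].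
by move: lt; rewrite eq ltnNge ge.
Qed.

End BigradedRing.

(** * Residues of elements of (P, Q) : (f, g) *)

Section Residues.

Variable A : comNzRingType.
Implicit Types (f g p q x y z : A).

Definition mem2 p q x : Prop := exists a b, x = a * p + b * q.

Lemma mem2_0 p q : mem2 p q 0.
Proof. by exists 0, 0; ring. Qed.

Lemma mem2D p q x y : mem2 p q x -> mem2 p q y -> mem2 p q (x + y).
Proof.
by move=> [a [b ->]] [c [d ->]]; exists (a + c), (b + d); ring.
Qed.

Lemma mem2M p q a x : mem2 p q x -> mem2 p q (a * x).
Proof. by move=> [b [c ->]]; exists (a * b), (a * c); ring. Qed.

Lemma mem2_sum p q (I : Type) (r : seq I) (F : I -> A) :
  (forall i, mem2 p q (F i)) -> mem2 p q (\sum_(i <- r) F i).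
Proof.
move=> hF; apply: big_ind => //; [exact: mem2_0|exact: mem2D].
Qed.

Lemma mem2l p q a : mem2 p q (a * p).
Proof. by exists a, 0; ring. Qed.

Lemma mem2r p q a : mem2 p q (a * q).
Proof. by exists 0, a; ring. Qed.

Definition coprime2 f g : Prop :=
  forall x y, f * x = g * y -> exists z, x = g * z /\ y = f * z.

Lemma coprime2_sym f g : coprime2 f g -> coprime2 g f.
Proof. by move=> fg x y /esym/fg [z [-> ->]]; exists z. Qed.

Variables P Q : A.

(** The class of e modulo (f, g) is the image of the class of p under the
    duality isomorphism between ((P, Q) : (f, g)) / (P, Q) and ((f, g) : (P,
    Q)) / (f, g) given by two regular sequences. Writing f p and g p in terms
    of P and Q, the two resulting expressions of f g p differ by e times the
    Koszul relation (Q, -P). *)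
Definition residue f g p e : Prop := exists al be ga de,
  [/\ f * p = al * P + be * Q, g * p = ga * P + de * Q,
      g * al - f * ga = e * Q & g * be - f * de = - e * P].

Lemma residueD f g p e p' e' :
  residue f g p e -> residue f g p' e' -> residue f g (p + p') (e + e').
Proof.
move=> [a [b [c [d [h1 h2 h3 h4]]]]] [a' [b' [c' [d' [h1' h2' h3' h4']]]]].
exists (a + a'), (b + b'), (c + c'), (d + d'); split.
- by rewrite mulrDr h1 h1'; ring.
- by rewrite mulrDr h2 h2'; ring.
- by transitivity (e * Q + e' * Q); [rewrite -h3 -h3'|]; ring.
- by transitivity (- e * P + - e' * P); [rewrite -h4 -h4'|]; ring.
Qed.

Lemma residueM f g p e x : residue f g p e -> residue f g (x * p) (x * e).
Proof.
move=> [a [b [c [d [h1 h2 h3 h4]]]]].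
exists (x * a), (x * b), (x * c), (x * d); split.
- by rewrite mulrCA h1; ring.
- by rewrite mulrCA h2; ring.
- by transitivity (x * (e * Q)); [rewrite -h3|]; ring.
- by transitivity (x * (- e * P)); [rewrite -h4|]; ring.
Qed.

Lemma residueN f g p e : residue f g p e -> residue f g (- p) (- e).
Proof. by rewrite -mulN1r -[- e]mulN1r; apply: residueM. Qed.

Lemma residueB f g p e p' e' :
  residue f g p e -> residue f g p' e' -> residue f g (p - p') (e - e').
Proof. by move=> h h'; apply: residueD => //; apply: residueN. Qed.

Lemma residue0 f g : residue f g 0 0.
Proof. by exists 0, 0, 0, 0; split; ring. Qed.

Lemma residue_sum f g (I : Type) (r : seq I) (F E : I -> A) :
  (forall i, residue f g (F i) (E i)) ->
  residue f g (\sum_(i <- r) F i) (\sum_(i <- r) E i).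
Proof.
move=> hFE; elim: r => [|i r IHr]; first by rewrite !big_nil; apply: residue0.
by rewrite !big_cons; apply: residueD.
Qed.

Lemma residue_memP f g p e : residue f g p e -> mem2 f g (e * P).
Proof.
move=> [a [b [c [d [_ _ _ h]]]]]; exists d, (- b).
by rewrite -[e * P]opprK -mulNr -h; ring.
Qed.

(** Subtracting f times the second expression from g times the first gives a
    relation between P and Q, hence a multiple of the Koszul one. *)
Lemma residue_exists f g p : coprime2 P Q ->
  mem2 P Q (f * p) -> mem2 P Q (g * p) -> exists e, residue f g p e.
Proof.
move=> PQ [al [be h1]] [ga [de h2]].
have [|e [h3 h4]] := PQ (g * al - f * ga) (f * de - g * be).
  have : g * (f * p) = f * (g * p) by ring.
  rewrite h1 h2 => /eqP; rewrite -subr_eq0 => /eqP eq; apply/subr0_eq.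
  by rewrite -eq; ring.
exists e, al, be, ga, de; split=> //; first by rewrite h3 mulrC.
by rewrite mulNr -[e * P]mulrC -h4; ring.
Qed.

(** If the residue e = f x + g y vanishes modulo (f, g), the coefficients of
    f p and g p can be corrected by multiples of (Q, -P) until they are
    divisible by f and g respectively. *)
Lemma mem2_residue f g p e : GRing.lreg f -> coprime2 f g ->
  residue f g p e -> mem2 f g e -> mem2 P Q p.
Proof.
move=> f_reg fg [al [be [ga [de [h1 h2 h3 h4]]]]] [x [y eE]].
have [|z [alE _]] := coprime2_sym fg (x := al - y * Q) (y := ga + x * Q).
  by apply/subr0_eq; rewrite eE in h3; rewrite -(subrr ((x * f + y * g) * Q))
    -{1}h3; ring.
have [|w [beE _]] := coprime2_sym fg (x := be + y * P) (y := de - x * P).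
  by apply/subr0_eq; rewrite eE in h4; rewrite -(subrr (- (x * f + y * g) * P))
    -{1}h4; ring.
exists z, w; apply: f_reg.
have {}alE : al = f * z + y * Q by rewrite -alE subrK.
have {}beE : be = f * w - y * P by rewrite -beE addrK.
by rewrite /= h1 alE beE; ring.
Qed.

(** For p in (P, Q) the expressions of f p and g p differ from the obvious ones
    by Koszul relations, whose coefficients s and t exhibit e. *)
Lemma residue_mem2 f g p e : coprime2 P Q -> GRing.lreg Q ->
  residue f g p e -> mem2 P Q p -> mem2 f g e.
Proof.
move=> PQ Q_reg [al [be [ga [de [h1 h2 h3 h4]]]]] [x [y pE]].
have [|s [alE _]] := PQ (al - f * x) (f * y - be).
  apply/subr0_eq; rewrite -(subrr (al * P + be * Q)) -{2}h1 pE; ring.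
have [|t [gaE _]] := PQ (ga - g * x) (g * y - de).
  apply/subr0_eq; rewrite -(subrr (ga * P + de * Q)) -{2}h2 pE; ring.
exists (- t), s; apply: Q_reg; rewrite [Q * e]mulrC -h3.
by rewrite -[al](subrK (f * x)) -[ga](subrK (g * x)) alE gaE; ring.
Qed.

End Residues.

(** Cramer's rule: multiplying the determinant by x or y lands in (P, Q), and
    the residue records the cofactors a and b that complete x and y to f = a x
    and g = b y. *)
Lemma residue_sylvester (A : comNzRingType) (a b x y P0 P1 Q0 Q1 : A) :
  residue (x * P0 + y * P1) (x * Q0 + y * Q1) (a * x) (b * y)
    (P0 * Q1 - P1 * Q0) (a * b).
Proof.
by exists (a * Q1), (- (a * P1)), (- (b * Q0)), (b * P0); split; ring.
Qed.

Section MorleyResidue.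

Variables (A S : comNzRingType) (iA : {rmorphism A -> S}) (L : {additive S -> A}).
Hypothesis L_linear : forall a s, L (iA a * s) = a * L s.

Variables (t0 t1 f g P Q : A) (s0 s1 sf sg P' Q' P0 P1 Q0 Q1 D0 D1 : S).
Hypothesis fE : iA f - sf = D0 * (iA t0 - s0).
Hypothesis gE : iA g - sg = D1 * (iA t1 - s1).
Hypothesis PE : iA P - P' = P0 * (iA t0 - s0) + P1 * (iA t1 - s1).
Hypothesis QE : iA Q - Q' = Q0 * (iA t0 - s0) + Q1 * (iA t1 - s1).
Hypothesis L_P : forall s, L (s * P') = 0.
Hypothesis L_Q : forall s, L (s * Q') = 0.
Hypothesis L_f : forall s, L (s * sf) = 0.
Hypothesis L_g : forall s, L (s * sg) = 0.

Let L_congr s s' a b c d :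
  s = s' + a * P' + b * Q' + c * sf + d * sg -> L s = L s'.
Proof. by move=> ->; rewrite !raddfD /= L_P L_Q L_f L_g !addr0. Qed.

(** A functional of S that kills P(S), Q(S) and high powers of the variables
    turns the Morley form into an element of (P, Q) : (f, g), whose residue is
    the value of the functional on the kernel D0 * D1. *)
Lemma residue_morley :
  residue P Q f g (L (P0 * Q1 - P1 * Q0)) (L (D0 * D1)).
Proof.
exists (L (D0 * Q1)), (- L (D0 * P1)), (- L (D1 * Q0)), (L (D1 * P0)).
have PE' : P' = iA P - (P0 * (iA t0 - s0) + P1 * (iA t1 - s1)).
  by rewrite -PE subKr.
have QE' : Q' = iA Q - (Q0 * (iA t0 - s0) + Q1 * (iA t1 - s1)).
  by rewrite -QE subKr.
have fE' : sf = iA f - D0 * (iA t0 - s0) by rewrite -fE subKr.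
have gE' : sg = iA g - D1 * (iA t1 - s1) by rewrite -gE subKr.
split.
- rewrite -L_linear.
  transitivity (L (iA P * (D0 * Q1) - iA Q * (D0 * P1))); last first.
    by rewrite raddfB /= !L_linear; ring.
  apply: (L_congr (a := - (D0 * Q1)) (b := D0 * P1)
    (c := P0 * Q1 - P1 * Q0) (d := 0)).
  by rewrite PE' QE' fE'; ring.
- rewrite -L_linear.
  transitivity (L (iA Q * (D1 * P0) - iA P * (D1 * Q0))); last first.
    by rewrite raddfB /= !L_linear; ring.
  apply: (L_congr (a := D1 * Q0) (b := - (D1 * P0))
    (c := 0) (d := P0 * Q1 - P1 * Q0)).
  by rewrite PE' QE' gE'; ring.
- transitivity (L (iA g * (D0 * Q1) + iA f * (D1 * Q0))).
    by rewrite raddfD /= !L_linear; ring.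
  rewrite [RHS]mulrC -L_linear.
  apply: (L_congr (a := 0) (b := - (D0 * D1)) (c := D1 * Q0) (d := D0 * Q1)).
  by rewrite QE' fE' gE'; ring.
- transitivity (- L (iA g * (D0 * P1) + iA f * (D1 * P0))).
    by rewrite raddfD /= !L_linear; ring.
  rewrite mulNr [_ * P]mulrC -L_linear; congr (- _).
  apply: (L_congr (a := - (D0 * D1)) (b := 0) (c := D1 * P0) (d := D0 * P1)).
  by rewrite PE' fE' gE'; ring.
Qed.

End MorleyResidue.

(** * Sequences satisfying a linear recurrence of order two *)

Section BandKernel.

Variable A : comNzRingType.
Variables a b c : A.

(** The determinant, up to the sign (-1)^(j - 1), of the tridiagonal matrix of
    size j - 1 with b on the diagonal and a, c beside it. *)
Fixpoint continuant (j : nat) : A :=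
  match j with
  | 0 => 0
  | 1 => 1
  | (j'.+1 as k).+1 => - b * continuant k - a * c * continuant j'
  end.

Lemma continuantSS j :
  continuant j.+2 = - b * continuant j.+1 - a * c * continuant j.
Proof. by []. Qed.

(** The maximal minors, up to sign, of the matrix with n + 1 rows and n - 1
    columns whose columns are the translates of (a, b, c): the rows k and l are
    deleted. For k < l what remains is block triangular, with blocks of
    determinants a^k, a continuant and c^(n - l). *)
Definition band_minor (n k l : nat) : A :=
  if (k <= l)%N then a ^+ k * continuant (l - k) * c ^+ (n - l)
  else - (a ^+ l * continuant (k - l) * c ^+ (n - k)).

Lemma band_minor_alt n k : band_minor n k k = 0.
Proof. by rewrite /band_minor leqnn subnn mulr0 mul0r. Qed.

Lemma band_minor_anti n k l : band_minor n k l = - band_minor n l k.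
Proof.
rewrite /band_minor; case: (ltngtP k l) => [kl|lk|->]; rewrite ?opprK //.
by rewrite subnn mulr0 mul0r oppr0.
Qed.

Lemma band_minor_rec n k m : (k <= n)%N -> (m.+2 <= n)%N ->
  a * band_minor n k m + b * band_minor n k m.+1 + c * band_minor n k m.+2 = 0.
Proof.
move=> kn mn; have [km|mk|->] := ltngtP k m.+1.
- have {}km : (k <= m)%N by [].
  rewrite /band_minor km !leqW // !subSn // ?leqW // continuantSS.
  have -> : (n - m = (n - m.+2).+2)%N by lia.
  have -> : (n - m.+1 = (n - m.+2).+1)%N by lia.
  by rewrite !exprS; ring.
- have -> : k = (m.+2 + (k - m.+2))%N by lia.
  set j := (k - m.+2)%N.
  have -> : band_minor n (m.+2 + j) m = - (a ^+ m * continuant j.+2 * c ^+ (n - (m.+2 + j))).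
    by rewrite /band_minor ifF; [congr (- (_ * continuant _ * _)); lia|lia].
  have -> : band_minor n (m.+2 + j) m.+1 = - (a ^+ m.+1 * continuant j.+1 * c ^+ (n - (m.+2 + j))).
    by rewrite /band_minor ifF; [congr (- (_ * continuant _ * _)); lia|lia].
  have -> : band_minor n (m.+2 + j) m.+2 = - (a ^+ m.+2 * continuant j * c ^+ (n - (m.+2 + j))).
    rewrite band_minor_anti /band_minor leq_addr.
    by congr (- (_ * continuant _ * _)); lia.
  by rewrite continuantSS !exprS; ring.
- rewrite band_minor_alt /band_minor ltnn leqnSn !subSnn /=.
  have -> : (n - m.+1 = (n - m.+2).+1)%N by lia.
  by rewrite !exprS; ring.
Qed.

Lemma band_minor_recl n l m : (l <= n)%N -> (m.+2 <= n)%N ->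
  a * band_minor n m l + b * band_minor n m.+1 l + c * band_minor n m.+2 l = 0.
Proof.
move=> ln mn; rewrite !(band_minor_anti n _ l) !mulrN -!opprD.
by rewrite band_minor_rec ?oppr0.
Qed.

Lemma band_minorS n k l : (k <= n)%N -> (l <= n)%N ->
  band_minor n.+1 k l = c * band_minor n k l.
Proof.
move=> kn ln; rewrite /band_minor !subSn // !exprS.
by case: ifP => _; ring.
Qed.

Lemma continuant_mod_c j : exists r, continuant j.+1 = (- b) ^+ j + c * r.
Proof.
elim: j => [|j [r IHj]]; first by exists 0; rewrite /= mulr0 addr0.
exists (- b * r - a * continuant j).
by rewrite continuantSS IHj exprS; ring.
Qed.

Hypothesis a_reg : GRing.lreg a.
Hypothesis c_reg : GRing.lreg c.
Hypothesis reg_b : forall x y, b * x = c * y -> exists z, x = c * z.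
Hypothesis reg_a : forall x, mem2 b c (a * x) -> mem2 b c x.

(** Modulo c, the left-hand side is the value at (a, -b) of a binary form with
    coefficients y k; since b, a is a regular sequence modulo c, these
    coefficients are combinations of the trivial relations (b, a) between
    consecutive powers. The division starts from the last coefficient, which a
    power of a multiplies into (b, c). *)
Lemma powers_syz n (y : nat -> A) w :
  \sum_(k < n.+1) y k * a ^+ k * (- b) ^+ (n - k) = c * w ->
  exists z v : nat -> A, [/\ z 0%N = 0, z n.+1 = 0 &
    forall k, (k <= n)%N -> y k = a * z k.+1 + b * z k + c * v k].
Proof.
elim: n y w => [|n IHn] y w.
  rewrite big_ord1 subn0 !expr0 !mulr1 /= => eq.
  by exists (fun=> 0), (fun=> w); split=> // -[|k] // _; rewrite eq; ring.
rewrite big_ord_recr /= subnn expr0 mulr1 => eq.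
have eq' : \sum_(k < n.+1) y k * a ^+ k * (- b) ^+ (n.+1 - k)
    = - b * \sum_(k < n.+1) y k * a ^+ k * (- b) ^+ (n - k).
  rewrite big_distrr; apply: eq_bigr => k _ /=.
  by rewrite subSn ?exprS; [ring|rewrite -ltnS].
(* All other terms are divisible by b modulo c, hence so is a^(n + 1) times the
   last coefficient. *)
have [p [q yE]] : mem2 b c (y n.+1).
  suff mem_a j : mem2 b c (a ^+ j * y n.+1) -> mem2 b c (y n.+1).
    apply: (mem_a n.+1); exists (\sum_(k < n.+1) y k * a ^+ k * (- b) ^+ (n - k)), w.
    by rewrite [w * c]mulrC -eq eq'; ring.
  elim: j => [|j IHj]; first by rewrite mul1r.
  by rewrite exprS -mulrA => /reg_a/IHj.
pose y' k := if k == n then y n - a * p else y k.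
have [|w' Ew'] := reg_b (x := \sum_(k < n.+1) y' k * a ^+ k * (- b) ^+ (n - k))
    (y := a ^+ n.+1 * q - w).
  transitivity (a ^+ n.+1 * y n.+1 - c * w - b * (p * a ^+ n.+1)); last first.
    by rewrite yE; ring.
  rewrite -eq eq' !big_ord_recr /= !subnn /y' eqxx.
  rewrite (eq_bigr (fun k : 'I_n => y k * a ^+ k * (- b) ^+ (n - k))); last first.
    by move=> k _; rewrite ltn_eqF.
  by rewrite !exprS; ring.
have [z [v [z0 zn yzv]]] := IHn _ _ Ew'.
exists (fun k => if k == n.+1 then p else if (k <= n)%N then z k else 0).
exists (fun k => if k == n.+1 then q else v k); split=> //.
- have -> : (n.+2 == n.+1)%N = false by lia.
  by have -> : (n.+2 <= n)%N = false by lia.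
- move=> k; rewrite leq_eqVlt ltnS => /orP[/eqP->|kn].
    have -> : (n.+2 == n.+1)%N = false by lia.
    have -> : (n.+2 <= n)%N = false by lia.
    by rewrite eqxx yE; ring.
  rewrite [k == _]ltn_eqF // kn eqSS; move: (yzv k kn); rewrite /y'.
  have [->|neq] := eqVneq k n.
    by move=> /eqP; rewrite subr_eq => /eqP ->; rewrite zn; ring.
  by rewrite ltn_neqAle neq kn.
Qed.

(** The recurrence for n + 1 divided by c, with its last term isolated. *)
Lemma band_minor_corner n k : (0 < n)%N -> (k <= n)%N ->
  a * band_minor n k n.-1 + b * band_minor n k n = - band_minor n.+1 k n.+1.
Proof.
case: n => // n _ kn; apply: (c_reg) => /=.
apply/eqP; rewrite mulrN -addr_eq0 mulrDr !(mulrCA c).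
rewrite -(band_minorS kn (leqnSn n)) -(band_minorS kn (leqnn n.+1)).
by apply/eqP/band_minor_rec => //; apply: leqW.
Qed.

Lemma band_minor_cornerl n k l : (k.+1 <= n)%N -> (l <= n)%N ->
  a * band_minor n k l + b * band_minor n k.+1 l = - band_minor n.+1 k.+2 l.
Proof.
move=> kn ln; apply: (c_reg).
apply/eqP; rewrite mulrN -addr_eq0 mulrDr !(mulrCA c).
rewrite -(band_minorS (ltnW kn) ln) -(band_minorS kn ln).
by apply/eqP/band_minor_recl => //; apply: leqW.
Qed.

Definition band_rec (n : nat) (y : nat -> A) : Prop :=
  forall m, (m.+2 <= n)%N -> a * y m + b * y m.+1 + c * y m.+2 = 0.

Lemma band_rec_comb n (x : nat -> A) :
  band_rec n (fun l => \sum_(k < n.+1) x k * band_minor n k l).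
Proof.
move=> m mn; rewrite !big_distrr -!big_split big1 //= => k _.
by rewrite !(mulrCA _ (x k)) -!mulrDr band_minor_rec ?mulr0 // -ltnS.
Qed.

(** The sequences satisfying the recurrence form the kernel of the band, and
    its minors generate this kernel when a, b, c is a regular sequence. By
    induction on n, the truncation of y is a combination of the minors for n -
    1; that it extends by one term is a relation among the powers of a and -b
    modulo c, which allows the coefficients to be corrected so that a factor c
    splits off. *)
Lemma band_kernel n (y : nat -> A) : (0 < n)%N -> band_rec n y ->
  exists x : nat -> A, forall l, (l <= n)%N ->
    y l = \sum_(k < n.+1) x k * band_minor n k l.
Proof.
case: n => // n _; elim: n y => [|n IHn] y y_rec.
  exists (fun k => if k == 0%N then y 1%N else - y 0%N) => l.
  rewrite !big_ord_recr big_ord0 /= add0r.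
  by case: l => [|[|]] //= _; rewrite /band_minor /=; ring.
have [|x xE] := IHn y; first by move=> m mn; apply: y_rec; apply: leqW.
have [w Ew] : exists w, \sum_(k < n.+2) x k * a ^+ k * (- b) ^+ (n.+1 - k) = c * w.
  suff [w Ew] : exists w, \sum_(k < n.+2) x k * a ^+ k * (- b) ^+ (n.+1 - k)
      - \sum_(k < n.+2) x k * band_minor n.+2 k n.+2 = c * w.
    have yE : \sum_(k < n.+2) x k * band_minor n.+2 k n.+2 = c * y n.+2.
      have /eqP := y_rec n (leqnn _); rewrite addrC addr_eq0 => /eqP ->.
      rewrite !xE // !big_distrr -big_split -sumrN; apply: eq_bigr => k _ /=.
      rewrite -[band_minor n.+2 k n.+2]opprK -band_minor_corner //; first by ring.
      by rewrite -ltnS.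
    by exists (w + y n.+2); rewrite mulrDr -Ew yE subrK.
  rewrite -sumrB; apply: (big_ind (fun s => exists w, s = c * w)).
  - by exists 0; rewrite mulr0.
  - by move=> _ _ [w1 ->] [w2 ->]; exists (w1 + w2); rewrite mulrDr.
  - move=> k _; have [r rE] := continuant_mod_c (n.+1 - k).
    exists (- x k * a ^+ k * r); have kn : (k <= n.+1)%N by rewrite -ltnS.
    by rewrite /band_minor (leqW kn) subnn (subSn kn) rE expr0; ring.
have [z [v [z0 zn xzv]]] := powers_syz Ew.
(* The parts of x from the trivial relations shift the first index by 2, by the
   recurrence in the first index. *)
pose x' k := (if (k <= n.+1)%N then v k else 0)
  - (if (1 < k)%N then z k.-1 else 0).
have low l : (l <= n.+1)%N -> y l = \sum_(k < n.+3) x' k * band_minor n.+2 k l.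
  move=> ln; rewrite xE //.
  have -> : \sum_(k < n.+2) x k * band_minor n.+1 k l
     = \sum_(k < n.+2) v k * band_minor n.+2 k l
       + \sum_(k < n.+2) (a * z k.+1 + b * z k) * band_minor n.+1 k l.
    rewrite -big_split; apply: eq_bigr => k _ /=.
    have kn : (k <= n.+1)%N by rewrite -ltnS.
    by rewrite (band_minorS kn ln) xzv //; ring.
  have -> : \sum_(k < n.+2) (a * z k.+1 + b * z k) * band_minor n.+1 k l
     = - \sum_(k < n.+1) z k.+1 * band_minor n.+2 k.+2 l.
    under eq_bigr do rewrite mulrDl; rewrite big_split /=.
    rewrite big_ord_recr [X in _ + X]big_ord_recl /= zn z0 !mulr0 !mul0r addr0 add0r.
    rewrite -big_split -sumrN; apply: eq_bigr => k _ /=.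
    by rewrite -mulrN -band_minor_cornerl // /bump /=; ring.
  rewrite /x'; under [RHS]eq_bigr do rewrite mulrBl; rewrite sumrB; congr (_ - _).
    rewrite [RHS]big_ord_recr /= ltnn mul0r addr0.
    by apply: eq_bigr => k _; rewrite -ltnS ltn_ord.
  by rewrite [RHS]big_ord_recl [in RHS]big_ord_recl /= !mul0r !add0r.
exists x' => l; rewrite leq_eqVlt => /orP[/eqP->|/low //].
apply: (c_reg); apply: (addrI (a * y n + b * y n.+1)).
rewrite y_rec //; apply/esym; rewrite !low //.
exact: (band_rec_comb x' (leqnn n.+2)).
Qed.

(** The relation with l = n involves, modulo c, only the powers of a and -b, so
    the x k with k < n lie in (a, b, c) and therefore vanish; the
    remaining one is then killed by a power of a, which is regular. *)
Lemma band_minor_indep n (x : nat -> A) : (0 < n)%N ->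
  (forall k p q r, x k = a * p + b * q + c * r -> x k = 0) ->
  (forall l, (l <= n)%N -> \sum_(k < n.+1) x k * band_minor n k l = 0) ->
  forall k, (k <= n)%N -> x k = 0.
Proof.
case: n => // n _ x_red sum0.
have [w Ew] : exists w, \sum_(k < n.+1) x k * a ^+ k * (- b) ^+ (n - k) = c * w.
  suff : exists w, \sum_(k < n.+1) x k * a ^+ k * (- b) ^+ (n - k)
      - \sum_(k < n.+2) x k * band_minor n.+1 k n.+1 = c * w.
    by rewrite sum0 // subr0.
  rewrite [X in _ - X]big_ord_recr /= band_minor_alt mulr0 addr0 -sumrB.
  apply: (big_ind (fun s => exists w, s = c * w)).
  - by exists 0; rewrite mulr0.
  - by move=> _ _ [w1 ->] [w2 ->]; exists (w1 + w2); rewrite mulrDr.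
  - move=> k _; have [r rE] := continuant_mod_c (n - k).
    exists (- x k * a ^+ k * r); have kn : (k <= n)%N by rewrite -ltnS.
    by rewrite /band_minor (leqW kn) subnn (subSn kn) rE expr0; ring.
have [z [v [_ _ xzv]]] := powers_syz Ew.
have low k : (k <= n)%N -> x k = 0 by move=> /xzv/x_red.
move=> k; rewrite leq_eqVlt => /orP[/eqP->|/low //].
have := sum0 n (leqnSn n); rewrite big_ord_recr big1 ?add0r => [|i _] /=; last first.
  by rewrite low ?mul0r // -ltnS.
rewrite band_minor_anti /band_minor leqnSn subSnn subnn expr0 /= !mulr1 mulrN.
rewrite sub0r => /eqP; rewrite oppr_eq0 mulrC => /eqP xn.
apply: (@lregX _ a n a_reg (x n.+1) 0).
by rewrite /= xn mulr0.
Qed.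

(** ** The maximal minors of a band matrix with an extra column *)

Variable n : nat.
Hypothesis n_gt0 : (0 < n)%N.

(** A second arbitrary column G makes the matrix square, so that its
    determinant is alternating in (F, G); the minors of the band with one
    arbitrary column are the case G = delta k. *)
Definition band_mx (F G : 'I_n.+1 -> A) : 'M[A]_n.+1 :=
  \matrix_(k, m)
    if m.+1 == n then F k else if m == n :> nat then G k
    else if k == m :> nat then a
    else if k == m.+1 :> nat then b
    else if k == m.+2 :> nat then c else 0.

Let j1 : 'I_n.+1 := inord n.-1.
Let j1S : j1.+1 = n.
Proof. by rewrite inordK ?prednK. Qed.

Let j1_max : j1 != ord_max.
Proof. by apply/eqP => /(congr1 val) /= eq; move: j1S; rewrite eq; lia. Qed.

Let cofactor_col_ext (M N : 'M[A]_n.+1) i j :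
  (forall i' j', j' != j -> M i' j' = N i' j') -> cofactor M i j = cofactor N i j.
Proof.
move=> MN; congr (_ * \det _); apply/matrixP => i' j'.
by rewrite !mxE MN // eq_sym neq_lift.
Qed.

Definition delta (k i : 'I_n.+1) : A := (i == k)%:R.

Lemma band_mx_suml F G :
  \det (band_mx F G) = \sum_k F k * \det (band_mx (delta k) G).
Proof.
have detE F' : \det (band_mx F' G) = \sum_k F' k * cofactor (band_mx F G) k j1.
  rewrite (expand_det_col _ j1); apply: eq_bigr => k _.
  rewrite mxE j1S eqxx; congr (_ * _); apply: cofactor_col_ext => i' j' neq.
  rewrite !mxE; suff -> : (j'.+1 == n)%N = false by [].
  apply: contraNF neq => /eqP eq.
  by apply/eqP/val_inj/succn_inj; rewrite eq j1S.
rewrite detE; apply: eq_bigr => k _; rewrite detE (bigD1 k) //= big1 ?addr0.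
  by rewrite /delta eqxx mul1r.
by move=> i ik; rewrite /delta (negbTE ik) mul0r.
Qed.

Lemma band_mx_alt F : \det (band_mx F F) = 0.
Proof.
rewrite -det_tr (determinant_alternate j1_max) // => i; rewrite !mxE j1S eqxx /=.
by rewrite if_same.
Qed.

Lemma band_mx_anti F G : \det (band_mx F G) = - \det (band_mx G F).
Proof.
have detE : band_mx G F = xcol j1 ord_max (band_mx F G).
  apply/matrixP => i j; rewrite !mxE.
  have e1 (k : 'I_n.+1) : (k.+1 == n)%N = (k == j1).
    by rewrite -(inj_eq val_inj) -[in RHS]eqSS j1S.
  have e2 (k : 'I_n.+1) : (k == n :> nat) = (k == ord_max) by [].
  rewrite !e1 !e2; have [->|jj1] := eqVneq j j1.
    by rewrite tpermL eqxx [ord_max == j1]eq_sym (negbTE j1_max).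
  have [->|jm] := eqVneq j ord_max; first by rewrite tpermR eqxx.
  by rewrite tpermD 1?eq_sym // (negbTE jj1) (negbTE jm).
by rewrite detE xcolE det_mulmx det_perm odd_tperm j1_max expr1 mulrN1 opprK.
Qed.

Lemma band_mx_rec m G : (m.+2 <= n)%N ->
  a * \det (band_mx (delta (inord m)) G)
    + b * \det (band_mx (delta (inord m.+1)) G)
    + c * \det (band_mx (delta (inord m.+2)) G) = 0.
Proof.
move=> mn.
pose F (k : 'I_n.+1) : A := if k == m :> nat then a
  else if k == m.+1 :> nat then b else if k == m.+2 :> nat then c else 0.
have [im im1 im2] : [/\ @inord n m = m :> nat, @inord n m.+1 = m.+1 :> nat
    & @inord n m.+2 = m.+2 :> nat].
  by rewrite !inordK //; lia.
have : \det (band_mx F G) = 0.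
  have neq : @inord n m != j1.
    by apply/eqP => /(congr1 val) /= eq; move: j1S mn; rewrite -eq im; lia.
  rewrite -det_tr (determinant_alternate neq) // => i; rewrite !mxE j1S eqxx im.
  have -> : (m.+1 == n)%N = false by lia.
  by have -> : (m == n)%N = false by lia.
rewrite band_mx_suml => <-.
rewrite (bigD1 (inord m)) //= (bigD1 (inord m.+1)) /=; last first.
  by apply/eqP => /(congr1 val) /=; rewrite im im1; lia.
rewrite (bigD1 (inord m.+2)) /=; last first.
  by apply/andP; split; apply/eqP => /(congr1 val) /=; rewrite ?im ?im1 im2; lia.
rewrite big1 ?addr0 => [|k /andP[/andP[km km1] km2]].
  have -> : F (inord m) = a by rewrite /F im eqxx.
  have -> : F (inord m.+1) = b.
    by rewrite /F im1 eqxx; have -> : (m.+1 == m)%N = false by lia.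
  have -> : F (inord m.+2) = c; last by rewrite addrA.
  rewrite /F im2 eqxx; have -> : (m.+2 == m)%N = false by lia.
  by have -> : (m.+2 == m.+1)%N = false by lia.
have km' (i : 'I_n.+1) l : i = l :> nat -> (k != i) -> (k == l :> nat) = false.
  by move=> <- /negbTE; rewrite -(inj_eq val_inj).
by rewrite /F (km' _ _ im km) (km' _ _ im1 km1) (km' _ _ im2 km2) mul0r.
Qed.

Lemma band_mx_corner : \det (band_mx (delta j1) (delta ord_max)) = a ^+ n.-1.
Proof.
have e1 (k : 'I_n.+1) : (k.+1 == n)%N = (k == j1).
  by rewrite -(inj_eq val_inj) -[in RHS]eqSS j1S.
rewrite det_trig; last first.
  apply/is_trig_mxP => i j ij; rewrite !mxE e1.
  have [jE|jj1] := eqVneq j j1.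
    by rewrite /delta -jE -(inj_eq val_inj) ltn_eqF.
  have [jn|jn] := eqVneq (j : nat) n.
    rewrite /delta; suff -> : (i == ord_max) = false by [].
    by apply/eqP => iE; move: ij; rewrite iE jn ltnn.
  by rewrite !ltn_eqF // ltnW // ltnW.
have ord_pred : n = n.-1.+1 by rewrite prednK.
pose e i := if (i < n.-1)%N then a else 1.
rewrite (eq_bigr (fun i : 'I_n.+1 => e i)) => [|i _]; last first.
  rewrite !mxE e1 /delta /e eqxx.
  have [->|jj1] := eqVneq i j1; first by rewrite -ltnS j1S prednK // ltnn.
  have [jn|jn] := eqVneq (i : nat) n.
    have -> : i = ord_max by apply/val_inj.
    by rewrite eqxx ltnNge leq_pred.
  have : (i.+1 != n)%N by rewrite e1.
  have lt_i : (i < n.+1)%N := ltn_ord i.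
  by move=> jn1; have -> : (i < n.-1)%N by lia.
rewrite -(big_mkord xpredT e) (big_cat_nat (n := n.-1)) //=; last by lia.
have -> : \prod_(n.-1 <= i < n.+1) e i = 1.
  rewrite big_nat_cond big1 // => i /andP[/andP[ni _] _].
  by rewrite /e ltnNge ni.
rewrite (eq_big_nat _ _ (F2 := fun=> a)) => [|i /andP[_ ni]]; last first.
  by rewrite /e ni.
by rewrite prodr_const_nat subn0 mulr1.
Qed.

(** Both sides are alternating, satisfy the same recurrence, whose leading
    coefficient is a, and have the same value at the last pair of indices. *)
Lemma band_mx_minor (k l : 'I_n.+1) :
  \det (band_mx (delta k) (delta l)) = band_minor n k l.
Proof.
pose D i j : A := \det (band_mx (delta (inord i)) (delta (inord j)))
  - band_minor n i j.
suff D0 : forall i j, (i <= n)%N -> (j <= n)%N -> D i j = 0.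
  apply/subr0_eq; rewrite -{1}(inord_val k) -{1}(inord_val l).
  by apply: D0; rewrite -ltnS.
have D_alt i : D i i = 0.
  by rewrite /D band_mx_alt band_minor_alt subrr.
have D_anti i i' : D i i' = - D i' i.
  by rewrite /D band_mx_anti band_minor_anti -opprD.
have D_col i' : (i' <= n)%N -> D n i' = 0 -> D n.-1 i' = 0 ->
    forall i, (i <= n)%N -> D i i' = 0.
  move=> ni' Dn Dn1 i ni; rewrite -(subKn ni).
  move: (n - i)%N (leq_subr i n) => r; move: r.
  suff H r : (r < n)%N -> D (n - r)%N i' = 0 /\ D (n - r.+1)%N i' = 0.
    case=> [|r] rn; first by rewrite subn0.
    by have [] := H r rn.
  elim: r => [|r IHr] rn; first by rewrite subn0 subn1.
  have [Dr Dr1] := IHr (ltnW rn); split=> //.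
  have rn2 : ((n - r.+2).+2 <= n)%N by lia.
  apply: (a_reg); rewrite mulr0.
  have E1 := band_mx_rec (delta (inord i')) rn2.
  have E2 := band_minor_recl ni' rn2.
  move: Dr Dr1; rewrite (_ : (n - r = (n - r.+2).+2)%N); last by lia.
  rewrite (_ : (n - r.+1 = (n - r.+2).+1)%N); last by lia.
  move: (n - r.+2)%N E1 E2 => m E1 E2 Dr Dr1.
  rewrite -[LHS]addr0 -[X in _ + X](mulr0 b) -{1}Dr1 -[LHS]addr0.
  rewrite -[X in _ + X](mulr0 c) -{1}Dr -[RHS](subrr 0) -{1}E1 -{1}E2 /D.
  by ring.
have nn1 : (n.-1 <= n)%N by rewrite leq_pred.
have D_corner : D n.-1 n = 0.
  rewrite /D (_ : inord n = ord_max); last by apply/val_inj; rewrite /= inordK.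
  rewrite band_mx_corner /band_minor nn1 subnn mulr1.
  by rewrite -[in (_ - n.-1)%N](prednK n_gt0) subSnn mulr1 subrr.
have Dn i : (i <= n)%N -> D i n = 0 by apply: D_col.
have Dn1 i : (i <= n)%N -> D i n.-1 = 0.
  by apply: D_col => //; rewrite D_anti D_corner oppr0.
by move=> i j ni nj; apply: D_col => //; rewrite D_anti ?Dn ?Dn1 ?oppr0.
Qed.

End BandKernel.

(** * The Rees kernel *)

Lemma homog_lin_comb (R : comNzRingType) (n j : nat) (p : {mpoly R[n]}) :
  p \is j.+1.-homog -> exists q : 'I_n -> {mpoly R[n]},
    (forall i, q i \is j.-homog) /\ p = \sum_i q i * 'X_i.
Proof.
move=> hp; rewrite [p]mpolyE big_seq.
apply: (big_ind (fun p => exists q : 'I_n -> {mpoly R[n]},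
  (forall i, q i \is j.-homog) /\ p = \sum_i q i * 'X_i)).
- exists (fun=> 0); split=> [i|]; first exact: rpred0.
  by rewrite big1 // => i _; rewrite mul0r.
- move=> _ _ [q1 [h1 ->]] [q2 [h2 ->]]; exists (fun i => q1 i + q2 i).
  split=> [i|]; first exact: rpredD (h1 i) (h2 i).
  by rewrite -big_split; apply: eq_bigr => i _; rewrite mulrDl.
- move=> m mp; have mj := mdeg_homog hp mp.
  have [i mi] : exists i, m i != 0%N.
    apply/existsP; apply: contra_eqT mj; rewrite negb_exists => /forallP m0.
    by rewrite mdegE big1 // => i _; apply/eqP; have := m0 i; rewrite negbK.
  have Ui : (U_(i) <= m)%MM by rewrite lep1mP.
  exists (fun i' => if i' == i then p@_m *: 'X_[m - U_(i)] else 0); split.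
    move=> i'; case: eqP => _; last exact: rpred0.
    rewrite rpredZ // dhomogX /=; apply/eqP/succn_inj.
    by rewrite -mj -[in RHS](submK Ui) mdegD mdeg1 addn1.
  rewrite (bigD1 i) //= eqxx big1 ?addr0 => [|i' /negbTE->]; last by rewrite mul0r.
  by rewrite -scalerAl -mpolyXD submK.
Qed.

Lemma linear_formE (R : comNzRingType) (n : nat) (p : {mpoly R[n]}) :
  p \is 1.-homog -> p = \sum_i (p@_U_(i))%:MP * 'X_i.
Proof.
move=> /homog_lin_comb [q [hq ->]]; apply: eq_bigr => i _; congr (_ * _).
rewrite [LHS](homog0_const (hq i)); congr (_%:MP).
rewrite raddf_sum /= (bigD1 i) //= big1 ?addr0 => [|i' neq].
  by rewrite (homog0_const (hq i)) !mcoeffCM mcoeffC eqxx mcoeffXU eqxx.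
rewrite (homog0_const (hq i')) mcoeffCM mcoeffXU.
by rewrite (negbTE neq) mulr0.
Qed.

Section NilIdeal.

Variables (A : comNzRingType) (J : A -> Prop).
Hypothesis J0 : J 0.
Hypothesis JD : forall x y, J x -> J y -> J (x + y).
Hypothesis JM : forall a x, J x -> J (a * x).

(** Serves to pass from powers of the coefficients of P to powers of the
    variables T_k. *)
Definition in_radical x : Prop := exists e, J (x ^+ e).

Lemma in_radicalD x y : in_radical x -> in_radical y -> in_radical (x + y).
Proof.
move=> [e xe] [f yf]; exists (e + f)%N; rewrite exprDn.
apply: (big_ind J) => // i _; rewrite -mulr_natl; apply: JM.
have [fi|if'] := leqP f i.
  by rewrite -(subnK fi) exprD mulrA; apply: JM.
have -> : (e + f - i = (f - i) + e)%N by lia.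
by rewrite exprD mulrC mulrA; apply: JM.
Qed.

Lemma in_radicalM a x : in_radical x -> in_radical (a * x).
Proof. by move=> [e xe]; exists e; rewrite exprMn; apply: JM. Qed.

Lemma in_radical_sum (I : Type) (r : seq I) (F : I -> A) :
  (forall i, in_radical (F i)) -> in_radical (\sum_(i <- r) F i).
Proof.
move=> hF; apply: (big_ind in_radical) => [||i _]; last exact: hF.
  by exists 1%N.
exact: in_radicalD.
Qed.

End NilIdeal.

Section ReesKernel.

Variable K : fieldType.
Local Notation A := {mpoly {mpoly K[2]}[3]}.
Variable u : 'I_3 -> {mpoly K[2]}.
Implicit Types p q x : A.

Local Notation ev := (meval u).

Lemma rees_map_homog j p : p \is j.-homog -> rees_map u p = ev p *: 'X^j.
Proof.
move=> hp; rewrite /rees_map /mmap mevalE scaler_suml; apply: eq_big_seq => m mp.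
rewrite -scalerA -mul_polyC; congr (_ * _).
rewrite /mmap1 -(mdeg_homog hp mp) mdegE -prodrXr.
rewrite (eq_bigr (fun i => (u i ^+ m i)%:P * 'X^(m i))) => [|i _]; last first.
  by rewrite exprZn mul_polyC.
by rewrite big_split /= -rmorph_prod mul_polyC.
Qed.

(** The Rees ideal is homogeneous in X: the degree in X is the exponent of Z.
    *)
Lemma rees_map_coef p j : (rees_map u p)`_j = ev (pihomog mdeg j p).
Proof.
rewrite {1}[p]pihomog_sum_comps /rees_map raddf_sum coef_sum.
have termE k : (rees_map u (pihomog mdeg k p))`_j
    = if k == j then ev (pihomog mdeg k p) else 0.
  rewrite (rees_map_homog (pihomogP _ _ _)) coefZ coefXn eq_sym.
  by case: eqP => _; rewrite ?mulr1 ?mulr0.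
have [lt|ge] := ltnP j (msize p).
  rewrite (bigD1 (Ordinal lt)) //= big1 ?addr0 => [|k neq].
    by rewrite [LHS]termE eqxx.
  by rewrite [LHS]termE ifF //; apply: negbTE.
rewrite big1 => [|k _]; last first.
  by rewrite [LHS]termE ifF //; apply/eqP; have := ltn_ord k; lia.
by rewrite pihomogE big_seq_cond big_pred0 ?meval0 // => m;
  apply/negbTE/negP => /andP[/msize_mdeg_lt m'p /eqP eq];
  move: m'p; rewrite eq ltnNge ge.
Qed.

Lemma rees_kerP p : rees_ker u p <-> forall j, ev (pihomog mdeg j p) = 0.
Proof.
split=> [kp j|kp]; first by rewrite -rees_map_coef kp coef0.
by apply/polyP => j; rewrite rees_map_coef kp coef0.
Qed.

Lemma rees_ker_homog j p : p \is j.-homog -> (rees_ker u p <-> ev p = 0).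
Proof.
move=> hp; split=> [/rees_kerP/(_ j)|ep]; first by rewrite pihomog_dE.
by rewrite /rees_ker (rees_map_homog hp) ep scale0r.
Qed.

Lemma rees_ker0 : rees_ker u 0.
Proof. exact: rmorph0. Qed.

Lemma rees_kerD p q : rees_ker u p -> rees_ker u q -> rees_ker u (p + q).
Proof. by rewrite /rees_ker /rees_map rmorphD /= => -> ->; rewrite addr0. Qed.

Lemma rees_kerM a p : rees_ker u p -> rees_ker u (a * p).
Proof. by rewrite /rees_ker /rees_map rmorphM /= => ->; rewrite mulr0. Qed.

Lemma rees_ker_cancel c p : c != 0 -> rees_ker u (c%:MP * p) -> rees_ker u p.
Proof.
move=> c_neq0; rewrite /rees_ker /rees_map rmorphM /= mmapC => /eqP.
by rewrite mulf_eq0 polyC_eq0 (negbTE c_neq0) => /eqP.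
Qed.

End ReesKernel.

Lemma mpoly_subst (R S : comNzRingType) (n : nat) (f : {rmorphism R -> S})
    (h : 'I_n -> S) :
  exists g : {rmorphism {mpoly R[n]} -> S},
    (forall c, g c%:MP = f c) /\ (forall i, g 'X_i = h i).
Proof.
exists (mmap f h); split=> [c|i] /=; first exact: mmapC.
by rewrite mmapX mmap1U.
Qed.

(** A fraction with the two coprime denominators f and g is an element of the
    ring. *)
Lemma dvd_of_coprime2 (R : comNzRingType) (f g p x a b : R) :
  GRing.lreg p -> GRing.lreg f -> coprime2 f g -> f * x = a * p ->
  g * x = b * p -> exists z, x = z * p.
Proof.
move=> p_reg f_reg fg fx gx; have [|z [_ aE]] := fg b a.
  apply: p_reg; transitivity (f * (b * p)); first by ring.
  by rewrite -gx; transitivity (g * (a * p)); [rewrite -fx; ring|ring].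
by exists z; apply: f_reg; rewrite fx aE; ring.
Qed.

Lemma coprime2_of_prime (R : comNzRingType) (p q : R) : GRing.lreg p ->
  (forall x y, x * q = y * p -> exists z, x = z * p) -> coprime2 p q.
Proof.
move=> p_reg pq x y pxy; have [|z yE] := pq y x; first by rewrite mulrC -pxy mulrC.
exists z; split; last by rewrite yE mulrC.
by apply: p_reg; rewrite pxy yE; ring.
Qed.

Section LinearFormPrime.

Variables (R : idomainType) (n : nat) (P Q : {mpoly R[n]}).
Hypotheses (P_lin : P \is 1.-homog) (Q_lin : Q \is 1.-homog).

Lemma rmorph_linear_form (S : comNzRingType) (f : {rmorphism {mpoly R[n]} -> S}) z :
  z \is 1.-homog -> f z = \sum_k f (z@_U_(k))%:MP * f 'X_k.
Proof.
move=> hz; rewrite {1}(linear_formE hz) rmorph_sum; apply: eq_bigr => k _.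
exact: rmorphM.
Qed.

(** Substituting c X_j for X_j when j != i and minus the sum of the other terms
    of P for X_i, where c X_i is a term of P, kills P but not Q. *)
Lemma linear_form_prime i j (x y : {mpoly R[n]}) :
  (P@_U_(i))%:MP * Q - (Q@_U_(i))%:MP * P != 0 ->
  x \is j.-homog -> x * Q = y * P ->
  exists w, (P@_U_(i))%:MP ^+ j * x = w * P.
Proof.
set c := P@_U_(i) => free hx xQ.
have [th [thC thX]] := mpoly_subst (@mpolyC n R)
  (fun k => c%:MP * 'X_k - (if i == k then P else 0)).
have [ph [phC phX]] := mpoly_subst (@mpolyC n R) (fun k => c%:MP * 'X_k).
have th_lin z : z \is 1.-homog -> th z = c%:MP * z - (z@_U_(i))%:MP * P.
  move=> hz; rewrite (rmorph_linear_form th hz).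
  rewrite (eq_bigr (fun k => c%:MP * ((z@_U_(k))%:MP * 'X_k)
      - (if k == i then (z@_U_(k))%:MP * P else 0))) => [|k _]; last first.
    by rewrite thC thX [k == i]eq_sym; case: ifP => _; ring.
  rewrite sumrB -mulr_sumr -(linear_formE hz); congr (_ - _).
  by rewrite -big_mkcond big_pred1_eq.
have thP : th P = 0 by rewrite (th_lin P P_lin) subrr.
have thQ : th Q != 0 by rewrite (th_lin Q Q_lin).
have thx : th x = 0.
  have /eqP : th x * th Q = 0 by rewrite -rmorphM xQ rmorphM thP mulr0.
  by rewrite mulf_eq0 (negbTE thQ) orbF => /eqP.
have phx : ph x = c%:MP ^+ j * x.
  rewrite [in RHS](mpolyE x) [in LHS](mpolyE x) rmorph_sum mulr_sumr.
  apply: eq_big_seq => m mx; rewrite -mul_mpolyC rmorphM /= phC mulrCA.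
  congr (_ * _); rewrite mpolyXE_id rmorph_prod -(mdeg_homog hx mx) mdegE.
  rewrite -prodrXr -big_split; apply: eq_bigr => k _ /=.
  by rewrite rmorphXn /= phX exprMn.
have [||||| w E] := rmorph_congr (f := ph) (g := th)
    (J := fun z => exists w, z = w * P) _ _ _ _ _ x.
- by exists 0; rewrite mul0r.
- by move=> _ _ [w ->] [w' ->]; exists (w + w'); rewrite mulrDl.
- by move=> a _ [w ->]; exists (a * w); rewrite mulrA.
- by move=> b; rewrite phC thC.
- move=> k; rewrite phX thX subKr; case: ifP => _; first by exists 1; rewrite mul1r.
  by exists 0; rewrite mul0r.
by exists w; rewrite -phx -E thx subr0.
Qed.

End LinearFormPrime.

Section MuBasis.

Variable K : closedFieldType.
Local Notation A := {mpoly {mpoly K[2]}[3]}.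
Variables (u : 'I_3 -> {mpoly K[2]}) (d : nat).
Hypothesis u_homog : forall i, u i \is d.-homog.
Implicit Types p q x : A.

Local Notation ev := (meval u).
Local Notation t k := (tvar K k).

Lemma tcomp_ge k x : (msize (toB x) <= k)%N -> tcomp k x = 0.
Proof.
move=> ge; rewrite /tcomp pihomogE big_seq_cond big_pred0 ?(rmorph0 (@toA K)) //.
move=> m; apply/negbTE/negP => /andP[/msize_mdeg_lt lt /eqP eq].
by move: lt; rewrite eq ltnNge ge.
Qed.

Lemma ev_bihomog i j x : bihomog i j x -> ev x \is (i + d * j).-homog.
Proof.
move=> [hx hx']; apply: (homog_rmorph (g := meval u)) hx => [m|k].
  by rewrite /= mevalC; apply: hx'.
by rewrite /= mevalXU.
Qed.

Lemma ev_tcomp i j x : x \is j.-homog ->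
  ev (tcomp i x) = pihomog mdeg (i + d * j) (ev x).
Proof.
move=> hx.
have -> : pihomog mdeg (i + d * j) (ev x)
    = \sum_(k < msize (toB x)) pihomog mdeg (i + d * j) (ev (tcomp k x)).
  by rewrite {1}[x]tcomp_sum rmorph_sum raddf_sum.
have hk k : ev (tcomp k x) \is (k + d * j).-homog.
  by apply: ev_bihomog; split; [exact: tcomp_homog|exact: thomog_tcomp].
have other k : k != i -> pihomog mdeg (i + d * j) (ev (tcomp k x)) = 0.
  by move=> ki; apply: pihomog_ne0 (hk k); rewrite eqn_add2r.
have [lt|ge] := ltnP i (msize (toB x)).
  rewrite (bigD1 (Ordinal lt)) //= [X in _ + X]big1 ?addr0 => [|k neq].
    by rewrite pihomog_dE.
  exact: other.
rewrite tcomp_ge // meval0 [RHS]big1 // => k _; apply: other.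
by apply/eqP; have := ltn_ord k; lia.
Qed.

(** Since the u_i have the same degree d, the kernel is homogeneous in T too.
    *)
Lemma rees_ker_bicomp i j x : rees_ker u x -> rees_ker u (bicomp i j x).
Proof.
move=> /rees_kerP/(_ j) x0; have hx := pihomogP (@mdeg 3) j x.
apply/(@rees_ker_homog K u j); first exact: tcomp_homog.
by rewrite (ev_tcomp _ hx) x0 raddf0.
Qed.

Lemma coprime2_tvar N : coprime2 (t 0 ^+ N) (t 1 ^+ N).
Proof.
have toA_tX k w : toA ('X_k ^+ N * w) = t k ^+ N * toA w.
  transitivity (toA ('X_k ^+ N) * toA w); first exact: (rmorphM (@toA K)).
  by congr (_ * _); rewrite -toA_X; apply: (rmorphXn (@toA K)).
have toB_tX k w : toB (t k ^+ N * w) = 'X_k ^+ N * toB w.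
  transitivity (toB (t k ^+ N) * toB w); first exact: (rmorphM (@toB K)).
  by congr (_ * _); rewrite -toB_t; apply: (rmorphXn (@toB K)).
move=> x y /(congr1 (@toB K)); rewrite !toB_tX => /powX_coprime [z [xz yz]].
by exists (toA z); split; rewrite -toA_tX -?xz -?yz toBK.
Qed.

Lemma tvarE k N : t k ^+ N = ('X_k ^+ N)%:MP :> A.
Proof. by rewrite -rmorphXn. Qed.

Lemma tvarX_neq0 k N : t k ^+ N != 0.
Proof. by rewrite tvarE mpolyC_eq0 -msize_poly_eq0 mpolyXn msizeX. Qed.

Lemma mpolyA_reg p : p != 0 -> GRing.lreg p.
Proof.
rewrite -mleadc_eq0 => p_neq0; apply: lreg_mleadc; move: p_neq0.
rewrite -mleadc_eq0 => p_neq0; apply: lreg_mleadc; exact: mulfI.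
Qed.

Lemma tvarX_reg k N : GRing.lreg (t k ^+ N).
Proof. exact: mpolyA_reg (tvarX_neq0 k N). Qed.

Variables P Q : A.
Variable mu : nat.
Hypothesis PQ_basis : mu_basis u d mu P Q.
Hypothesis u_coprime : no_common_factor u.

Lemma P_bihomog : bihomog mu 1 P. Proof. by case: PQ_basis => _ []. Qed.
Lemma Q_bihomog : bihomog (d - mu) 1 Q. Proof. by case: PQ_basis => _ []. Qed.
Lemma P_ker : rees_ker u P. Proof. by case: PQ_basis => _ _ [[]]. Qed.
Lemma Q_ker : rees_ker u Q. Proof. by case: PQ_basis => _ _ [_ []]. Qed.

Lemma syz_mem (p : A) : p \is 1.-homog -> ev p = 0 ->
  exists a b : {mpoly K[2]}, p = a%:MP * P + b%:MP * Q.
Proof.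
move=> hp ep; case: PQ_basis => _ _ _ /(_ p) [|[a b] [pE _]].
  by split=> //; apply/(rees_ker_homog u hp).
by exists a, b; rewrite !mul_mpolyC.
Qed.

Lemma basis_free (a b : {mpoly K[2]}) :
  a%:MP * P + b%:MP * Q = 0 -> a = 0 /\ b = 0.
Proof.
move=> ab0; case: PQ_basis => _ _ _ /(_ 0) [|[a' b'] [_ uniq]].
  by split; [exact: rees_ker0|exact: rpred0].
have e0 : (a', b') = (0, 0) by apply: uniq; rewrite /= !scale0r addr0.
have : (a', b') = (a, b) by apply: uniq; rewrite /= -!mul_mpolyC ab0.
by rewrite e0 => -[<- <-].
Qed.

Lemma P_neq0 : P != 0.
Proof.
apply/eqP => P0; have [] := @basis_free 1 0; first by rewrite P0 mulr0 mpolyC0 mul0r addr0.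
by move/eqP; rewrite oner_eq0.
Qed.

Lemma P_reg : GRing.lreg P.
Proof. exact: mpolyA_reg P_neq0. Qed.

Lemma Q_neq0 : Q != 0.
Proof.
apply/eqP => Q0; have [] := @basis_free 0 1; first by rewrite Q0 mulr0 mpolyC0 mul0r addr0.
by move=> _ /eqP; rewrite oner_eq0.
Qed.

Lemma koszul_mem j k : mem2 P Q ((u k)%:MP * 'X_j - (u j)%:MP * 'X_k).
Proof.
have [||a [b ->]] := @syz_mem ((u k)%:MP * 'X_j - (u j)%:MP * 'X_k).
- by rewrite rpredB // homog_mulC // homog_var.
- by rewrite mevalB !mevalM !mevalC !mevalXU mulrC subrr.
- by exists a%:MP, b%:MP.
Qed.

Lemma Q_reg : GRing.lreg Q.
Proof. exact: mpolyA_reg Q_neq0. Qed.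

(** Modulo the Koszul syzygies, u_k p equals X_k p' where p' has lower degree
    in X; and the u_k generate a power of each variable T_k. *)
Lemma power_mem2 k j p : p \is j.-homog -> ev p = 0 ->
  exists N, mem2 P Q (t k ^+ N * p).
Proof.
have [M [c Ec]] := forms_bezout k u_homog u_coprime.
elim: j p => [|j IHj] p hp ep.
  exists 0%N; suff -> : p = 0 by rewrite mulr0; apply: mem2_0.
  by move: ep; rewrite (homog0_const hp) mevalC => ->.
have [q [hq pE]] := homog_lin_comb hp.
(* p' arises from p = \sum_i q i X_i on replacing X_i by u_i. *)
pose p' : A := \sum_i (u i)%:MP * q i.
have [||N memN] := IHj p'.
- by apply: rpred_sum => i _; rewrite homog_mulC.
- rewrite -ep pE !rmorph_sum; apply: eq_bigr => i _ /=.
  by rewrite !mevalM mevalC mevalXU mulrC.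
exists (N + M)%N.
rewrite exprD tvarE [X in _ * X * _]tvarE Ec rmorph_sum /= -tvarE.
rewrite mulr_sumr mulr_suml; apply: mem2_sum => i.
have -> : t k ^+ N * (c i * u i)%:MP * p = (c i)%:MP * (t k ^+ N * ((u i)%:MP * p)).
  by rewrite mpolyCM; ring.
apply: mem2M.
have -> : (u i)%:MP * p = 'X_i * p'
    + \sum_l q l * ((u i)%:MP * 'X_l - (u l)%:MP * 'X_i).
  rewrite pE !mulr_sumr -big_split; apply: eq_bigr => l _ /=; ring.
rewrite mulrDr; apply: mem2D.
  by rewrite mulrCA; apply: mem2M.
by apply/mem2M/mem2_sum => l; apply/mem2M/koszul_mem.
Qed.

Lemma power_mem2_both j p : p \is j.-homog -> ev p = 0 ->
  exists N0, forall N, (N0 <= N)%N ->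
    mem2 P Q (t 0 ^+ N * p) /\ mem2 P Q (t 1 ^+ N * p).
Proof.
move=> hp ep; have [N0 h0] := power_mem2 0 hp ep.
have [N1 h1] := power_mem2 1 hp ep; exists (N0 + N1)%N => N leN.
have -> : N = ((N - N0) + N0)%N by lia.
rewrite {1}exprD -mulrA; split; first exact: mem2M.
have -> : ((N - N0) + N0 = (N - N1) + N1)%N by lia.
by rewrite exprD -mulrA; apply: mem2M.
Qed.

(** If h divides all coefficients of P, then P / h is again a syzygy, hence a
    combination of P and Q, and freeness makes h invertible. *)
Lemma P_primitive : no_common_factor (fun i => P@_U_(i)).
Proof.
move=> h hP; have [hP1 _] := P_bihomog; have PE := linear_formE hP1.
have [g gE] : exists g : 'I_3 -> {mpoly K[2]}, forall i, P@_U_(i) = g i * h.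
  have [g0 e0] := hP 0; have [g1 e1] := hP 1; have [g2 e2] := hP 2.
  exists (fun i => if i == 0 then g0 else if i == 1 then g1 else g2).
  exact: forall_I3.
pose P' : A := \sum_i (g i)%:MP * 'X_i.
have PP' : P = h%:MP * P'.
  rewrite PE mulr_sumr; apply: eq_bigr => i _; rewrite gE mpolyCM; ring.
have h_neq0 : h != 0.
  by apply: contraNneq P_neq0 => h0; rewrite PP' h0 mpolyC0 mul0r.
have [||a [b P'E]] := @syz_mem P'.
- by apply: rpred_sum => i _; rewrite homog_mulC // homog_var.
- have := (rees_ker_homog u hP1).1 P_ker; rewrite PP' mevalM mevalC => /eqP.
  by rewrite mulf_eq0 (negbTE h_neq0) => /eqP.
have [|ha _] := @basis_free (h * a - 1) (h * b).
  transitivity (h%:MP * (a%:MP * P + b%:MP * Q) - P).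
    by rewrite mpolyCB !mpolyCM mpolyC1; ring.
  by rewrite -P'E -PP' subrr.
by apply/unitrP; exists a; rewrite mulrC; move/subr0_eq: ha => ->.
Qed.

(** After inverting a coefficient of P the linear form P generates a prime
    ideal, which does not contain Q. Hence powers of all coefficients of P
    multiply x into (P), and so do powers of T_0 and T_1, these coefficients
    being without common factor; T_0 and T_1 being coprime, x itself lies in
    (P). *)
Lemma P_prime_to_Q_homog j x y : x \is j.-homog -> x * Q = y * P ->
  exists z, x = z * P.
Proof.
move=> hx xQ; have [hP1 hP2] := P_bihomog; have [hQ1 _] := Q_bihomog.
pose J (z : A) := exists w, z * x = w * P.
have JD z z' : J z -> J z' -> J (z + z').
  by move=> [w e] [w' e']; exists (w + w'); rewrite mulrDl e e' mulrDl.
have JM a z : J z -> J (a * z).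
  by move=> [w e]; exists (a * w); rewrite -mulrA e mulrA.
have J0 : J 0 by exists 0; rewrite !mul0r.
have pow_mem i : J ((P@_U_(i))%:MP ^+ j.+1).
  have [pi0|pi_neq0] := eqVneq (P@_U_(i)) 0.
    by rewrite pi0 mpolyC0 expr0n.
  rewrite exprS; apply: (JM); apply: linear_form_prime xQ => //.
  apply/eqP => e; have [|_] := @basis_free (- Q@_U_(i)) (P@_U_(i)).
    by rewrite -e mpolyCN; ring.
  by move/eqP; rewrite (negbTE pi_neq0).
have T_mem k : exists N, J (t k ^+ N).
  have [M [c Ec]] := forms_bezout k (fun i => hP2 U_(i)%MM) P_primitive.
  have [e Je] : in_radical J (t k ^+ M).
    rewrite tvarE Ec rmorph_sum; apply: (in_radical_sum J0 JD JM) => i /=.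
    by rewrite mpolyCM; apply: (in_radicalM JM); exists j.+1.
  by exists (M * e)%N; rewrite exprM.
have [N0 J0N] := T_mem 0; have [N1 J1N] := T_mem 1.
have [w0 e0] : J (t 0 ^+ (N0 + N1)) by rewrite addnC exprD; apply: JM.
have [w1 e1] : J (t 1 ^+ (N0 + N1)) by rewrite exprD; apply: JM.
exact: (dvd_of_coprime2 (@P_reg) (@tvarX_reg _ _) (@coprime2_tvar _) e0 e1).
Qed.

Lemma P_prime_to_Q x y : x * Q = y * P -> exists z, x = z * P.
Proof.
move=> xQ; have [hP _] := P_bihomog; have [hQ _] := Q_bihomog.
have [z zE] : exists z : 'I_(msize x) -> A, forall j : 'I_(msize x),
      pihomog mdeg j x = z j * P.
  apply: (fin_all_exists (P := fun (j : 'I_(msize x)) (z : A) =>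
    pihomog mdeg j x = z * P)) => j; apply: (P_prime_to_Q_homog (pihomogP _ _ _)).
  have := congr1 (pihomog mdeg j.+1) xQ.
  by rewrite (pihomogMr _ _ hQ) (pihomogMr _ _ hP) /= subn1 => e; exact: e.
exists (\sum_j z j); rewrite {1}[x]pihomog_sum_comps mulr_suml.
by apply: eq_bigr => j _; rewrite zE.
Qed.

Lemma coprime2_PQ : coprime2 P Q.
Proof. exact: (coprime2_of_prime (@P_reg) P_prime_to_Q). Qed.

End MuBasis.

(** * Independent linear forms *)

Section IndependentForms.

Variables (R : comNzRingType) (n : nat) (L : 'I_n -> {mpoly R[n]}).
Variables (M W : 'M[R]_n).
Hypothesis L_eq : forall i, L i = \sum_j (M i j)%:MP * 'X_j.
Hypothesis MW : M *m W = 1%:M.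

(** The columns of W are dual to the forms, so that subtracting from each X_j
    the combination of the L_i (i in S) with coefficients W j i is reduction
    modulo these L_i. *)
Lemma reduce_forms (S : pred 'I_n) :
  exists th : {rmorphism {mpoly R[n]} -> {mpoly R[n]}},
    (forall k, th (L k) = if S k then 0 else L k) /\
    (forall x, exists e : 'I_n -> {mpoly R[n]},
      x - th x = \sum_(i | S i) e i * L i).
Proof.
have [th [thC thX]] := mpoly_subst (@mpolyC n R)
  (fun j => 'X_j - \sum_(i | S i) (W j i)%:MP * L i).
exists th; split=> [k|x].
  have -> : th (L k) = L k - \sum_(i | S i) (\sum_j M k j * W j i)%:MP * L i.
    rewrite {1 2}L_eq rmorph_sum.
    have -> : \sum_(i | S i) (\sum_j M k j * W j i)%:MP * L i
        = \sum_j \sum_(i | S i) (M k j)%:MP * ((W j i)%:MP * L i).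
      rewrite exchange_big; apply: eq_bigr => i _.
      rewrite rmorph_sum mulr_suml; apply: eq_bigr => j _.
      by rewrite /= mpolyCM mulrA.
    rewrite -sumrB; apply: eq_bigr => j _ /=.
    by rewrite rmorphM /= thC thX mulrBr mulr_sumr.
  have dual i : \sum_j M k j * W j i = (k == i)%:R.
    by have := congr1 (fun N : 'M_n => N k i) MW; rewrite !mxE.
  rewrite (eq_bigr (fun i => if i == k then L k else 0)) => [|i _]; last first.
    rewrite dual eq_sym; case: eqP => [->|_]; first by rewrite mpolyC1 mul1r.
    by rewrite mpolyC0 mul0r.
  rewrite -big_mkcondr; have [Sk|Sk] := boolP (S k).
    by rewrite (big_pred1 k) ?subrr // => i /=; case: eqP => [->|]; rewrite ?andbF ?Sk.
  by rewrite big_pred0 ?subr0 // => i; case: eqP => [->|]; rewrite ?andbF ?(negbTE Sk).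
apply: (rmorph_congr (f := idfun) (g := th) (J := fun z =>
  exists e : 'I_n -> {mpoly R[n]}, z = \sum_(i | S i) e i * L i)) => [||||j] /=.
- by exists (fun=> 0); rewrite big1 // => i _; rewrite mul0r.
- move=> _ _ [e ->] [e' ->]; exists (fun i => e i + e' i).
  by rewrite -big_split; apply: eq_bigr => i _; rewrite mulrDl.
- move=> z _ [e ->]; exists (fun i => z * e i).
  by rewrite mulr_sumr; apply: eq_bigr => i _; rewrite mulrA.
- by move=> z; rewrite thC.
- by exists (fun i => (W j i)%:MP); rewrite thX subKr.
Qed.

(** Reducing modulo L_i kills the right-hand side and leaves L_j alone. *)
Lemma forms_regular2 i j : i != j -> GRing.lreg (L j) ->
  forall x y, L j * x = L i * y -> exists z, x = L i * z.
Proof.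
move=> ij Lj_reg x y e; have [th [thL thx]] := reduce_forms (pred1 i).
have th0 : th x = 0.
  apply: Lj_reg; rewrite /= mulr0 -[LHS](_ : th (L j * x) = _).
    by rewrite e rmorphM thL /= eqxx mul0r.
  by rewrite rmorphM thL /= eq_sym (negbTE ij).
have [c] := thx x; rewrite th0 subr0 (big_pred1 i) // => ->.
by exists (c i); rewrite mulrC.
Qed.

Lemma forms_regular3 i j k : i != j -> i != k -> j != k -> GRing.lreg (L k) ->
  forall x, mem2 (L i) (L j) (L k * x) -> mem2 (L i) (L j) x.
Proof.
move=> ij ik jk Lk_reg x [p [q e]].
have [th [thL thx]] := reduce_forms (pred2 i j).
have th0 : th x = 0.
  apply: Lk_reg; rewrite /= mulr0 -[LHS](_ : th (L k * x) = _).
    by rewrite e rmorphD !rmorphM !thL /= !eqxx orbT !mulr0 addr0.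
  by rewrite rmorphM thL /= ![k == _]eq_sym (negbTE ik) (negbTE jk).
have [c] := thx x; rewrite th0 subr0 (bigD1 i) /= ?eqxx // (big_pred1 j).
  by move=> ->; exists (c i), (c j).
move=> l /=; have [->|] := eqVneq l i; first by rewrite andbF (negbTE ij).
by rewrite andbT.
Qed.

End IndependentForms.

Section TConstLinear.

Variable K : closedFieldType.
Local Notation A := {mpoly {mpoly K[2]}[3]}.

Definition lin_form (l : 'I_3 -> K) : A := \sum_j ((l j)%:MP)%:MP * 'X_j.

Lemma tconst_linear (L : A) : bihomog 0 1 L -> exists l, L = lin_form l.
Proof.
move=> [hL hL']; exists (fun j => L@_U_(j)@_0).
rewrite {1}(linear_formE hL); apply: eq_bigr => j _.
by rewrite {1}(homog0_const (hL' U_(j)%MM)).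
Qed.

Lemma lin_form_neq0 l j : l j != 0 -> lin_form l != 0.
Proof.
apply: contraNneq => l0; have := congr1 (fun x : A => x@_U_(j)@_0) l0.
rewrite raddf_sum /= (bigD1 j) //= big1 => [|i neq].
  by rewrite mcoeffCM mcoeffXU eqxx mulr1 addr0 mcoeffC eqxx mulr1 !mcoeff0 => ->.
by rewrite mcoeffCM mcoeffXU (negbTE neq) mulr0.
Qed.

Variable l : 'I_3 -> 'I_3 -> K.
Hypothesis l_indep : \det (\matrix_(i, j) l i j) != 0.

Lemma indep_forms_neq0 i : lin_form (l i) != 0.
Proof.
have [j lij] : exists j, l i j != 0.
  apply/existsP; apply: contraNT l_indep; rewrite negb_exists => /forallP l0.
  rewrite (expand_det_row _ i) big1 // => j _; rewrite mxE.
  by have := l0 j; rewrite negbK => /eqP ->; rewrite mul0r.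
exact: lin_form_neq0 lij.
Qed.

Lemma indep_forms_reg i : GRing.lreg (lin_form (l i)).
Proof. exact: mpolyA_reg (indep_forms_neq0 i). Qed.

Let M : 'M[K]_3 := \matrix_(i, j) l i j.
Let MW : map_mx (@mpolyC 2 K) M *m map_mx (@mpolyC 2 K) (invmx M) = 1%:M.
Proof. by rewrite -map_mxM mulmxV ?map_mx1 // unitmxE unitfE. Qed.

Let LE i : lin_form (l i) = \sum_j (map_mx (@mpolyC 2 K) M i j)%:MP * 'X_j.
Proof. by apply: eq_bigr => j _; rewrite !mxE. Qed.

Lemma indep_forms_regular2 i j : i != j ->
  forall x y, lin_form (l j) * x = lin_form (l i) * y ->
  exists z, x = lin_form (l i) * z.
Proof.
by move=> ij; apply: (forms_regular2 LE MW ij); apply: indep_forms_reg.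
Qed.

Lemma indep_forms_regular3 i j k : i != j -> i != k -> j != k ->
  forall x, mem2 (lin_form (l i)) (lin_form (l j)) (lin_form (l k) * x) ->
  mem2 (lin_form (l i)) (lin_form (l j)) x.
Proof.
by move=> ij ik jk; apply: (forms_regular3 LE MW ij ik jk); apply: indep_forms_reg.
Qed.

End TConstLinear.

(** * The implicit equation *)

Lemma rmorph_pihomog (R S : comNzRingType) (n l d j : nat)
    (g : {rmorphism {mpoly R[n]} -> {mpoly S[l]}}) (p : {mpoly R[n]}) :
  (0 < d)%N -> (forall c, g c%:MP \is 0.-homog) ->
  (forall i, g 'X_i \is d.-homog) ->
  g (pihomog mdeg j p) = pihomog mdeg (d * j) (g p).
Proof.
move=> d_gt0 gC gX.
have hk k : g (pihomog mdeg k p) \is (d * k).-homog.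
  by have := homog_rmorph (e := 0) (fun m => gC _) gX (pihomogP mdeg k p).
have -> : pihomog mdeg (d * j) (g p)
    = \sum_(k < msize p) pihomog mdeg (d * j) (g (pihomog mdeg k p)).
  by rewrite {1}[p]pihomog_sum_comps rmorph_sum raddf_sum.
have other k : k != j -> pihomog mdeg (d * j) (g (pihomog mdeg k p)) = 0.
  by move=> kj; apply: pihomog_ne0 (hk k); rewrite eqn_pmul2l.
have [lt|ge] := ltnP j (msize p).
  rewrite (bigD1 (Ordinal lt)) //= [X in _ + X]big1 ?addr0 => [|k neq].
    by rewrite [RHS]pihomog_dE.
  exact: other.
rewrite [RHS]big1 => [|k _]; last first.
  by apply: other; apply/eqP; have := ltn_ord k; lia.
rewrite pihomogE big_seq_cond big_pred0 ?rmorph0 // => m.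
apply/negbTE/negP => /andP[/msize_mdeg_lt m'p /eqP eq].
by move: m'p; rewrite eq ltnNge ge.
Qed.

Section LastVariable.

Variable K : fieldType.
Local Notation R2 := {mpoly K[2]}.
Local Notation R3 := {mpoly K[3]}.

Definition last_var (i : 'I_3) : {poly R2} :=
  if i == 2 then 'X else ('X_(inord i))%:P.

(** Polynomials in X_0, X_1, X_2 as polynomials in X_2, on which division is
    available. *)
Definition to_uni : R3 -> {poly R2} := mmap (polyC \o @mpolyC 2 K) last_var.
HB.instance Definition _ := GRing.RMorphism.copy to_uni
  (mmap (polyC \o @mpolyC 2 K) last_var).

Definition incl : R2 -> R3 := mmap (@mpolyC 3 K) (fun i => 'X_(inord i)).
HB.instance Definition _ := GRing.RMorphism.copy incl
  (mmap (@mpolyC 3 K) (fun i : 'I_2 => 'X_(inord i) : R3)).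

Definition of_uni : {poly R2} -> R3 := horner_eval 'X_2 \o map_poly incl.
HB.instance Definition _ := GRing.RMorphism.copy of_uni
  (horner_eval ('X_2 : R3) \o map_poly incl).

Lemma of_uniM f h : of_uni (f * h) = of_uni f * of_uni h.
Proof. exact: (rmorphM of_uni). Qed.

Lemma to_uniM x y : to_uni (x * y) = to_uni x * to_uni y.
Proof. exact: (rmorphM to_uni). Qed.

Lemma of_uniC c : of_uni c%:P = incl c.
Proof. by rewrite /of_uni /= map_polyC /= /horner_eval hornerC. Qed.

Lemma of_uniX : of_uni 'X = 'X_2.
Proof. by rewrite /of_uni /= map_polyX /horner_eval hornerX. Qed.

Lemma inclC c : incl c%:MP = c%:MP.
Proof. exact: mmapC. Qed.

Lemma inclX i : incl 'X_i = 'X_(inord i).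
Proof. by rewrite /incl mmapX mmap1U. Qed.

Lemma to_uniC c : to_uni c%:MP = (c%:MP)%:P.
Proof. exact: mmapC. Qed.

Lemma to_uniX i : to_uni 'X_i = last_var i.
Proof. by rewrite /to_uni mmapX mmap1U. Qed.

Lemma to_uniK : cancel to_uni of_uni.
Proof.
apply: (rmorph_mpoly_ext (f := of_uni \o to_uni) (g := idfun)) => [c|i] /=.
  by rewrite to_uniC of_uniC inclC.
move: i; apply: forall_I3; rewrite to_uniX /last_var /= ?of_uniX ?of_uniC ?inclX;
  rewrite //; by congr 'X_ _; apply/val_inj; rewrite /= !inordK.
Qed.

Lemma to_uni_incl c : to_uni (incl c) = c%:P.
Proof.
apply: (rmorph_mpoly_ext (f := to_uni \o incl) (g := @polyC R2) _ _ c) => [a|i] /=.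
  by rewrite inclC to_uniC.
move: i; apply: forall_I2; rewrite inclX to_uniX /last_var -val_eqE /= !inordK //=;
  by congr ('X_ _)%:P; apply/val_inj; rewrite /= inordK.
Qed.

Lemma of_uniK : cancel of_uni to_uni.
Proof.
elim/poly_ind => [|f c IHf]; first by rewrite !rmorph0.
rewrite !rmorphD !rmorphM /= IHf of_uniX of_uniC to_uni_incl to_uniX.
by rewrite /last_var eqxx.
Qed.

Lemma to_uni_mon (m : 'X_{1..3}) :
  to_uni 'X_[m] = ('X_[bmon (m 0) (m 1)])%:P * 'X^(m 2).
Proof.
rewrite /to_uni mmapX /mmap1 !big_ord_recl big_ord0.
have -> : lift 0 0 = 1 :> 'I_3 by apply/val_inj.
have -> : lift 0 (lift 0 0) = 2 :> 'I_3 by apply/val_inj.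
have e0 : last_var 0 = ('X_0)%:P.
  by congr ('X_ _)%:P; apply/val_inj; rewrite /= inordK.
have e1 : last_var 1 = ('X_1)%:P.
  by congr ('X_ _)%:P; apply/val_inj; rewrite /= inordK.
have e2 : last_var 2 = 'X by [].
by rewrite mulr1 mulrA e0 e1 e2 mpolyX_bmon polyCM !polyC_exp.
Qed.

Lemma to_uni_homog k (p : R3) i : p \is k.-homog ->
  (to_uni p)`_i \is (k - i).-homog /\ ((k < i)%N -> (to_uni p)`_i = 0).
Proof.
move=> hp; rewrite [p]mpolyE rmorph_sum coef_sum.
have termE m : (to_uni (p@_m *: 'X_[m]))`_i
    = if m 2 == i then p@_m *: 'X_[bmon (m 0%R) (m 1%R)] else 0.
  rewrite -mul_mpolyC rmorphM /= to_uniC to_uni_mon mulrA -polyCM coefCM coefXn.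
  by rewrite mul_mpolyC eq_sym; case: eqP => _; rewrite ?mulr1 ?mulr0.
have mdeg3 (m : 'X_{1..3}) : mdeg m = (m 0%R + m 1%R + m 2%R)%N.
  rewrite mdegE !big_ord_recl big_ord0 addn0 addnA.
  by congr (_ + m _ + m _)%N; apply/val_inj.
rewrite big_seq; split=> [|ki].
  apply: rpred_sum => m mp; rewrite /= termE; case: eqP => [mi|_]; last exact: rpred0.
  rewrite rpredZ // dhomogX /= mdeg_bmon.
  by rewrite -(mdeg_homog hp mp) mdeg3 mi addnK.
rewrite big1 // => m mp; rewrite /= termE; case: eqP => // mi.
by move: ki; rewrite -(mdeg_homog hp mp) mdeg3 mi ltnNge leq_addl.
Qed.

Lemma to_uni_pihomog k (p : R3) i :
  (to_uni (pihomog mdeg k p))`_i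
    = if (i <= k)%N then pihomog mdeg (k - i) (to_uni p)`_i else 0.
Proof.
case: (leqP i k) => [ik|]; last exact: (to_uni_homog i (pihomogP mdeg k p)).2.
have -> : pihomog mdeg (k - i) (to_uni p)`_i
    = \sum_(j < msize p) pihomog mdeg (k - i) (to_uni (pihomog mdeg j p))`_i.
  by rewrite {1}[p]pihomog_sum_comps rmorph_sum coef_sum raddf_sum.
have hj j := to_uni_homog i (pihomogP mdeg j p).
have other j : j != k -> pihomog mdeg (k - i) (to_uni (pihomog mdeg j p))`_i = 0.
  move=> jk; have [ij|ji] := leqP i j; last by rewrite (hj j).2 // raddf0.
  by apply: pihomog_ne0 (hj j).1; apply: contra jk => /eqP eq; apply/eqP; lia.
have [lt|ge] := ltnP k (msize p).
  rewrite (bigD1 (Ordinal lt)) //= [X in _ + X]big1 ?addr0 => [|j neq].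
    by rewrite [RHS]pihomog_dE //; apply: (hj k).1.
  exact: other.
rewrite [RHS]big1 => [|j _]; last first.
  by apply: other; apply/eqP; have := ltn_ord j; lia.
rewrite pihomogE big_seq_cond big_pred0 ?rmorph0 ?coef0 // => m.
apply/negbTE/negP => /andP[/msize_mdeg_lt m'p /eqP eq].
by move: m'p; rewrite eq ltnNge ge.
Qed.

End LastVariable.

Section Gauss.

Variable K : closedFieldType.
Local Notation R2 := {mpoly K[2]}.

(** Eliminating a variable identifies the quotient by a linear form with a
    subring, so the linear form generates a prime ideal. *)
Lemma lform_reduce (al be : K) : (al, be) != 0 ->
  exists th : {rmorphism R2 -> R2}, th (lform al be) = 0 /\
    forall x, exists y, x - th x = lform al be * y.
Proof.
rewrite xpair_eqE negb_and => nz.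
have [v [w vw]] : exists v w : K, al * v + be * w = 1.
  case/orP: nz => nz; [exists (al^-1), 0|exists 0, (be^-1)].
    by rewrite mulr0 addr0 mulfV.
  by rewrite mulr0 add0r mulfV.
have [th [thC thX]] := mpoly_subst (@mpolyC 2 K)
  (fun i : 'I_2 => 'X_i - (if i == 0 then v else w)%:MP * lform al be).
exists th; split=> [|x].
  transitivity ((1 - (al * v + be * w))%:MP * lform al be); last first.
    by rewrite vw subrr mpolyC0 mul0r.
  rewrite {1}/lform rmorphD !rmorphM /= !thC !thX /=.
  by rewrite mpolyCB mpolyCD !mpolyCM mpolyC1 /lform; ring.
apply: (rmorph_congr (f := idfun) (g := th)
  (J := fun z => exists y, z = lform al be * y)) => [||||i] /=.
- by exists 0; rewrite mulr0.
- by move=> _ _ [y ->] [y' ->]; exists (y + y'); rewrite mulrDr.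
- by move=> z _ [y ->]; exists (z * y); rewrite mulrCA.
- by move=> c; rewrite thC.
- by rewrite thX subKr; eexists; rewrite mulrC.
Qed.

Lemma lform_neq0 al be : (al, be) != 0 -> lform al be != 0 :> R2.
Proof.
apply: contraNneq => l0; rewrite xpair_eqE.
have := congr1 (fun p : R2 => p@_U_(0)) l0.
have := congr1 (fun p : R2 => p@_U_(1)) l0.
by rewrite /lform !mcoeffD !mcoeffCM !mcoeffXU /= !mulr1 !mulr0 addr0 add0r
  !mcoeff0 => -> ->; rewrite eqxx.
Qed.

Lemma lform_prime_poly al be (H G F : {poly R2}) : (al, be) != 0 ->
  H * G = (lform al be)%:P * F ->
  (exists H', H = (lform al be)%:P * H') \/ (exists G', G = (lform al be)%:P * G').
Proof.
move=> nz HG; have [th [thl thx]] := lform_reduce nz.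
have div H' : map_poly th H' = 0 -> exists H'', H' = (lform al be)%:P * H''.
  move=> H'0; have coefH i : exists y, H'`_i = lform al be * y.
    have [y Ey] := thx H'`_i; exists y; rewrite -Ey.
    have -> : th H'`_i = 0 by rewrite -coef_map H'0 coef0.
    by rewrite subr0.
  have [y Ey] : exists y : 'I_(size H') -> R2,
      forall i : 'I_(size H'), H'`_i = lform al be * y i.
    exact: (fin_all_exists (P := fun (i : 'I_(size H')) y =>
      H'`_i = lform al be * y)).
  exists (\sum_i y i *: 'X^i); rewrite -[LHS]coefK poly_def mulr_sumr.
  by apply: eq_bigr => i _; rewrite Ey mul_polyC scalerA.
have : map_poly th H * map_poly th G = 0.
  by rewrite -rmorphM HG rmorphM /= map_polyC /= thl polyC0 mul0r.
by move/eqP; rewrite mulf_eq0 => /orP[] /eqP /div; [left|right].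
Qed.

(** Gauss's lemma for a denominator which is a product of linear forms. *)
Lemma gauss_form e (c : R2) (F H G : {poly R2}) :
  c \is e.-homog -> c != 0 -> c%:P * F = H * G ->
  exists c1 c2 H' G', [/\ c = c1 * c2, H = c1%:P * H', G = c2%:P * G' & F = H' * G'].
Proof.
elim: e c F H G => [|e IHe] c F H G hc c_neq0 cF.
  move: c_neq0 cF; rewrite (homog0_const hc) mpolyC_eq0; set k := c@_0 => k_neq0.
  have kV : (k%:MP : R2)%:P * (k^-1%:MP)%:P = 1.
    by rewrite -polyCM -mpolyCM mulfV // mpolyC1 polyC1.
  move=> cF; exists k%:MP, 1, ((k^-1%:MP)%:P * H), G; split.
  - by rewrite mulr1.
  - by rewrite mulrA kV mul1r.
  - by rewrite polyC1 mul1r.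
  - by rewrite -mulrA -cF mulrA [X in X * F]mulrC kV mul1r.
have [al [be [c' [nz hc' cE]]]] := form_linear_factor hc.
have c'_neq0 : c' != 0.
  by apply: contraNneq c_neq0 => c'0; rewrite cE c'0 mulr0.
have l_reg : GRing.lreg ((lform al be)%:P : {poly R2}).
  by apply: mulfI; rewrite polyC_eq0 lform_neq0.
have [|[H' HE]|[G' GE]] := @lform_prime_poly al be H G (c'%:P * F) nz.
- by rewrite -cF cE polyCM mulrA.
- have [|c1 [c2 [H'' [G'' [cE' HE' GE' FE]]]]] := IHe c' F H' G hc' c'_neq0.
    apply: l_reg; transitivity (c%:P * F); first by rewrite cE polyCM mulrA.
    by rewrite cF HE mulrA.
  exists (lform al be * c1), c2, H'', G''.
  split; [by rewrite cE cE' mulrA|by rewrite HE HE' polyCM mulrA|exact: GE'|].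
  exact: FE.
- have [|c1 [c2 [H'' [G'' [cE' HE' GE' FE]]]]] := IHe c' F H G' hc' c'_neq0.
    apply: l_reg; transitivity (c%:P * F); first by rewrite cE polyCM mulrA.
    by rewrite cF GE mulrCA.
  exists c1, (lform al be * c2), H'', G''.
  split; [by rewrite cE cE' mulrCA|exact: HE'|by rewrite GE GE' polyCM mulrA|].
  exact: FE.
Qed.

End Gauss.

Section ImplicitEquation.

Variable K : closedFieldType.
Local Notation R2 := {mpoly K[2]}.
Local Notation R3 := {mpoly K[3]}.

Variable d : nat.
Hypothesis d_gt0 : (0 < d)%N.
Variable g : {rmorphism R3 -> R2}.
Hypothesis g_const : forall c, g c%:MP \is 0.-homog.
Hypothesis g_var : forall i, g 'X_i \is d.-homog.
Hypothesis g_lform : forall al be, (al, be) != 0 ->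
  g (incl (lform al be)) != 0.
Hypothesis g_unit : forall p, g p = 0 -> p \isn't a GRing.unit.

Let ker (f : {poly R2}) := g (of_uni f) = 0.

Let kerM f h : ker h -> ker (f * h).
Proof. by rewrite /ker of_uniM rmorphM => ->; rewrite mulr0. Qed.

Let g_form e c : c \is e.-homog -> c != 0 -> g (incl c) != 0.
Proof.
move=> hc c_neq0; apply: (form_prod_neq0 hc c_neq0 (f := g \o @incl K)) => al be.
exact: g_lform.
Qed.

Let ker_cancel e c f : c \is e.-homog -> c != 0 -> ker (c%:P * f) -> ker f.
Proof.
move=> hc c_neq0; rewrite /ker of_uniM rmorphM of_uniC => /eqP.
by rewrite mulf_eq0 (negbTE (g_form hc c_neq0)) => /eqP.
Qed.

(** The kernel is homogeneous, so an element of minimal degree in X_2 can be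
    replaced by the homogeneous part that carries its leading coefficient,
    which then becomes a form. *)
Lemma min_degree_form (p0 : R3) : p0 != 0 -> g p0 = 0 ->
  exists r e, [/\ ker r, r != 0, lead_coef r \is e.-homog &
    forall f, ker f -> f != 0 -> (size r <= size f)%N].
Proof.
move=> p0_neq0 gp0.
pose S n := exists f, [/\ ker f, f != 0 & size f = n].
have exS : exists n, S n.
  exists (size (to_uni p0)), (to_uni p0); rewrite /ker to_uniK; split=> //.
  by rewrite -(inj_eq (can_inj (@of_uniK K))) to_uniK rmorph0.
have [n [[f0 [kf0 f0_neq0 sf0]] minn]] :
    exists n, S n /\ forall m, S m -> (n <= m)%N.
  have [n Sn] := exS; move: n Sn; elim/ltn_ind => n IHn Sn.
  have [[m [Sm mn]]|none] := classic (exists m, S m /\ (m < n)%N).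
    exact: IHn mn Sm.
  exists n; split=> // m Sm; rewrite leqNgt; apply/negP => mn.
  by apply: none; exists m.
pose p := of_uni f0; have f0E : f0 = to_uni p by rewrite /p of_uniK.
(* The total degree k is chosen so that the leading coefficient in X_2 survives
   in the part of degree k. *)
have [k lead_k] : exists k, pihomog mdeg (k - n.-1) (f0`_n.-1) != 0
    /\ (n.-1 <= k)%N.
  have : f0`_n.-1 != 0 by rewrite -sf0 -lead_coefE lead_coef_eq0.
  move=> nz; apply: NNPP => none; case/eqP: nz; apply: homog_comps => j.
  apply/eqP; apply: contra_notT none => nz; exists (j + n.-1)%N.
  by rewrite addnK leq_addl.
pose r := to_uni (pihomog mdeg k p).
have rE i : r`_i = if (i <= k)%N then pihomog mdeg (k - i) f0`_i else 0.
  by rewrite /r to_uni_pihomog -f0E.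
have size_r : (size r <= n)%N.
  apply/leq_sizeP => i ni; rewrite rE (nth_default _ (n := i)) ?sf0 // raddf0.
  by case: ifP.
have r_lead : r`_n.-1 != 0 by rewrite rE lead_k.2; apply: lead_k.1.
have kr : ker r.
  by rewrite /ker /r to_uniK (rmorph_pihomog _ _ d_gt0) // kf0 raddf0.
have r_neq0 : r != 0 by apply: contraNneq r_lead => ->; rewrite coef0.
have size_rE : size r = n.
  by apply/eqP; rewrite eqn_leq size_r minn //; exists r.
exists r, (k - n.-1)%N; split=> //.
  by rewrite lead_coefE size_rE rE lead_k.2 pihomogP.
by move=> f kf f_neq0; rewrite size_rE minn //; exists f.
Qed.

Lemma ker_pseudo_div r e f : ker r -> r != 0 -> lead_coef r \is e.-homog ->
  (forall f, ker f -> f != 0 -> (size r <= size f)%N) -> ker f ->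
  exists c e' q, [/\ c \is e'.-homog, c != 0 & c%:P * f = q * r].
Proof.
move=> kr r_neq0 hr r_min kf.
have E := Pdiv.WeakIdomain.divp_eq f r; rewrite -mul_polyC in E.
set c := lead_coef r ^+ _ in E.
exists c, (e * scalp f r)%N, (f %/ r); split; first exact: dhomogMn hr.
  by rewrite expf_neq0 // lead_coef_eq0.
suff mod0 : f %% r = 0 by rewrite E mod0 addr0.
apply/eqP; apply: contraT => mod_neq0.
have km : ker (f %% r).
  have -> : f %% r = c%:P * f + - (f %/ r) * r.
    by rewrite E mulNr addrAC subrr add0r.
  by rewrite /ker rmorphD rmorphD; rewrite [g _](kerM _ kf) [g _](kerM _ kr) addr0.
by have := r_min _ km mod_neq0; rewrite leqNgt Pdiv.CommonIdomain.ltn_modp r_neq0.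
Qed.

(** An element r of the kernel of minimal degree in the last variable divides
    every element of the kernel up to a product of linear forms, none of which
    lies in the kernel; by Gauss's lemma the irreducible E is r, up to such a
    factor, and divides every element of the kernel. *)
Lemma irreducible_generates_ker (E p : R3) :
  irreducible_elt E -> g E = 0 -> g p = 0 -> exists q, p = q * E.
Proof.
move=> [E_neq0 _ E_irr] gE gp.
have [r [e [kr r_neq0 hr r_min]]] := min_degree_form E_neq0 gE.
have pseudo := ker_pseudo_div kr r_neq0 hr r_min.
have kU x : g x = 0 -> ker (to_uni x) by move=> gx; rewrite /ker to_uniK.
have irr a b : to_uni E = a * b -> of_uni a \is a GRing.unit \/ of_uni b \is a GRing.unit.
  by move=> Eab; apply: E_irr; rewrite -of_uniM -Eab to_uniK.
have ker_nonunit f : ker f -> ~ of_uni f \is a GRing.unit.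
  by move=> kf; apply/negP; apply: g_unit.
have [c [e1 [q [hc c_neq0 cE]]]] := pseudo _ (kU E gE).
have [c1 [c2 [q' [r' [cc qE rE EE]]]]] := gauss_form hc c_neq0 cE.
have kr' : ker r'.
  apply: (ker_cancel hc c_neq0); rewrite cc polyCM -mulrA -rE; exact: kerM.
have uq' : of_uni q' \is a GRing.unit 
  by case: (irr _ _ EE) => [h|h]; [exact: h|case: (ker_nonunit _ kr' h)].
have [c' [e2 [s [hc' c'_neq0 cp]]]] := pseudo _ (kU p gp).
have eq2 : c'%:P * to_uni p = (s * c2%:P * to_uni (of_uni q')^-1) * to_uni E.
  have qV : q' * to_uni (of_uni q')^-1 = 1.
    by rewrite -{1}(of_uniK q') -to_uniM mulrV //; apply: (rmorph1 (@to_uni K)).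
  rewrite cp rE EE; set v := to_uni _ in qV *.
  by transitivity (s * c2%:P * (q' * v) * r'); [rewrite qV|]; ring.
have [d1 [d2 [s' [E' [dd _ EE' pE]]]]] := gauss_form hc' c'_neq0 eq2.
have kE' : ker E'.
  apply: (ker_cancel hc' c'_neq0); rewrite dd polyCM -mulrA -EE'.
  by apply: kerM; apply: kU.
have ud2 : of_uni d2%:P \is a GRing.unit.
  by case: (irr _ _ EE') => [h|h]; [exact: h|case: (ker_nonunit _ kE' h)].
have EU : E = of_uni d2%:P * of_uni E' by rewrite -of_uniM -EE' to_uniK.
have pU : p = of_uni s' * of_uni E' by rewrite -of_uniM -pE to_uniK.
move: (of_uni s') (of_uni d2%:P) (of_uni E') EU pU ud2 => a b z -> -> ub.
by exists (a * b^-1); rewrite -mulrA mulKr.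
Qed.

End ImplicitEquation.

Section CurveKernel.

Variable K : closedFieldType.
Local Notation A := {mpoly {mpoly K[2]}[3]}.
Variables (u : 'I_3 -> {mpoly K[2]}) (d : nat).
Hypothesis u_homog : forall i, u i \is d.-homog.

Local Notation ev := (meval u).

Lemma dehom_horner (f : {mpoly K[2]}) r :
  (dehom f).[r] = f.@[fun i => if i == 0 then 1 else r].
Proof.
apply: (rmorph_mpoly_ext (f := horner_eval r \o @dehom K)
  (g := meval (fun i : 'I_2 => if i == 0 then 1 else r))) => [c|i] /=.
  by rewrite dehomC /horner_eval hornerC mevalC.
rewrite mevalXU /horner_eval; move: i; apply: forall_I2.
  by rewrite dehomX0 hornerC.
by rewrite dehomX1 hornerX.
Qed.

Lemma form_vanishing_eq0 e (f : {mpoly K[2]}) : f \is e.-homog ->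
  (forall r, f.@[fun i => if i == 0 then 1 else r] = 0) -> f = 0.
Proof.
move=> hf f0; apply: (dehom_inj hf); apply/eqP; apply: contraT.
by move=> /closed_nonrootP [r]; rewrite /root dehom_horner f0 eqxx.
Qed.

Definition on_curve : {rmorphism {mpoly K[3]} -> {mpoly K[2]}} :=
  meval u \o @x_poly K.

Lemma on_curveC c : on_curve c%:MP = c%:MP.
Proof. by rewrite /on_curve /= x_polyC mevalC. Qed.

Lemma on_curveX i : on_curve 'X_i = u i.
Proof. by rewrite /on_curve /= x_polyX mevalXU. Qed.

Lemma on_curve_meval (p : {mpoly K[3]}) (v : 'I_2 -> K) :
  (on_curve p).@[v] = p.@[fun i => (u i).@[v]].
Proof.
apply: (rmorph_mpoly_ext (f := meval v \o on_curve)
  (g := meval (fun i : 'I_3 => (u i).@[v]))) => [c|i].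
  transitivity ((c%:MP : {mpoly K[2]}).@[v]); last by rewrite /= !mevalC.
  exact: (congr1 (meval v) (on_curveC c)).
transitivity (u i).@[v]; last by rewrite /= mevalXU.
exact: (congr1 (meval v) (on_curveX i)).
Qed.

(** The pullback of the equation is a form that vanishes at every point of the
    projective line, over an infinite field. *)
Lemma on_curve_equation (E : {mpoly K[3]}) : (0 < d)%N ->
  defines_image u d E -> on_curve E = 0.
Proof.
move=> d_gt0 [hE _ E_zero].
have hgE : on_curve E \is (d * d).-homog.
  have := homog_rmorph (g := on_curve) (e := 0) (k := d) (p := E).
  apply=> // [m|i]; first by rewrite on_curveC homog_mpolyC.
  by rewrite on_curveX.
apply: (form_vanishing_eq0 hgE) => r; rewrite on_curve_meval.
pose tr : 'rV[K]_2 := \row_i (if i == 0 then 1 else r).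
have tr_neq0 : tr != 0.
  apply/eqP => /(congr1 (fun v : 'rV_2 => v 0 0)); rewrite !mxE /= => /eqP.
  by rewrite oner_eq0.
pose x := form_map u tr.
have xE i : x 0 i = (u i).@[fun i => if i == 0 then 1 else r].
  by rewrite mxE; apply: meval_eq => k; rewrite mxE.
rewrite -(meval_eq (v1 := x 0)) //.
have [x0|x_neq0] := eqVneq x 0.
  by apply: (homog_gt0_at0 hE d_gt0) => i; rewrite x0 mxE.
apply/(E_zero x x_neq0); exists tr => //; exists 1; first exact: oner_neq0.
by rewrite scale1r.
Qed.

Variables (P Q : A) (mu : nat).
Hypothesis PQ_basis : mu_basis u d mu P Q.
Hypothesis mu_gt0 : (0 < mu)%N.

Let mu_lt_d : (mu < d)%N.
Proof. by case: PQ_basis => + _ _ _; rewrite -addnn; lia. Qed.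

(** A linear relation among the u_i would be a syzygy of T-degree 0, whereas P
    and Q have positive T-degrees. *)
Lemma no_linear_relation (L : A) : bihomog 0 1 L -> ev L = 0 -> L = 0.
Proof.
move=> [hL hL'] eL; have [a [b LE]] := syz_mem PQ_basis hL eL.
rewrite -(tcomp_id hL') LE raddfD /=.
rewrite (tcomp_Mr _ _ (P_bihomog PQ_basis).2) (tcomp_Mr _ _ (Q_bihomog PQ_basis).2).
rewrite leqNgt mu_gt0 /= leqNgt subn_gt0 mu_lt_d /= addr0 //.
Qed.

Lemma on_curve_lform al be : (al, be) != 0 ->
  on_curve (incl (lform al be)) != 0.
Proof.
apply: contraNneq.
pose y : {mpoly K[3]} := al%:MP * 'X_0 + be%:MP * 'X_1.
have -> : incl (lform al be) = y.
  rewrite /lform rmorphD !rmorphM /= !inclC !inclX.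
  by congr (_ * 'X_ _ + _ * 'X_ _); apply/val_inj; rewrite /= inordK.
move=> y0; have hy : y \is 1.-homog by rewrite rpredD // homog_mulC // homog_var.
have := no_linear_relation (bihomog_x hy) y0 => /eqP.
rewrite -(rmorph0 (@x_poly K)) (inj_eq (@x_poly_inj K)) => /eqP {}y0.
have := congr1 (fun p : {mpoly K[3]} => p@_U_(0)) y0.
have := congr1 (fun p : {mpoly K[3]} => p@_U_(1)) y0.
rewrite !mcoeffD !mcoeffCM !mcoeffXU /= !mulr1 !mulr0 addr0 add0r !mcoeff0.
by move=> -> ->; rewrite xpair_eqE eqxx.
Qed.

(** The general statement on irreducible elements applies, since by the absence
    of linear relations the pullback kills no linear form in X_0 and X_1. *)
Lemma curve_ker_principal (E p : {mpoly K[3]}) :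
  defines_image u d E -> on_curve p = 0 -> exists q, p = q * E.
Proof.
move=> E_curve p0; have d_gt0 : (0 < d)%N := ltn_trans mu_gt0 mu_lt_d.
have E0 := on_curve_equation d_gt0 E_curve.
have [_ E_irr _] := E_curve.
apply: (irreducible_generates_ker d_gt0 (g := on_curve)) E_irr E0 p0.
- by move=> c; rewrite on_curveC homog_mpolyC.
- by move=> i; rewrite on_curveX.
- exact: on_curve_lform.
- move=> f f0; apply/negP => /(rmorph_unit on_curve); rewrite f0 unitr0 //.
Qed.

End CurveKernel.

(** * The resultant of P and Q *)

Lemma homog_prod1 (R : comNzRingType) (n l : nat) (F : 'I_l -> {mpoly R[n]}) :
  (forall i, F i \is 1.-homog) -> \prod_i F i \is l.-homog.
Proof.
move=> hF; suff : \prod_i F i \is (\sum_(i < l) 1)%N.-homog.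
  by rewrite sum1_card card_ord.
apply: (big_ind2 (fun q j => q \is j.-homog)) => [|q1 d1 q2 d2|i _].
- exact: dhomog1.
- exact: dhomogM.
- exact: hF.
Qed.

Lemma homog_det (R : comNzRingType) (n l : nat) (M : 'M[{mpoly R[n]}]_l) :
  (forall i j, M i j \is 1.-homog) -> \det M \is l.-homog.
Proof.
move=> hM; apply: rpred_sum => s _; rewrite -signr_odd.
by case: (odd _); rewrite ?expr0 ?mul1r ?expr1 ?mulN1r ?rpredN; apply: homog_prod1.
Qed.

Lemma mcoeff_toB_homog (K : fieldType) j (x : {mpoly {mpoly K[2]}[3]}) m :
  x \is j.-homog -> (toB x)@_m \is j.-homog.
Proof.
move=> hx; apply/dhomogP => w.
rewrite mcoeff_msupp mcoeff_toB => xw; apply: (mdeg_homog hx).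
by rewrite mcoeff_msupp; apply: contraNneq xw => ->; rewrite mcoeff0.
Qed.

Section Resultant.

Variable K : closedFieldType.
Local Notation A := {mpoly {mpoly K[2]}[3]}.
Variables (u : 'I_3 -> {mpoly K[2]}) (d m : nat).
Hypothesis d_eq : d = (m.+1 + 2)%N.

Variables (P Q : A).
Hypothesis PQ_basis : mu_basis u d 2 P Q.

Definition sylv_row (r : 'I_(m.+1 + 2)) : A :=
  match split r with
  | inl r' => P * tmon K (m - r') r'
  | inr s => Q * tmon K (1 - s) s
  end.

Lemma sylv_rowl r : sylv_row (lshift 2 r) = P * tmon K (m - r) r.
Proof.
by rewrite /sylv_row (_ : split _ = inl r) //; apply: (unsplitK (inl r)).
Qed.

Lemma sylv_rowr s : sylv_row (rshift m.+1 s) = Q * tmon K (1 - s) s.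
Proof.
by rewrite /sylv_row (_ : split _ = inr s) //; apply: (unsplitK (inr s)).
Qed.

(** Sylvester's matrix: the rows are the coefficients in T of the multiples of
    P and Q by monomials. *)
Definition sylv : 'M[{mpoly K[3]}]_(m.+1 + 2) :=
  \matrix_(r, c) (toB (sylv_row r))@_(bmon (m + 2 - c) c).

Lemma bihomog_sylv_row r : bihomog (m + 2) 1 (sylv_row r).
Proof.
have hP := P_bihomog PQ_basis; have hQ := Q_bihomog PQ_basis.
case: (split_ordP r) => [r' ->|s ->].
  rewrite sylv_rowl; apply: (bihomog_cast (bihomogM hP (bihomog_tmon K _ _))) => //.
  by have := ltn_ord r'; clear; lia.
rewrite sylv_rowr; apply: (bihomog_cast (bihomogM hQ (bihomog_tmon K _ _))) => //.
by have := ltn_ord s; move: d_eq; clear; lia.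
Qed.

Lemma sylv_row_sum r :
  sylv_row r = \sum_c x_poly (sylv r c) * tmon K (m + 2 - c) c.
Proof.
have [_ hr] := bihomog_sylv_row r; rewrite {1}(cf_sum hr).
rewrite -addSn; apply: eq_bigr => c _; by rewrite mxE.
Qed.

Definition resultant_PQ : {mpoly K[3]} := \det sylv.

Lemma resultant_homog : resultant_PQ \is d.-homog.
Proof.
rewrite d_eq; apply: homog_det => r c; rewrite mxE.
exact: mcoeff_toB_homog (bihomog_sylv_row r).1.
Qed.

(** By the adjugate matrix a monomial multiple of the resultant is a
    combination of P and Q, which vanish on substituting u. *)
Lemma resultant_on_curve : on_curve u resultant_PQ = 0.
Proof.
have evP : meval u P = 0.
  exact: (rees_ker_homog u (P_bihomog PQ_basis).1).1 (P_ker PQ_basis).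
have evQ : meval u Q = 0.
  exact: (rees_ker_homog u (Q_bihomog PQ_basis).1).1 (Q_ker PQ_basis).
have ev_row r : meval u (sylv_row r) = 0.
  case: (split_ordP r) => [r' ->|s ->].
    by rewrite sylv_rowl mevalM evP mul0r.
  by rewrite sylv_rowr mevalM evQ mul0r.
have detE : x_poly resultant_PQ * tmon K (m + 2) 0
    = \sum_r x_poly (\adj sylv ord0 r) * sylv_row r.
  under eq_bigr do rewrite sylv_row_sum mulr_sumr.
  rewrite exchange_big /=.
  have adjE c : \sum_r \adj sylv ord0 r * sylv r c = if c == ord0 then resultant_PQ else 0.
    have := congr1 (fun N : 'M_(m.+1 + 2) => N ord0 c) (mul_adj_mx sylv).
    by rewrite !mxE eq_sym => ->; case: eqP => _; rewrite ?mulr1n ?mulr0n.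
  rewrite (bigD1 ord0) //= [X in _ + X]big1 ?addr0 => [|c c_neq0].
    under eq_bigr do rewrite mulrA -(rmorphM (@x_poly K)).
    by rewrite -mulr_suml -(rmorph_sum (@x_poly K)) adjE eqxx subn0.
  under eq_bigr do rewrite mulrA -(rmorphM (@x_poly K)).
  rewrite -mulr_suml -(rmorph_sum (@x_poly K)) adjE (negbTE c_neq0).
  by rewrite (rmorph0 (@x_poly K)) mul0r.
have : meval u (\sum_r x_poly (\adj sylv ord0 r) * sylv_row r) = 0.
  rewrite (rmorph_sum (meval u)); apply: big1 => r _.
  by rewrite [LHS]mevalM ev_row mulr0.
rewrite -detE mevalM /tmon expr0 mulr1 tvarE mevalC => /eqP.
rewrite mulf_eq0 => /orP[/eqP //|].
by rewrite mpolyXn -msize_poly_eq0 msizeX.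
Qed.

Lemma cf_comb n (y : 'I_n.+1 -> {mpoly K[3]}) (k : 'I_n.+1) :
  cf (n - k) k (\sum_r x_poly (y r) * tmon K (n - r) r) = x_poly (y k).
Proof.
rewrite raddf_sum (bigD1 k) //= [X in _ + X]big1 ?addr0 => [|r neq].
  by rewrite cf_Mtmon !leqnn !subnn cf_x eqxx.
rewrite cf_Mtmon; case: ifP => // /andP[h1 h2]; rewrite cf_x ifF //.
apply/negP => /andP[/eqP e1 /eqP e2]; case/eqP: neq; apply/val_inj => /=; lia.
Qed.

(** A relation among the rows is a relation a P + b Q = 0 with b of T-degree 1,
    less than the T-degree of P, although P is prime to Q. *)
Lemma resultant_neq0 : resultant_PQ != 0.
Proof.
apply/det0P => -[v v_neq0 vS].
pose a := \sum_(r < m.+1) x_poly (v 0 (lshift 2 r)) * tmon K (m - r) r.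
pose b := \sum_(s < 2) x_poly (v 0 (rshift m.+1 s)) * tmon K (1 - s) s.
have abPQ : b * Q = - a * P.
  apply/eqP; rewrite mulNr -addr_eq0 addrC.
  have -> : a * P + b * Q = \sum_r x_poly (v 0 r) * sylv_row r.
    rewrite big_split_ord /= !mulr_suml; congr (_ + _); apply: eq_bigr => r _.
      by rewrite sylv_rowl; ring.
    by rewrite sylv_rowr; ring.
  under eq_bigr do rewrite sylv_row_sum mulr_sumr.
  rewrite exchange_big big1 //= => c _.
  under eq_bigr do rewrite mulrA -(rmorphM (@x_poly K)).
  rewrite -mulr_suml -(rmorph_sum (@x_poly K)).
  have -> : \sum_r v 0 r * sylv r c = 0.
    by have := congr1 (fun N : 'rV_(m.+1 + 2) => N 0 c) vS; rewrite !mxE.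
  by rewrite (rmorph0 (@x_poly K)) mul0r.
have [z bE] := P_prime_to_Q PQ_basis abPQ.
have hb : thomog 1 b.
  apply: thomog_sum => s; apply: (thomogM (i := 0)); first exact: thomog_x.
  have e : (1 - s + s = 1)%N by have := ltn_ord s; clear; lia.
  exact: (bihomog_cast (bihomog_tmon K (1 - s) s) e (erefl _)).2.
have b0 : b = 0.
  by rewrite -(tcomp_id hb) bE (tcomp_Mr _ _ (P_bihomog PQ_basis).2).
have a0 : a = 0.
  apply: (@P_reg _ _ _ _ _ _ PQ_basis) => /=.
  by rewrite mulr0 mulrC -[a * P]opprK -mulNr -abPQ b0 mul0r oppr0.
case/eqP: v_neq0; apply/rowP => r; rewrite mxE; apply: (@x_poly_inj K).
rewrite (rmorph0 (@x_poly K)).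
case: (split_ordP r) => [r' ->|s ->].
  rewrite -(cf_comb (fun r => v 0 (lshift 2 r)) r') -/a a0.
  exact: raddf0.
rewrite -(cf_comb (n := 1) (fun s => v 0 (rshift m.+1 s)) s) -/b b0.
exact: raddf0.
Qed.

End Resultant.

(** * A common zero of the coefficients of P is a point of high multiplicity *)

Lemma size_prod_le (R : comNzRingType) (n : nat) (F : 'I_n -> {poly R})
    (deg : 'I_n -> nat) :
  (forall i, (size (F i) <= (deg i).+1)%N) ->
  (size (\prod_i F i)%R <= (\sum_i deg i).+1)%N.
Proof.
move=> hF.
apply: (big_ind2 (fun (q : {poly R}) j => (size q <= j.+1)%N)) => [|q1 d1 q2 d2 h1 h2|i _].
- by rewrite size_poly1.
- apply: leq_trans (size_polyMleq _ _) _; move: h1 h2; clear; lia.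
- exact: hF.
Qed.

Lemma size_det_le (R : comNzRingType) (n : nat) (M : 'M[{poly R}]_n)
    (deg : 'I_n -> nat) :
  (forall i j, (size (M i j) <= (deg i).+1)%N) ->
  (size (\det M) <= (\sum_i deg i).+1)%N.
Proof.
move=> hM; apply: leq_trans (size_sum _ _ _) _; apply/bigmax_leqP => s _.
rewrite -signr_odd mulr_sign; case: (odd _); rewrite ?size_polyN;
  exact: (size_prod_le (F := fun i => M i (s i))).
Qed.

Section Direction.

Variables (K : fieldType) (v : 'I_3 -> K) (i : 'I_3).
Local Notation R3 := {mpoly K[3]}.

(** The coordinates of Y + s v, where s is the variable of the univariate
    polynomials and the i-th entry of Y is 0: the line of direction v through a
    point Y of the plane X_i = 0. *)
Definition line_var (j : 'I_3) : {poly R3} :=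
  (if j == i then 0 else 'X_j)%:P + (v j)%:MP *: 'X.

Definition line : R3 -> {poly R3} := mmap (polyC \o @mpolyC 3 K) line_var.
HB.instance Definition _ := GRing.RMorphism.copy line
  (mmap (polyC \o @mpolyC 3 K) line_var).

Lemma lineC c : line c%:MP = (c%:MP)%:P.
Proof. exact: mmapC. Qed.

Lemma lineM x y : line (x * y) = line x * line y.
Proof. exact: (rmorphM line). Qed.

Lemma lineD x y : line (x + y) = line x + line y.
Proof. exact: (rmorphD line). Qed.

Lemma lineX j : line 'X_j = line_var j.
Proof. by rewrite /line mmapX mmap1U. Qed.

Definition graded (d : nat) (f : {poly R3}) : Prop :=
  forall k, f`_k \is (d - k).-homog /\ ((d < k)%N -> f`_k = 0).

Lemma gradedM d e f h : graded d f -> graded e h -> graded (d + e) (f * h).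
Proof.
move=> hf hh k; rewrite coefM; split=> [|dk].
  apply: rpred_sum => j _.
  have [jd|dj] := leqP j d; last by rewrite (hf j).2 // mul0r rpred0.
  have [kje|ekj] := leqP (k - j) e; last by rewrite (hh _).2 // mulr0 rpred0.
  have -> : (d + e - k = (d - j) + (e - (k - j)))%N.
    by move: (ltn_ord j) jd kje; clear; lia.
  exact: dhomogM (hf j).1 (hh _).1.
apply: big1 => j _; have [jd|dj] := leqP j d; last by rewrite (hf j).2 // mul0r.
rewrite (hh _).2 ?mulr0 //; move: (ltn_ord j) jd dk; clear; lia.
Qed.

Lemma graded_line d p : p \is d.-homog -> graded d (line p).
Proof.
move=> hp; rewrite [p]mpolyE (rmorph_sum line) big_seq.
apply: (big_ind (graded d)) => [k|f h hf hh k|m mp].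
- by rewrite coef0 rpred0.
- rewrite coefD; split=> [|dk]; first by rewrite rpredD ?(hf k).1 ?(hh k).1.
  by rewrite (hf k).2 // (hh k).2 // addr0.
have gradedC c : graded 0 ((c%:MP)%:P : {poly R3}).
  move=> k; rewrite coefC; case: eqP => [->|]; last by rewrite rpred0.
  by rewrite homog_mpolyC.
have graded1 : graded 0 1 by rewrite -polyC1 -(mpolyC1 3 K); apply: gradedC.
rewrite /= -mul_mpolyC lineM lineC -[d]add0n; apply: gradedM (gradedC _) _.
rewrite mpolyXE_id (rmorph_prod line) -(mdeg_homog hp mp) mdegE.
apply: (big_ind2 (fun q j => graded j q)) => [|q1 d1 q2 d2|j _]; first exact: graded1.
  exact: gradedM.
rewrite (rmorphXn line) /= lineX.
have graded_var : graded 1 (line_var j).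
  move=> k; rewrite /line_var coefD coefC coefZ coefX.
  case: k => [|[|k]] /=; rewrite ?mulr0 ?addr0 ?add0r ?mulr1 ?rpred0 //.
    by split=> //; case: ifP => _; rewrite ?rpred0 ?homog_var.
  by rewrite subnn homog_mpolyC.
elim: (m j) => [|n IHn]; first by rewrite expr0; apply: graded1.
by rewrite exprS -addn1 addnC; apply: gradedM graded_var IHn.
Qed.

Lemma size_line_linear (l : 'I_3 -> K) :
  (size (line (\sum_j (l j)%:MP * 'X_j)%R) <= 2)%N.
Proof.
rewrite (rmorph_sum line); apply: leq_trans (size_sum _ _ _) _; apply/bigmax_leqP => j _.
rewrite /= lineM lineC lineX mul_polyC; apply: leq_trans (size_scale_leq _ _) _.
apply: leq_trans (size_polyD _ _) _; rewrite geq_max.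
rewrite (leq_trans (size_polyC_leq1 _)) //=.
by apply: leq_trans (size_scale_leq _ _) _; rewrite size_polyX.
Qed.

Lemma size_line_linear0 (l : 'I_3 -> K) : \sum_j l j * v j = 0 ->
  (size (line (\sum_j (l j)%:MP * 'X_j)%R) <= 1)%N.
Proof.
move=> lv; rewrite (rmorph_sum line) /=.
have -> : \sum_j line ((l j)%:MP * 'X_j)
    = (\sum_j (l j)%:MP * (if j == i then 0 else 'X_j))%:P
      + (\sum_j l j * v j)%:MP *: 'X.
  rewrite !rmorph_sum scaler_suml -big_split; apply: eq_bigr => j _ /=.
  rewrite lineM lineC lineX /line_var mulrDr -polyCM; congr (_ + _).
  by rewrite mul_polyC scalerA mpolyCM.
by rewrite lv mpolyC0 scale0r addr0 size_polyC_leq1.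
Qed.

Hypothesis vi : v i = 1.

(** If the local equation vanished, E would be divisible by X_i - 1, which a
    homogeneous irreducible polynomial is not. *)
Lemma line1_neq0 d (E : R3) : (0 < d)%N -> E \is d.-homog -> irreducible_elt E ->
  (line E).[1] != 0.
Proof.
move=> d_gt0 hE [E_neq0 _ E_irr]; apply/eqP => E1.
have [ch [chC chX]] := mpoly_subst (@mpolyC 3 K) (fun j => 'X_j - (v j)%:MP : R3).
have [th [thC thX]] := mpoly_subst (@mpolyC 3 K)
  (fun j => if j == i then 1 else 'X_j : R3).
have thE : th E = 0.
  transitivity (ch (line E).[1]); last by rewrite E1 rmorph0.
  apply/esym; apply: (rmorph_mpoly_ext (f := ch \o horner_eval 1 \o line) (g := th)).
    by move=> c; rewrite /= lineC /horner_eval hornerC chC thC.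
  move=> j; rewrite /= lineX thX /horner_eval /line_var hornerD hornerC hornerZ.
  rewrite hornerX mulr1 rmorphD chC; have [->|ji] := eqVneq j i.
    by rewrite rmorph0 add0r /= vi mpolyC1.
  by rewrite chX subrK.
have [q Eq] : exists q, E - th E = ('X_i - 1) * q.
  apply: (rmorph_congr (f := idfun) (g := th)
    (J := fun z => exists y, z = ('X_i - 1) * y)) => [||||j] /=.
  - by exists 0; rewrite mulr0.
  - by move=> _ _ [y ->] [y' ->]; exists (y + y'); rewrite mulrDr.
  - by move=> z _ [y ->]; exists (z * y); rewrite mulrCA.
  - by move=> c; rewrite thC.
  - rewrite thX; case: eqP => [->|_]; first by exists 1; rewrite mulr1.
    by exists 0; rewrite subrr mulr0.
rewrite thE subr0 in Eq.
have [/(unit_meval_neq0 (fun=> 1))|/(unit_meval_neq0 (fun=> 0))] := E_irr _ _ Eq.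
  by rewrite mevalB mevalXU meval1 subrr eqxx.
have := homog_gt0_at0 (v := fun=> 0) hE d_gt0 (fun=> erefl).
rewrite Eq mevalM mevalB mevalXU meval1 sub0r mulN1r => /eqP.
by rewrite oppr_eq0 => ->.
Qed.

(** The part of degree d - k of E(v + Y) is the coefficient of s^k in
    E(Y + s v). *)
Lemma order_line d n (E : R3) : (0 < d)%N -> E \is d.-homog -> irreducible_elt E ->
  (size (line E) <= n.+1)%N -> (d - n <= order_at_origin (line E).[1])%N.
Proof.
move=> d_gt0 hE E_irr sE; have f_neq0 := line1_neq0 d_gt0 hE E_irr.
have low m : m \in msupp (line E).[1] -> (d - n <= mdeg m)%N.
  rewrite mcoeff_msupp horner_coef raddf_sum /= => fm.
  have [k km] : exists k : 'I_(size (line E)), ((line E)`_k)@_m != 0.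
    apply/existsP; apply: contraNT fm; rewrite negb_exists => /forallP c0.
    rewrite big1 // => k _; rewrite expr1n mulr1.
    by apply/eqP; have := c0 k; rewrite negbK.
  rewrite -mcoeff_msupp in km; rewrite (mdeg_homog (graded_line hE k).1 km).
  by apply: leq_sub2l; rewrite -ltnS; apply: leq_trans sE.
rewrite /order_at_origin big_seq; apply: (big_ind (fun k => d - n <= k)%N) => //.
  apply: leq_trans (low _ (mlead_supp f_neq0)) _; apply: ltnW.
  exact: msize_mdeg_lt (mlead_supp f_neq0).
by move=> a b ha hb; rewrite leq_min ha hb.
Qed.

End Direction.

Lemma mcoeff_toB_comb (K : fieldType) (x y z : {mpoly K[3]})
    a b a' b' a'' b'' m :
  (toB (x_poly x * tmon K a b + x_poly y * tmon K a' b'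
    + x_poly z * tmon K a'' b''))@_m
  = x * (bmon a b == m)%:R + y * (bmon a' b' == m)%:R + z * (bmon a'' b'' == m)%:R.
Proof.
have termE w c e : (toB (x_poly w * tmon K c e))@_m = w * (bmon c e == m)%:R.
  by rewrite toBM toB_tmon toB_x mcoeffCM mcoeffX.
by rewrite toBD mcoeffD toBD mcoeffD; congr (_ + _ + _); exact: termE.
Qed.

Section Independence.

Variable K : closedFieldType.
Local Notation A := {mpoly {mpoly K[2]}[3]}.
Variables (u : 'I_3 -> {mpoly K[2]}) (d : nat) (P Q : A) (E : {mpoly K[3]}).
Variable l : 'I_3 -> 'I_3 -> K.
Hypothesis d_ge5 : (5 <= d)%N.
Hypothesis u_homog : forall i, u i \is d.-homog.
Hypothesis E_curve : defines_image u d E.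
Hypothesis PQ_basis : mu_basis u d 2 P Q.
Hypothesis sing_double : singularities_are_double E.
Hypothesis P_eq : P = lin_form (l 0) * tmon K 2 0 + lin_form (l 1) * tmon K 1 1
  + lin_form (l 2) * tmon K 0 2.

Let lf (l' : 'I_3 -> K) : {mpoly K[3]} := \sum_j (l' j)%:MP * 'X_j.

Lemma lin_formE l' : lin_form l' = x_poly (lf l').
Proof.
rewrite (rmorph_sum (@x_poly K)); apply: eq_bigr => j _.
by rewrite (rmorphM (@x_poly K)) /= x_polyC x_polyX.
Qed.

Lemma local_equation_line (x : 'rV[K]_3) i :
  local_equation E x i = (line (fun j => x 0 j / x 0 i) i E).[1].
Proof.
pose v j := x 0 j / x 0 i.
pose lq := [tuple (v j)%:MP + (if j == i then 0 else 'X_j) | j < 3].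
apply: (rmorph_mpoly_ext (f := comp_mpoly lq) (g := horner_eval 1 \o line v i)).
  by move=> c; rewrite /= comp_mpolyC lineC /horner_eval hornerC.
move=> j; rewrite /= comp_mpolyXU lineX /horner_eval /line_var.
rewrite hornerD hornerC hornerZ hornerX mulr1 addrC -tnth_nth tnth_mktuple //.
Qed.

(** If the three coefficients of P vanish at a point v, the equation of C, which
    is the resultant of P and Q, has degree at most 2 in the direction of v,
    since
    only the two rows of Sylvester's matrix built from Q depend on it. So v is a
    point of multiplicity at least d - 2. *)
Lemma coefficients_independent : \det (\matrix_(i, j) l i j) != 0.
Proof.
apply/negP; rewrite -det_tr => /det0P [x x_neq0 xl].
have lx k : \sum_j l k j * x 0 j = 0.
  have := congr1 (fun N : 'rV_3 => N 0 k) xl; rewrite !mxE => {2}<-.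
  by apply: eq_bigr => j _; rewrite !mxE mulrC.
have [i xi] : exists i, x 0 i != 0.
  apply/existsP; apply: contraNT x_neq0; rewrite negb_exists => /forallP x0.
  by apply/eqP/rowP => j; rewrite mxE; apply/eqP; have := x0 j; rewrite negbK.
pose v j := x 0 j / x 0 i.
have lv k : \sum_j l k j * v j = 0.
  by under eq_bigr do rewrite mulrA; rewrite -mulr_suml lx mul0r.
have vi : v i = 1 by rewrite /v mulfV.
have [m d_eq] : exists m, d = (m.+1 + 2)%N by exists (d - 3)%N; lia.
have d_gt0 : (0 < d)%N by lia.
pose F := resultant_PQ m P Q.
have F_homog : F \is d.-homog := resultant_homog d_eq PQ_basis.
have F_curve := resultant_on_curve d_eq PQ_basis.
have F_neq0 := resultant_neq0 d_eq PQ_basis.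
have size_coefP mm : (size (line v i (toB P)@_mm) <= 1)%N.
  have -> : P = x_poly (lf (l 0)) * tmon K 2 0 + x_poly (lf (l 1)) * tmon K 1 1
      + x_poly (lf (l 2)) * tmon K 0 2 by rewrite -!lin_formE.
  rewrite mcoeff_toB_comb lineD lineD.
  have size_term k (b : bool) : (size (line v i (lf (l k) * b%:R)) <= 1)%N.
    case: b; rewrite ?mulr1 ?mulr0; first exact: size_line_linear0 (lv k).
    by rewrite (rmorph0 (line v i)) size_poly0.
  apply: leq_trans (size_polyD _ _) _; rewrite geq_max; apply/andP.
  split; last exact: size_term.
  apply: leq_trans (size_polyD _ _) _; rewrite geq_max; apply/andP.
  by split; exact: size_term.
have size_F : (size (line v i F) <= 3)%N.
  rewrite -det_map_mx /=.
  (* Along v the rows of Sylvester's matrix from P are constant and the two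
     from Q are linear. *)
  pose deg (r : 'I_(m.+1 + 2)) : nat := if split r is inl _ then 0 else 1.
  have deg_sum : (\sum_r deg r).+1 = 3%N.
    congr _.+1.
    rewrite big_split_ord /= [X in (X + _)%N]big1 => [|r _]; last first.
      by rewrite /deg (_ : split _ = inl r) //; apply: (unsplitK (inl r)).
    rewrite (eq_bigr (fun=> 1%N)) ?sum1_card ?card_ord // => s _.
    by rewrite /deg (_ : split _ = inr s) //; apply: (unsplitK (inr s)).
  suff : (size (\det (map_mx (line v i) (sylv m P Q))) <= (\sum_r deg r).+1)%N.
    by rewrite deg_sum.
  apply: size_det_le => r c; rewrite mxE [sylv _ _ _ r c]mxE.
  case: (split_ordP r) => [r' ->|s ->].
    rewrite /deg (_ : split _ = inl r'); last exact: (unsplitK (inl r')).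
    rewrite sylv_rowl toBM toB_tmon mcoeff_MX_bmon.
    case: ifP => _; first exact: size_coefP.
    by rewrite (rmorph0 (line v i)) size_poly0.
  rewrite /deg (_ : split _ = inr s); last exact: (unsplitK (inr s)).
  have [hr _] := bihomog_sylv_row d_eq PQ_basis (rshift m.+1 s).
  rewrite (linear_formE (mcoeff_toB_homog _ hr)); exact: size_line_linear.
have [q FE] := curve_ker_principal u_homog PQ_basis (erefl _) E_curve F_curve.
have [hE E_irr E_zero] := E_curve.
(* Both have degree d, so the cofactor is a constant. *)
have [c c_neq0 FcE] : exists2 c : K, c != 0 & F = c%:MP * E.
  exists (pihomog mdeg 0 q)@_0; last first.
    rewrite -(homog0_const (pihomogP mdeg 0 q)) -(pihomog_dE F_homog).
    by rewrite /F FE (pihomogMr _ _ hE) leqnn subnn.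
  apply: contraNneq F_neq0 => c0; rewrite -/F -(pihomog_dE F_homog).
  rewrite /F FE (pihomogMr _ _ hE) leqnn subnn (homog0_const (pihomogP mdeg 0 q)).
  by rewrite c0 mpolyC0 mul0r.
have size_E : (size (line v i E) <= 3)%N.
  have -> : E = c^-1%:MP * F by rewrite FcE mulrA -mpolyCM mulVf // mpolyC1 mul1r.
  rewrite lineM lineC mul_polyC; exact: leq_trans (size_scale_leq _ _) _.
(* The multiplicity is at least d - 2, which is at least 3. *)
have mult : (3 <= multiplicity E x i)%N.
  rewrite /multiplicity local_equation_line.
  apply: leq_trans (order_line vi d_gt0 hE E_irr size_E).
  by move: d_ge5; clear; lia.
by move: (mult); rewrite (sing_double xi (ltnW mult)).
Qed.

End Independence.

(** * Residues in T-degree i *)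

Lemma residue0_mem (A : comNzRingType) (P Q f g e : A) :
  mem2 f g e -> residue P Q f g 0 e.
Proof.
move=> [x [y ->]]; exists (y * Q), (- (y * P)), (- (x * Q)), (x * P).
by split; ring.
Qed.

Lemma residue_congr (A : comNzRingType) (P Q f g p e e' : A) :
  residue P Q f g p e -> mem2 f g (e - e') -> residue P Q f g p e'.
Proof.
move=> res /(residue0_mem P Q) res0.
by have := residueB res res0; rewrite subr0 subKr.
Qed.

Section TResidue.

Variable K : closedFieldType.
Local Notation A := {mpoly {mpoly K[2]}[3]}.
Local Notation t k := (tvar K k).
Implicit Types (x p e : A).

Lemma cf_term y a b a' b' : thomog 0 y ->
  cf a b (y * tmon K a' b') = if (a == a') && (b == b') then y else 0.
Proof.
move=> /tconstP [z ->]; rewrite cf_Mtmon.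
have [/andP[/eqP<- /eqP<-]|ne] := boolP ((a == a') && (b == b')).
  rewrite !leqnn !subnn cf_x; reflexivity.
case: ifP => [/andP[ha hb]|_]; last reflexivity.
rewrite cf_x; case: ifP => [/andP[ha' hb']|_]; last reflexivity.
by exfalso; move: ne ha hb ha' hb'; clear; lia.
Qed.

Lemma tvar0_tmon N : t 0 ^+ N = tmon K N 0.
Proof. by rewrite /tmon expr0 mulr1. Qed.

Lemma tvar1_tmon N : t 1 ^+ N = tmon K 0 N.
Proof. by rewrite /tmon expr0 mul1r. Qed.

Lemma cf_mem2 a b N x : (a < N)%N -> (b < N)%N ->
  mem2 (t 0 ^+ N) (t 1 ^+ N) x -> cf a b x = 0.
Proof.
move=> aN bN [y [z ->]]; rewrite raddfD /= tvar0_tmon tvar1_tmon.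
rewrite (cf_Mtmon a b N 0 y) (cf_Mtmon a b 0 N z) leqNgt aN.
by rewrite [(N <= b)%N]leqNgt bN /= addr0.
Qed.

Lemma mem2_tmon N y a b : (N <= a)%N || (N <= b)%N ->
  mem2 (t 0 ^+ N) (t 1 ^+ N) (y * tmon K a b).
Proof.
rewrite tvar0_tmon tvar1_tmon => /orP[Na|Nb].
  have -> : tmon K a b = tmon K (a - N) b * tmon K N 0.
    by rewrite tmonM subnK ?addn0.
  by rewrite mulrA; apply: mem2l.
have -> : tmon K a b = tmon K a (b - N) * tmon K 0 N.
  by rewrite tmonM subnK ?addn0.
by rewrite mulrA; apply: mem2r.
Qed.

(** With N = n + r + 1, these are the elements of degree n + 2r in T modulo
    (T_0^N, T_1^N): lam k is the coefficient of the monomial whose exponents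
    are N - 1 - v_0 and N - 1 - v_1 for v = (n - k, k). *)
Definition tres n r (lam : nat -> A) : A :=
  \sum_(k < n.+1) lam k * tmon K (r + k) (r + (n - k)).

(** The other monomials of this degree lie in (T_0^N, T_1^N). *)
Lemma tres_homog_mod n r e : thomog (n + r + r) e ->
  mem2 (t 0 ^+ (n + r).+1) (t 1 ^+ (n + r).+1)
    (e - tres n r (fun k => cf (r + k) (r + (n - k)) e)).
Proof.
move=> he; rewrite {1}(cf_sum he).
pose F b := cf (n + r + r - b) b e * tmon K (n + r + r - b) b.
have -> : \sum_(b < (n + r + r).+1) cf (n + r + r - b) b e * tmon K (n + r + r - b) b
    = \sum_(0 <= b < (n + r + r).+1) F b by rewrite big_mkord.
have mid : \sum_(r <= b < (n + r).+1) F b = tres n r (fun k => cf (r + k) (r + (n - k)) e).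
  rewrite -{1}[r]add0n -addSn big_addn addnK big_mkord /tres (reindex_inj rev_ord_inj).
  apply: eq_bigr => k _ /=; rewrite /F.
  have kn : (k <= n)%N by rewrite -ltnS.
  have e1 : (n + r + r - (n.+1 - k.+1 + r) = r + k)%N by move: kn; clear; lia.
  have e2 : (n.+1 - k.+1 + r = r + (n - k))%N by move: kn; clear; lia.
  by rewrite e1 e2.
set M := tres _ _ _ in mid *.
pose S1 := \sum_(0 <= b < r) F b.
pose S3 := \sum_((n + r).+1 <= b < (n + r + r).+1) F b.
have -> : \sum_(0 <= b < (n + r + r).+1) F b = S1 + (M + S3).
  rewrite (big_cat_nat (n := r)) /=; [|by []|by clear; lia].
  congr (_ + _); rewrite (big_cat_nat (n := (n + r).+1)) /=; first by rewrite mid.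
    by clear; lia.
  by clear; lia.
have -> : S1 + (M + S3) - M = S1 + S3 by ring.
apply: mem2D; rewrite /S1 /S3 big_nat_cond.
  apply: (big_ind (mem2 (t 0 ^+ (n + r).+1) (t 1 ^+ (n + r).+1))).
  - exact: mem2_0.
  - by move=> x y; apply: mem2D.
  - move=> b /andP[/andP[_ br] _]; apply: mem2_tmon.
    by apply/orP; left; move: br; clear; lia.
apply: (big_ind (mem2 (t 0 ^+ (n + r).+1) (t 1 ^+ (n + r).+1))).
- exact: mem2_0.
- by move=> x y; apply: mem2D.
- by move=> b /andP[/andP[br _] _]; apply: mem2_tmon; rewrite br orbT.
Qed.

Lemma mem2_thomog_ge N D e : (2 * N <= D.+1)%N -> thomog D e ->
  mem2 (t 0 ^+ N) (t 1 ^+ N) e.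
Proof.
move=> ND he; rewrite (cf_sum he); apply: mem2_sum => b; apply: mem2_tmon.
by have := ltn_ord b; move: ND; clear; case: leqP => //=; lia.
Qed.

Lemma tres_mem2_eq0 n r lam : (forall k, thomog 0 (lam k)) ->
  mem2 (t 0 ^+ (n + r).+1) (t 1 ^+ (n + r).+1) (tres n r lam) ->
  forall k, (k <= n)%N -> lam k = 0.
Proof.
move=> hlam mem k kn.
have [lt1 lt2] : (r + k < (n + r).+1)%N /\ (r + (n - k) < (n + r).+1)%N.
  by move: kn; clear; lia.
have := cf_mem2 lt1 lt2 mem; rewrite raddf_sum.
have kn1 : (k < n.+1)%N by [].
rewrite (bigD1 (Ordinal kn1)) //= [X in _ + X]big1 ?addr0 => [|i neq].
  by rewrite (cf_term _ _ _ _ (hlam k)) !eqxx.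
rewrite (cf_term _ _ _ _ (hlam i)) ifF // eqn_add2l.
by apply/negbTE/negP => /andP[/eqP ki _]; case/eqP: neq; apply/val_inj.
Qed.

Variables (u : 'I_3 -> {mpoly K[2]}) (d : nat) (P Q : A).
Hypothesis u_homog : forall i, u i \is d.-homog.
Hypothesis u_coprime : no_common_factor u.
Hypothesis PQ_basis : mu_basis u d 2 P Q.

Local Notation res N := (residue P Q (t 0 ^+ N) (t 1 ^+ N)).

Let d_ge4 : (4 <= d)%N.
Proof. by case: PQ_basis => + _ _ _; rewrite -addnn. Qed.

(** The identities that define a residue can be replaced by their homogeneous
    parts in T. *)
Lemma residue_tcomp N i p e : (d <= N)%N -> thomog i p -> res N p e ->
  res N p (tcomp (2 * N + i - d) e).
Proof.
move=> dN hp [al [be [ga [de [h1 h2 h3 h4]]]]].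
have hP : thomog 2 P := (P_bihomog PQ_basis).2.
have hQ : thomog (d - 2) Q := (Q_bihomog PQ_basis).2.
have hf : thomog N (t 0 ^+ N) by rewrite tvar0_tmon -[N in thomog N]addn0; apply: (bihomog_tmon K N 0).2.
have hg : thomog N (t 1 ^+ N) by rewrite tvar1_tmon; apply: (bihomog_tmon K 0 N).2.
have step k l x h : thomog l h -> (l <= k)%N -> tcomp k (x * h) = tcomp (k - l) x * h.
  by move=> hh lk; rewrite (tcomp_Mr _ _ hh) lk.
have stepl k l x h : thomog l h -> (l <= k)%N -> tcomp k (h * x) = h * tcomp (k - l) x.
  by move=> hh lk; rewrite mulrC (step _ _ _ _ hh lk) mulrC.
have h2N : (2 <= N + i)%N by move: dN d_ge4; clear; lia.
have hdN : (d - 2 <= N + i)%N by move: dN d_ge4; clear; lia.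
have degrees (f a b : A) : thomog N f -> f * p = a * P + b * Q ->
    f * p = tcomp (N + i - 2) a * P + tcomp (N + i - (d - 2)) b * Q.
  move=> hf' fp; transitivity (tcomp (N + i) (a * P + b * Q)).
    by rewrite -fp; apply/esym/tcomp_id; apply: thomogM hf' hp.
  rewrite raddfD; congr (_ + _); [exact: step hP h2N|exact: step hQ hdN].
have NNi : (N <= N + (N + i - 2))%N by rewrite leq_addr.
have NNi' : (N <= N + (N + i - (d - 2)))%N by rewrite leq_addr.
exists (tcomp (N + i - 2) al), (tcomp (N + i - (d - 2)) be),
  (tcomp (N + i - 2) ga), (tcomp (N + i - (d - 2)) de); split.
- exact: degrees hf h1.
- exact: degrees hg h2.
- transitivity (tcomp (N + (N + i - 2)) (t 1 ^+ N * al - t 0 ^+ N * ga)).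
    rewrite raddfB /=; congr (_ - _); apply/esym.
      by rewrite (stepl _ _ _ _ hg NNi) addKn.
    by rewrite (stepl _ _ _ _ hf NNi) addKn.
  rewrite h3 (step _ _ _ _ hQ); last by move: dN d_ge4; clear; lia.
  have -> : (N + (N + i - 2) - (d - 2) = 2 * N + i - d)%N.
    by move: dN d_ge4; clear; lia.
  reflexivity.
- transitivity (tcomp (N + (N + i - (d - 2))) (t 1 ^+ N * be - t 0 ^+ N * de)).
    rewrite raddfB /=; congr (_ - _); apply/esym.
      by rewrite (stepl _ _ _ _ hg NNi') addKn.
    by rewrite (stepl _ _ _ _ hf NNi') addKn.
  rewrite h4 (step _ _ _ _ hP); last by move: dN d_ge4; clear; lia.
  rewrite raddfN /=.
  have -> : (N + (N + i - (d - 2)) - 2 = 2 * N + i - d)%N.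
    by move: dN d_ge4; clear; lia.
  reflexivity.
Qed.

(** The residue exists by the elimination of the u_i, which puts T_0^N p and
    T_1^N p into (P, Q). *)
Lemma ker_residue i j p : bihomog i j p -> rees_ker u p ->
  exists N0, forall N, (N0 <= N)%N -> exists e,
    thomog (2 * N + i - d) e /\ res N p e.
Proof.
move=> [hp hp'] /(rees_ker_homog u hp) ep.
have [N0 mem] := power_mem2_both u_homog PQ_basis u_coprime hp ep.
exists (N0 + d)%N => N leN; have [|m0 m1] := mem N; first by move: leN; clear; lia.
have [e res_e] := residue_exists (coprime2_PQ PQ_basis) m0 m1.
exists (tcomp (2 * N + i - d) e); split; first exact: thomog_tcomp.
by apply: residue_tcomp hp' res_e; move: leN; clear; lia.
Qed.

Lemma mem2_of_residue N p e : res N p e -> mem2 (t 0 ^+ N) (t 1 ^+ N) e ->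
  mem2 P Q p.
Proof. exact: mem2_residue (@tvarX_reg K 0 N) (@coprime2_tvar K N). Qed.

(** In T-degree at least d - 1 the residue vanishes for degree reasons. *)
Lemma ker_high_degree i j p : bihomog i j p -> rees_ker u p ->
  (d - 1 <= i)%N -> mem2 P Q p.
Proof.
move=> hp kp di; have [N0 resN] := ker_residue hp kp.
have [e [he res_e]] := resN (N0 + d)%N (leq_addr _ _).
apply: mem2_of_residue res_e (mem2_thomog_ge _ he).
by move: di d_ge4; clear; lia.
Qed.

(** In T-degree d - 2 - n the residue has degree n + 2 r for N = n + r + 1. *)
Lemma ker_tres i j n p : bihomog i j p -> rees_ker u p -> (i + n = d - 2)%N ->
  exists r0, forall r, (r0 <= r)%N -> exists lam,
    (forall k, thomog 0 (lam k)) /\ res (n + r).+1 p (tres n r lam).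
Proof.
move=> hp kp in_d; have [N0 resN] := ker_residue hp kp.
exists N0 => r leN; have [|e [he res_e]] := resN (n + r).+1.
  by move: leN; clear; lia.
exists (fun k => cf (r + k) (r + (n - k)) e); split=> [k|]; first exact: thomog_cf.
apply: residue_congr res_e _; apply: tres_homog_mod.
have <- : (2 * (n + r).+1 + i - d = n + r + r)%N by move: in_d d_ge4; clear; lia.
exact: he.
Qed.

(** An element is determined by its residue modulo (P, Q). *)
Lemma same_tres n r p p' lam : res (n + r).+1 p (tres n r lam) ->
  res (n + r).+1 p' (tres n r lam) -> mem2 P Q (p - p').
Proof.
move=> h h'; apply: mem2_of_residue (residueB h h') _.
by rewrite subrr; apply: mem2_0.
Qed.

Lemma tres_eq0 n r p lam : (forall k, thomog 0 (lam k)) ->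
  res (n + r).+1 p (tres n r lam) -> mem2 P Q p ->
  forall k, (k <= n)%N -> lam k = 0.
Proof.
move=> hlam h mem; apply: (tres_mem2_eq0 (r := r) hlam).
exact: residue_mem2 (coprime2_PQ PQ_basis) (Q_reg PQ_basis) h mem.
Qed.

End TResidue.

(** * Morley forms *)

Lemma mcoeff_low (R : nzRingType) (n e : nat) (s h : {mpoly R[n]}) m :
  h \is e.-homog -> (mdeg m < e)%N -> (s * h)@_m = 0.
Proof.
move=> hh lt; have := mcoeff_pihomog (mdeg m) (s * h) m.
by rewrite eqxx (pihomogMr _ _ hh) leqNgt lt mcoeff0.
Qed.

Lemma geom_sum (R : comNzRingType) (x y : R) N :
  x ^+ N - y ^+ N = (\sum_(i < N) x ^+ (N.-1 - i) * y ^+ i) * (x - y).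
Proof.
by rewrite subrXX mulrC.
Qed.

Section Functional.

Variables (A : comNzRingType) (n : nat) (lam : nat -> A).

(** The A-linear functional on A[S_0, S_1] with value lam k at S_0^(n - k)
    S_1^k and 0 at the monomials of degree other than n. *)
Definition functional (M : {mpoly A[2]}) : A :=
  \sum_(k < n.+1) lam k * M@_(bmon (n - k) k).

Lemma functional_is_additive : additive functional.
Proof.
move=> M M'; rewrite /functional -sumrB; apply: eq_bigr => k _.
by rewrite mcoeffB mulrBr.
Qed.

HB.instance Definition _ :=
  GRing.isAdditive.Build {mpoly A[2]} A functional functional_is_additive.

Lemma functional_linear a M : functional (a%:MP * M) = a * functional M.
Proof.
rewrite /functional mulr_sumr; apply: eq_bigr => k _.
by rewrite mcoeffCM mulrCA.
Qed.

Lemma functional_high e s h : h \is e.-homog -> (n < e)%N ->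
  functional (s * h) = 0.
Proof.
move=> hh ne; apply: big1 => k _; rewrite (mcoeff_low _ hh) ?mulr0 //.
by rewrite mdeg_bmon subnK // -ltnS.
Qed.

Lemma functional_geom N (x y : A) : (n < N)%N ->
  functional ((\sum_(i < N) x%:MP ^+ (N.-1 - i) * 'X_0 ^+ i) *
              (\sum_(i < N) y%:MP ^+ (N.-1 - i) * 'X_1 ^+ i))
  = \sum_(k < n.+1) lam k * (x ^+ (N.-1 - (n - k)) * y ^+ (N.-1 - k)).
Proof.
move=> nN; apply: eq_bigr => k _; congr (_ * _).
have kn : (k <= n)%N by rewrite -ltnS.
have lt1 : (n - k < N)%N by lia.
have lt2 : (k < N)%N by lia.
rewrite big_distrlr /= raddf_sum /= (bigD1 (Ordinal lt1)) //=.
have termE i j : (x%:MP ^+ (N.-1 - i) * 'X_0 ^+ i * (y%:MP ^+ (N.-1 - j) * 'X_1 ^+ j))@_(bmon (n - k) k)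
    = if (i == n - k)%N && (j == k) then x ^+ (N.-1 - i) * y ^+ (N.-1 - j) else 0.
  have -> : x%:MP ^+ (N.-1 - i) * 'X_0 ^+ i * (y%:MP ^+ (N.-1 - j) * 'X_1 ^+ j)
      = (x ^+ (N.-1 - i) * y ^+ (N.-1 - j))%:MP * 'X_[bmon i j] :> {mpoly A[2]}.
    by rewrite mpolyX_bmon mpolyCM !rmorphXn /=; ring.
  by rewrite mcoeffCM mcoeffX bmon_eq; case: ifP => _; rewrite ?mulr1 ?mulr0.
rewrite [X in _ + X]big1 => [|i neq]; last first.
  rewrite raddf_sum big1 // => j _; rewrite /= termE ifF //.
  by apply/negbTE/negP => /andP[/eqP e _]; case/eqP: neq; apply/val_inj.
rewrite addr0 raddf_sum (bigD1 (Ordinal lt2)) //= termE !eqxx.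
rewrite big1 ?addr0 // => j neq; rewrite /= termE eqxx ifF //.
by apply/negbTE; apply: contra neq => /eqP e; apply/eqP/val_inj.
Qed.

End Functional.

(** The functional with values satisfying the recurrence kills the multiples of
    the quadratic form a S_0^2 + b S_0 S_1 + c S_1^2. *)
Lemma functional_quadratic (A : comNzRingType) (a b c : A) n lam s :
  band_rec a b c n.+2 lam ->
  functional n.+2 lam (s * (a%:MP * 'X_[bmon 2 0] + b%:MP * 'X_[bmon 1 1]
    + c%:MP * 'X_[bmon 0 2])) = 0.
Proof.
move=> lam_rec; rewrite !mulrDr !raddfD /= !(mulrCA s) !functional_linear.
have e0 : functional n.+2 lam (s * 'X_[bmon 2 0])
    = \sum_(m < n.+1) lam m * s@_(bmon (n - m) m).
  rewrite /functional [LHS]big_ord_recr /= [X in X + _]big_ord_recr /=.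
  rewrite !mcoeff_MX_bmon subnn subSnn /= !mulr0 !addr0.
  apply: eq_bigr => m _; rewrite mcoeff_MX_bmon subn0.
  have mn : (m <= n)%N by rewrite -ltnS.
  have -> : (n.+2 - m = (n - m).+2)%N by lia.
  by rewrite /= !subSS subn0.
have e1 : functional n.+2 lam (s * 'X_[bmon 1 1])
    = \sum_(m < n.+1) lam m.+1 * s@_(bmon (n - m) m).
  rewrite /functional [LHS]big_ord_recl /= [X in _ + X]big_ord_recr /=.
  rewrite !mcoeff_MX_bmon !subnn !andbF /=.
  rewrite mulr0 add0r mulr0 addr0; apply: eq_bigr => m _; rewrite mcoeff_MX_bmon.
  rewrite /bump /= add1n; have mn : (m <= n)%N by rewrite -ltnS.
  have -> : (n.+2 - m.+1 = (n - m).+1)%N by lia.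
  by rewrite /= !subSS !subn0.
have e2 : functional n.+2 lam (s * 'X_[bmon 0 2])
    = \sum_(m < n.+1) lam m.+2 * s@_(bmon (n - m) m).
  rewrite /functional [LHS]big_ord_recl /= [X in _ + X]big_ord_recl /=.
  rewrite !mcoeff_MX_bmon /= !mulr0 !add0r.
  apply: eq_bigr => m _; rewrite mcoeff_MX_bmon /bump /= !add1n.
  by rewrite !subSS !subn0.
rewrite e0 e1 e2 !mulr_sumr -!big_split big1 //= => m _.
rewrite !mulrA -!mulrDl lam_rec ?mul0r //.
by have := ltn_ord m; lia.
Qed.

Lemma distribute3 (A : comNzRingType) (l s x y z a b c : A) :
  l * s * (x * a + y * b + z * c)
    = l * x * (s * a) + l * y * (s * b) + l * z * (s * c).
Proof. by ring. Qed.

Section MorleyForms.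

Variable K : closedFieldType.
Local Notation A := {mpoly {mpoly K[2]}[3]}.
Local Notation S := {mpoly A[2]}.
Local Notation t k := (tvar K k).

Lemma to_SE (x : A) : to_S x = map_mpoly (@x_poly K) (toB x).
Proof.
pose F : {rmorphism A -> S} := mmap (mmap
  ((@mpolyC 2 A \o @mpolyC 3 {mpoly K[2]}) \o @mpolyC 2 K) (fun i : 'I_2 => 'X_i : S))
  (fun j : 'I_3 => ('X_j)%:MP : S).
have FX j : F 'X_j = ('X_j)%:MP by rewrite /F /= mmapX mmap1U.
have FC c : F c%:MP = mmap ((@mpolyC 2 A \o @mpolyC 3 {mpoly K[2]}) \o @mpolyC 2 K)
  (fun i : 'I_2 => 'X_i : S) c by exact: mmapC.
apply: (rmorph_mpoly_ext (f := F) (g := map_mpoly (@x_poly K) \o @toB K)) => [c|j].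
  rewrite FC /= toB_C.
  apply: (rmorph_mpoly_ext
    (f := mmap ((@mpolyC 2 A \o @mpolyC 3 {mpoly K[2]}) \o @mpolyC 2 K)
       (fun i : 'I_2 => 'X_i : S))
    (g := map_mpoly (@x_poly K) \o map_mpoly (@mpolyC 3 K)) _ _ c) => [k|i] /=.
    by rewrite mmapC /= !map_mpolyC /= x_polyC.
  by rewrite mmapX mmap1U !map_mpolyX.
by rewrite FX /= toB_X map_mpolyC /= x_polyX.
Qed.

Lemma to_S_homog e (x : A) : thomog e x -> to_S x \is e.-homog.
Proof.
move=> /toB_homog hx; rewrite to_SE; apply/dhomogP => m.
rewrite mcoeff_msupp mcoeff_map_mpoly => xm; apply: (mdeg_homog hx).
rewrite mcoeff_msupp; apply: contraNneq xm => ->.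
by apply/eqP; apply: (rmorph0 (@x_poly K)).
Qed.

Lemma to_S_comb (x y z : {mpoly K[3]}) :
  to_S (x_poly x * tmon K 2 0 + x_poly y * tmon K 1 1 + x_poly z * tmon K 0 2)
  = (x_poly x)%:MP * 'X_[bmon 2 0] + (x_poly y)%:MP * 'X_[bmon 1 1]
    + (x_poly z)%:MP * 'X_[bmon 0 2].
Proof.
rewrite to_SE; have termE (w : {mpoly K[3]}) a b :
    map_mpoly (@x_poly K) (toB (x_poly w * tmon K a b)) = (x_poly w)%:MP * 'X_[bmon a b].
  rewrite toBM toB_tmon toB_x rmorphM /= map_mpolyC map_mpolyX //.
rewrite toBD (rmorphD (map_mpoly (@x_poly K))) toBD (rmorphD (map_mpoly (@x_poly K))).
by congr (_ + _ + _); exact: termE.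
Qed.

Variables (u : 'I_3 -> {mpoly K[2]}) (d : nat) (P Q : A) (y0 y1 y2 : {mpoly K[3]}).
Hypothesis PQ_basis : mu_basis u d 2 P Q.
Hypothesis P_eq : P = x_poly y0 * tmon K 2 0 + x_poly y1 * tmon K 1 1
  + x_poly y2 * tmon K 0 2.

Local Notation res N := (residue P Q (t 0 ^+ N) (t 1 ^+ N)).

(** The functional kills P(S) by the recurrence and Q(S) because its degree d -
    2 exceeds n, so the general computation applies; the kernel given by the
    geometric sums dual to T_0^N and T_1^N turns the values lam into the
    coefficients of the residue. *)
Lemma residue_morley_form n r lam (Mor : S) : (n.+2 < d - 2)%N ->
  band_rec (x_poly y0) (x_poly y1) (x_poly y2) n.+2 lam ->
  morley_form d P Q Mor ->
  res (n.+2 + r).+1 (functional n.+2 lam Mor) (tres n.+2 r lam).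
Proof.
move=> nd lam_rec [P0 [P1 [Q0 [Q1 [_ PE QE ->]]]]]; set N := (n.+2 + r).+1.
have nN : (n.+2 < N)%N by rewrite /N; lia.
have -> : tres n.+2 r lam = functional n.+2 lam
    ((\sum_(i < N) (t 0)%:MP ^+ (N.-1 - i) * 'X_0 ^+ i) *
     (\sum_(i < N) (t 1)%:MP ^+ (N.-1 - i) * 'X_1 ^+ i)).
  rewrite functional_geom //; apply: eq_bigr => k _; congr (_ * _).
  have kn : (k <= n.+2)%N by rewrite -ltnS.
  by rewrite /tmon; congr (_ ^+ _ * _ ^+ _); rewrite /N /=; move: kn; clear; lia.
apply: (@residue_morley A S (@mpolyC 2 A) (functional n.+2 lam)
  (@functional_linear A n.+2 lam) (t 0) (t 1) _ _ P Q 'X_0 'X_1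
  ('X_0 ^+ N) ('X_1 ^+ N) (to_S P) (to_S Q)).
- by rewrite (rmorphXn (@mpolyC 2 A)); apply: geom_sum.
- by rewrite (rmorphXn (@mpolyC 2 A)); apply: geom_sum.
- exact: PE.
- exact: QE.
- by move=> s; rewrite P_eq to_S_comb; apply: functional_quadratic.
- move=> s; exact: functional_high (to_S_homog (Q_bihomog PQ_basis).2) nd.
- move=> s; exact: functional_high (homog_varX _ _ _) nN.
- move=> s; exact: functional_high (homog_varX _ _ _) nN.
Qed.

(** A residue e satisfies e P = 0 modulo (T_0^N, T_1^N), and the three-term
    recurrence is the vanishing of the coefficients of the monomials outside
    this ideal. *)
Lemma residue_band_rec n r p lam : (forall k, thomog 0 (lam k)) ->
  res (n.+2 + r).+1 p (tres n.+2 r lam) ->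
  band_rec (x_poly y0) (x_poly y1) (x_poly y2) n.+2 lam.
Proof.
move=> hlam /residue_memP mem m mn.
have [lt1 lt2] : (r + m.+2 < (n.+2 + r).+1)%N /\ (r + (n.+2 - m) < (n.+2 + r).+1)%N.
  by move: mn; clear; lia.
have cf0 := cf_mem2 lt1 lt2 mem.
pose F k a b (y : {mpoly K[3]}) : A := (lam k * x_poly y) * tmon K (r + k + a) (r + (n.+2 - k) + b).
have hy k y : thomog 0 (lam k * x_poly y).
  exact: thomogM (hlam k) (thomog_x y).
have pick a b y m' : (m' <= n.+2)%N -> (m' + a = m.+2)%N -> (n.+2 - m' + b = n.+2 - m)%N ->
    cf (r + m.+2) (r + (n.+2 - m)) (\sum_(k < n.+3) F k a b y) = lam m' * x_poly y.
  move=> m'n e1 e2; have lt : (m' < n.+3)%N by [].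
  rewrite raddf_sum (bigD1 (Ordinal lt)) //= [X in _ + X]big1 ?addr0 => [|k neq].
    by rewrite (cf_term _ _ _ _ (hy m' y)) -!addnA e1 e2 !eqxx.
  rewrite (cf_term _ _ _ _ (hy k y)) ifF // -!addnA !eqn_add2l -e1 eqn_add2r.
  by apply/negbTE/negP => /andP[/eqP e _]; case/eqP: neq; apply/val_inj.
have tresP : tres n.+2 r lam * P = \sum_(k < n.+3) F k 2 0 y0
    + \sum_(k < n.+3) F k 1 1 y1 + \sum_(k < n.+3) F k 0 2 y2.
  rewrite -!big_split /tres mulr_suml; apply: eq_bigr => k _.
  have e a b : tmon K (r + k + a) (r + (n.+2 - k) + b)
      = tmon K (r + k) (r + (n.+2 - k)) * tmon K a b by rewrite tmonM.
  rewrite P_eq /F (e 2 0)%N (e 1 1)%N (e 0 2)%N; exact: distribute3.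
have m1 : (m.+1 <= n.+2)%N by apply: ltnW.
transitivity (cf (r + m.+2) (r + (n.+2 - m)) (tres n.+2 r lam * P)); last exact: cf0.
rewrite tresP raddfD raddfD; congr (_ + _ + _); apply/esym; rewrite mulrC; apply: pick.
- exact: ltnW.
- by rewrite addn2.
- by rewrite addn0.
- exact: m1.
- by rewrite addn1.
- by move: mn; clear; lia.
- exact: mn.
- by rewrite addn0.
- by move: mn; clear; lia.
Qed.

Lemma residue_sylv10 r D : sylvester_form d P Q 1 0 D ->
  res r.+2 D (tmon K r r.+1).
Proof.
move=> [P0 [P1 [Q0 [Q1 [_ PE QE ->]]]]].
have -> : t 0 ^+ r.+2 = t 0 ^+ r * t 0 ^+ 2 by rewrite -exprD addn2.
have -> : t 1 ^+ r.+2 = t 1 ^+ r.+1 * t 1 ^+ 1 by rewrite -exprD addn1.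
rewrite PE QE; exact: residue_sylvester.
Qed.

Lemma residue_sylv01 r D : sylvester_form d P Q 0 1 D ->
  res r.+2 D (tmon K r.+1 r).
Proof.
move=> [P0 [P1 [Q0 [Q1 [_ PE QE ->]]]]].
have -> : t 1 ^+ r.+2 = t 1 ^+ r * t 1 ^+ 2 by rewrite -exprD addn2.
have -> : t 0 ^+ r.+2 = t 0 ^+ r.+1 * t 0 ^+ 1 by rewrite -exprD addn1.
rewrite PE QE; exact: residue_sylvester.
Qed.

End MorleyForms.

(** * Generation of the Rees kernel *)

Section MorleyMinors.

Variables (K : closedFieldType) (n : nat).
Local Notation A := {mpoly {mpoly K[2]}[3]}.
Variables (L0 Ls L1 : A) (M : {mpoly A[2]}).

Lemma band_mx_last_col (F : 'I_n.+1 -> A) (k i : 'I_n.+1) :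
  band_mx L0 Ls L1 F (delta A k) i ord_max = (i == k)%:R.
Proof. by rewrite mxE /= gtn_eqF ?eqxx. Qed.

Lemma det_band_mx_delta (F : 'I_n.+1 -> A) (k : 'I_n.+1) :
  \det (band_mx L0 Ls L1 F (delta A k))
  = (-1) ^+ (k + n) * \det (row' k (col' ord_max (band_mx L0 Ls L1 F (delta A k)))).
Proof.
rewrite (expand_det_col _ ord_max) (bigD1 k isT) /= [X in _ + X]big1; last first.
  move=> i ik; rewrite band_mx_last_col (negbTE ik); exact: mul0r.
rewrite band_mx_last_col eqxx addr0 mul1r; reflexivity.
Qed.

Lemma morley_matrix_band (k : 'I_n.+1) :
  row' k (morley_matrix n L0 Ls L1 M) = row' k (col' ord_max
    (band_mx L0 Ls L1 (fun i => morley_coef M (n - i) i) (delta A k))).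
Proof.
apply/matrixP => i j; rewrite !mxE lift_max.
by rewrite [j == n :> nat]ltn_eqF.
Qed.

Lemma morley_minor_det (k : 'I_n.+1) : morley_minor L0 Ls L1 M k
  = (-1) ^+ n * \det (band_mx L0 Ls L1 (n := n) (fun i => morley_coef M (n - i) i) (delta A k)).
Proof.
rewrite det_band_mx_delta /morley_minor morley_matrix_band mulrA -exprD.
have -> : (-1) ^+ (n + (k + n)) = (-1) ^+ k :> A.
  by rewrite -[LHS]signr_odd -[RHS]signr_odd !oddD addbA addbAC addbb.
reflexivity.
Qed.

(** Laplace expansion along the Morley column: the minor is the value at the
    Morley form of the functional whose values are a row of band minors. *)
Lemma morley_minor_functional (k : 'I_n.+1) : (0 < n)%N -> GRing.lreg L0 ->
  morley_minor L0 Ls L1 M k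
  = (-1) ^+ n * functional n (fun l => band_minor L0 Ls L1 n l k) M.
Proof.
move=> n_gt0 regL; rewrite morley_minor_det (band_mx_suml _ _ _ n_gt0); congr (_ * _).
apply: eq_bigr => l _; rewrite (band_mx_minor _ _ regL n_gt0) mulrC; reflexivity.
Qed.

End MorleyMinors.

Lemma sum_ord2 (V : nmodType) (F : nat -> V) : \sum_(k < 2) F k = F 0%N + F 1%N.
Proof. by rewrite big_ord_recr big_ord1. Qed.

Lemma exchange_weights (A : comNzRingType) (n m : nat) (s : A) (c : 'I_n -> A)
    (w : 'I_m -> 'I_n -> A) (z : 'I_m -> A) :
  \sum_k c k * (s * \sum_l w l k * z l) = \sum_l (\sum_k c k * s * w l k) * z l.
Proof.
transitivity (\sum_k \sum_l c k * s * w l k * z l).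
  by apply: eq_bigr => k _; rewrite !mulr_sumr; apply: eq_bigr => l _; rewrite !mulrA.
by rewrite exchange_big; apply: eq_bigr => l _; rewrite mulr_suml.
Qed.

Section Generation.

Variable K : closedFieldType.
Local Notation A := {mpoly {mpoly K[2]}[3]}.
Local Notation t k := (tvar K k).
Variables (u : 'I_3 -> {mpoly K[2]}) (d : nat) (P Q : A).
Hypothesis u_homog : forall i, u i \is d.-homog.
Hypothesis u_coprime : no_common_factor u.
Hypothesis PQ_basis : mu_basis u d 2 P Q.
Variable l : 'I_3 -> 'I_3 -> K.
Local Notation L i := (lin_form (l i)).
Hypothesis P_eq : P = L 0 * tmon K 2 0 + L 1 * tmon K 1 1 + L 2 * tmon K 0 2.

Local Notation res N := (residue P Q (t 0 ^+ N) (t 1 ^+ N)).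

Let y i : {mpoly K[3]} := \sum_j (l i j)%:MP * 'X_j.

Let LE i : L i = x_poly (y i).
Proof. exact: lin_formE. Qed.

Let P_eq' : P = x_poly (y 0) * tmon K 2 0 + x_poly (y 1) * tmon K 1 1
  + x_poly (y 2) * tmon K 0 2.
Proof. rewrite -!LE; exact: P_eq. Qed.

Lemma ker_of_residue N p e : res N p e -> rees_ker u p.
Proof.
move=> [a [b [_ [_ [pE _ _ _]]]]].
have Tp : rees_ker u (t 0 ^+ N * p).
  by rewrite pE; apply: rees_kerD; apply: rees_kerM;
    [exact: P_ker PQ_basis|exact: Q_ker PQ_basis].
apply: (rees_ker_cancel (c := 'X_0 ^+ N)); last by rewrite -tvarE.
have := tvarX_neq0 K 0 N; rewrite tvarE; apply: contraNneq => ->; apply/eqP; exact: mpolyC0.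
Qed.

Lemma ker_sylv10 D : sylvester_form d P Q 1 0 D -> rees_ker u D.
Proof. move=> D_syl; exact: (ker_of_residue (residue_sylv10 0 D_syl)). Qed.

Lemma ker_sylv01 D : sylvester_form d P Q 0 1 D -> rees_ker u D.
Proof. move=> D_syl; exact: (ker_of_residue (residue_sylv01 0 D_syl)). Qed.

(** The residue lam 0 (T_0 T_1)^(r + 1) is lam 0 T_0 times that of the Sylvester
    form. *)
Lemma ker_tdeg0 j p D : sylvester_form d P Q 1 0 D -> (2 <= d)%N ->
  bihomog (d - 2) j p -> rees_ker u p -> exists c, mem2 P Q (p - c * D).
Proof.
move=> D_syl d2 hp kp; have [r0 resp] := ker_tres (n := 0) u_homog u_coprime PQ_basis hp kp (addn0 _).
have [lam [_ res_p]] := resp r0.+1 (leqnSn _).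
exists (lam 0%N * t 0); apply: (same_tres (n := 0) (r := r0.+1) res_p).
have := residueM (lam 0%N * t 0) (residue_sylv10 r0 D_syl).
suff -> : tres 0 r0.+1 lam = lam 0%N * t 0 * tmon K r0 r0.+1 by [].
rewrite /tres big_ord1 -mulrA; congr (_ * _).
by rewrite subn0 !addn0 /tmon mulrA exprS.
Qed.

Lemma ker_tdeg1 j p D D' : sylvester_form d P Q 1 0 D ->
  sylvester_form d P Q 0 1 D' -> (3 <= d)%N ->
  bihomog (d - 3) j p -> rees_ker u p ->
  exists c c', mem2 P Q (p - (c * D + c' * D')).
Proof.
move=> D_syl D'_syl d3 hp kp.
have dE : (d - 3 + 1 = d - 2)%N by move: d3; clear; lia.
have [r0 resp] := ker_tres u_homog u_coprime PQ_basis hp kp dE.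
have [lam [_ res_p]] := resp r0 (leqnn _).
exists (lam 0%N), (lam 1%N); apply: (same_tres (n := 1) (r := r0) res_p).
have resD := residueM (lam 0%N) (residue_sylv10 r0 D_syl).
have resD' := residueM (lam 1%N) (residue_sylv01 r0 D'_syl).
have := residueD resD resD'.
suff -> : tres 1 r0 lam = lam 0%N * tmon K r0 r0.+1 + lam 1%N * tmon K r0.+1 r0 by [].
transitivity (lam 0%N * tmon K (r0 + 0) (r0 + 1) + lam 1%N * tmon K (r0 + 1) (r0 + 0)).
  exact: (sum_ord2 (fun k => lam k * tmon K (r0 + k) (r0 + (1 - k)))).
rewrite addn0 addn1; reflexivity.
Qed.

Section Minors.

Hypothesis l_indep : \det (\matrix_(i, j) l i j) != 0.
Variable Mor : {mpoly A[2]}.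
Hypothesis Mor_morley : morley_form d P Q Mor.
Variable n : nat.
Hypothesis n_lt : (n.+2 < d - 2)%N.

Local Notation bm := (band_minor (L 0) (L 1) (L 2) n.+2).
Local Notation minor k := (morley_minor (n := n.+2) (L 0) (L 1) (L 2) Mor k).

Lemma residue_minor r (k : 'I_n.+3) :
  res (n.+2 + r).+1 (minor k) ((-1) ^+ n.+2 * tres n.+2 r (fun m => bm m k)).
Proof.
rewrite (morley_minor_functional _ _ _ _ (ltn0Sn n.+1) (indep_forms_reg l_indep (i := 0))).
apply: residueM; apply: (residue_morley_form PQ_basis P_eq' _ n_lt _ Mor_morley).
rewrite -!LE => m mn; apply: band_minor_recl => //; exact: (ltn_ord k).
Qed.

(** The residues of the minors are the rows of band minors, up to sign. *)
Lemma residue_minors r (c : 'I_n.+3 -> A) :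
  res (n.+2 + r).+1 (\sum_k c k * minor k)
    (tres n.+2 r (fun m => \sum_k c k * (-1) ^+ n.+2 * bm m k)).
Proof.
have E := exchange_weights ((-1) ^+ n.+2) c
  (fun (m : 'I_n.+3) k => bm m k) (fun m => tmon K (r + m) (r + (n.+2 - m))).
exact: (eq_rect _ (fun e => res (n.+2 + r).+1 (\sum_k c k * minor k) e)
  (residue_sum (index_enum 'I_n.+3) (fun k => residueM (c k) (residue_minor r k))) _ E).
Qed.

Lemma ker_minor k : rees_ker u (minor k).
Proof. exact: (ker_of_residue (residue_minor 0 k)). Qed.

Let reg_b := indep_forms_regular2 l_indep (i := 2) (j := 1) isT.
Let reg_a := indep_forms_regular3 l_indep (i := 1) (j := 2) (k := 0) isT isT isT.

(** The coefficients of the residue of p satisfy the recurrence, hence are a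
    combination of the rows of band minors, that is of the residues of the
    Morley minors. *)
Lemma ker_minors i j p : bihomog i j p -> rees_ker u p -> (i + n.+2 = d - 2)%N ->
  exists c : 'I_n.+3 -> A, mem2 P Q (p - \sum_k c k * minor k).
Proof.
move=> hp kp iE.
have [r0 resp] := ker_tres u_homog u_coprime PQ_basis hp kp iE.
have [lam [hlam res_p]] := resp r0 (leqnn _).
have lam_rec := residue_band_rec P_eq' hlam res_p.
rewrite -!LE in lam_rec.
have [x xE] := band_kernel (indep_forms_reg l_indep (i := 2)) reg_b reg_a (ltn0Sn n.+1) lam_rec.
(* The sign - comes from exchanging the two indices of the band minors. *)
exists (fun k => - x k * (-1) ^+ n.+2).
apply: (same_tres (n := n.+2) (r := r0) (lam := lam) res_p).
have := residue_minors r0 (fun k => - x k * (-1) ^+ n.+2).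
suff -> : tres n.+2 r0 (fun m => \sum_(k < n.+3) - x k * (-1) ^+ n.+2 * (-1) ^+ n.+2 * bm m k)
  = tres n.+2 r0 lam by [].
apply: eq_bigr => m _; congr (_ * _); have mn : (m <= n.+2)%N by rewrite -ltnS.
rewrite (xE m mn); apply: eq_bigr => k _.
rewrite -[_ * _ * _ ^+ _]mulrA -exprD addnn -signr_odd odd_double expr0 mulr1.
by rewrite [in LHS]band_minor_anti mulrNN.
Qed.

End Minors.

End Generation.

Section Ideals.

Variable R : comNzRingType.
Implicit Types (s : seq R) (J : R -> Prop).

Lemma in_ideal0 s : in_ideal s 0.
Proof. by exists (fun=> 0); rewrite big1 // => i _; rewrite mul0r. Qed.

Lemma in_idealD s p q : in_ideal s p -> in_ideal s q -> in_ideal s (p + q).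
Proof.
move=> [c ->] [c' ->]; exists (fun i => c i + c' i).
by rewrite -big_split; apply: eq_bigr => i _; rewrite mulrDl.
Qed.

Lemma in_idealM s a p : in_ideal s p -> in_ideal s (a * p).
Proof.
move=> [c ->]; exists (fun i => a * c i).
by rewrite mulr_sumr; apply: eq_bigr => i _; rewrite mulrA.
Qed.

Lemma in_ideal_mem s p : p \in s -> in_ideal s p.
Proof.
move=> ps; have lt : (index p s < size s)%N by rewrite index_mem.
exists (fun i => (i == Ordinal lt)%:R).
rewrite (bigD1 (Ordinal lt)) //= eqxx mul1r nth_index // big1 ?addr0 //.
by move=> i /negbTE ->; rewrite mul0r.
Qed.

Lemma in_ideal_sub s J : J 0 -> (forall x y, J x -> J y -> J (x + y)) ->
  (forall a x, J x -> J (a * x)) -> (forall g, g \in s -> J g) ->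
  forall p, in_ideal s p -> J p.
Proof.
move=> J0 JD JM Js p [c ->].
by apply: big_ind => [||i _]; [| |apply: JM; apply: Js; apply: mem_nth].
Qed.

(** A generating set is minimal as soon as no element lies in the ideal
    generated by the others. *)
Lemma minimal_of_not_in_ideal J s : generates J s ->
  (forall g, g \in s -> ~ in_ideal [seq h <- s | h != g] g) ->
  minimal_generating_set J s.
Proof.
move=> gen irr; split=> // s' s's gen' g gs.
case: (boolP (g \in s')) => // gs'; case: (irr g gs).
have Jg : in_ideal s' g by apply/gen'/gen; exact: in_ideal_mem.
apply: (in_ideal_sub (in_ideal0 _) (@in_idealD _) (@in_idealM _) _ Jg) => h hs'.
apply: in_ideal_mem; rewrite mem_filter s's // andbT.
by apply: contraNneq gs' => <-.
Qed.

End Ideals.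

Section GeneratedIdeal.

Variable K : closedFieldType.
Local Notation A := {mpoly {mpoly K[2]}[3]}.
Variables (u : 'I_3 -> {mpoly K[2]}) (d : nat) (P Q D10 D01 : A).
Variables (E : {mpoly K[3]}) (Mor : {mpoly A[2]}).
Hypothesis u_homog : forall i, u i \is d.-homog.
Hypothesis u_coprime : no_common_factor u.
Hypothesis E_curve : defines_image u d E.
Hypothesis PQ_basis : mu_basis u d 2 P Q.
Variable l : 'I_3 -> 'I_3 -> K.
Local Notation L i := (lin_form (l i)).
Hypothesis P_eq : P = L 0 * tmon K 2 0 + L 1 * tmon K 1 1 + L 2 * tmon K 0 2.
Hypothesis l_indep : (5 <= d)%N -> \det (\matrix_(i, j) l i j) != 0.
Hypothesis D10_syl : sylvester_form d P Q 1 0 D10.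
Hypothesis D01_syl : sylvester_form d P Q 0 1 D01.
Hypothesis Mor_morley : morley_form d P Q Mor.

Variable J : A -> Prop.
Hypothesis J0 : J 0.
Hypothesis JD : forall x y, J x -> J y -> J (x + y).
Hypothesis JM : forall a x, J x -> J (a * x).
Hypothesis JE : J (x_poly E).
Hypothesis JP : J P.
Hypothesis JQ : J Q.
Hypothesis JD10 : J D10.
Hypothesis JD01 : J D01.
Hypothesis Jminor : forall i n, (0 < i)%N -> (i + n.+2 = d - 2)%N ->
  forall k : 'I_n.+3, J (morley_minor (L 0) (L 1) (L 2) Mor k).

Let J_mem2 x : mem2 P Q x -> J x.
Proof.
by move=> [a [b ->]]; apply: JD; [exact: (JM a JP)|exact: (JM b JQ)].
Qed.

Let J_mod x z : mem2 P Q (x - z) -> J z -> J x.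
Proof.
move=> /J_mem2 Jxz Jz; rewrite -(subrK z x); exact: JD Jxz Jz.
Qed.

(** The part of T-degree 0 of the kernel is the ideal of the curve. *)
Lemma ker_tconst j p : bihomog 0 j p -> rees_ker u p -> J p.
Proof.
move=> hp kp; have [p' pE] := tconstP hp.2.
have evp : on_curve u p' = 0.
  by have /(rees_ker_homog u hp.1) := kp; rewrite pE.
have [q qE] := curve_ker_principal u_homog PQ_basis isT E_curve evp.
rewrite pE qE (rmorphM (@x_poly K)); exact: JM JE.
Qed.

(** One generator type for each range of T-degrees: the equation for 0, the
    Morley minors for 1 to d - 4, the Sylvester forms for d - 3 and d - 2, and
    P, Q alone from d - 1 on. *)
Lemma ker_bihomog_generated i j p : bihomog i j p -> rees_ker u p -> J p.
Proof.
have d4 : (4 <= d)%N by case: PQ_basis.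
case: i => [|i] hp kp; first exact: ker_tconst hp kp.
have [hi|hi] := leqP (d - 1) i.+1.
  apply: J_mem2; exact: (ker_high_degree u_homog u_coprime PQ_basis hp kp hi).
have [iE|ni2] := eqVneq i.+1 (d - 2)%N.
  have d2 : (2 <= d)%N by move: d4; clear; lia.
  rewrite iE in hp; have [c mem] := ker_tdeg0 u_homog u_coprime PQ_basis D10_syl d2 hp kp.
  apply: (J_mod mem); exact: JM JD10.
have [iE|ni3] := eqVneq i.+1 (d - 3)%N.
  have d3 : (3 <= d)%N by move: d4; clear; lia.
  rewrite iE in hp.
  have [c [c' mem]] := ker_tdeg1 u_homog u_coprime PQ_basis D10_syl D01_syl d3 hp kp.
  apply: (J_mod mem); apply: JD; [exact: JM JD10|exact: JM JD01].
have [n nE] : exists n, (i.+1 + n.+2 = d - 2)%N.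
  exists (d - 2 - i.+3)%N; move: d4 hi ni2 ni3; clear; lia.
have d5 : (5 <= d)%N by move: nE; clear; lia.
have n_lt : (n.+2 < d - 2)%N by move: nE; clear; lia.
have [c mem] := ker_minors u_homog u_coprime PQ_basis P_eq (l_indep d5) Mor_morley n_lt hp kp nE.
apply: (J_mod mem); apply: big_ind => // k _; apply: JM; exact: Jminor nE k.
Qed.

Lemma ker_generated p : rees_ker u p -> J p.
Proof.
move=> kp; have [N pE] := bicomp_sum p; rewrite pE.
apply: big_ind => // j _; apply: big_ind => // i _.
apply: (ker_bihomog_generated (bihomog_bicomp i j p)).
exact: (rees_ker_bicomp u_homog i j kp).
Qed.

End GeneratedIdeal.

(** * Minimality *)

Section Bidegrees.

Variable K : closedFieldType.
Local Notation A := {mpoly {mpoly K[2]}[3]}.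
Local Notation S := {mpoly A[2]}.

Lemma bihomog00_const (x : A) : bihomog 0 0 x -> exists c : K, x = (c%:MP)%:MP.
Proof.
move=> [hx tx]; exists (x@_0)@_0.
rewrite -(homog0_const (tx 0%MM)); exact: homog0_const hx.
Qed.

Lemma bihomog_X0_const i (x : A) : bihomog i 0 x -> exists c : {mpoly K[2]}, x = c%:MP.
Proof. by move=> [hx _]; exists x@_0; exact: homog0_const hx. Qed.

Lemma const_bihomog (c : K) : bihomog 0 0 ((c%:MP)%:MP : A).
Proof. by rewrite -x_polyC; apply: bihomog_x; exact: homog_mpolyC. Qed.

Lemma bihomog_lin_form (l : 'I_3 -> K) : bihomog 0 1 (lin_form l).
Proof.
rewrite lin_formE; apply: bihomog_x; apply: rpred_sum => j _.
apply: homog_mulC; exact: homog_var.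
Qed.

Lemma st_bihomogM e j e' j' (M M' : S) : st_bihomog e j M -> st_bihomog e' j' M' ->
  st_bihomog (e + e') (j + j') (M * M').
Proof.
move=> hM hM'.
have term v w : M@_v * M'@_w != 0 -> (mdeg (v + w)%MM <= e + e')%N /\
    bihomog (e + e' - mdeg (v + w)%MM) (j + j') (M@_v * M'@_w).
  move=> nz.
  have [|le1 h1] := hM v.
    rewrite mcoeff_msupp; apply: contraNneq nz => ->; apply/eqP; exact: mul0r.
  have [|le2 h2] := hM' w.
    rewrite mcoeff_msupp; apply: contraNneq nz => ->; apply/eqP; exact: mulr0.
  rewrite mdegD; split; first by move: le1 le2; clear; lia.
  apply: (bihomog_cast (bihomogM h1 h2)); last exact: erefl.
  by move: le1 le2; clear; lia.
move=> v; rewrite mcoeff_msupp => nz; split.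
  rewrite leqNgt; apply: contraNN nz => lt; apply/eqP; rewrite mcoeffM.
  apply: big1 => k /eqP vE; case: (eqVneq (M@_k.1 * M'@_k.2) 0) => [//|/term []].
  by rewrite -vE leqNgt lt.
rewrite mcoeffM; apply: big_ind => [||k /eqP vE].
- exact: bihomog0.
- exact: bihomogD.
case: (eqVneq (M@_k.1 * M'@_k.2) 0) => [->|/term []]; first exact: bihomog0.
by rewrite -vE.
Qed.

Lemma st_bihomogB e j (M M' : S) : st_bihomog e j M -> st_bihomog e j M' ->
  st_bihomog e j (M - M').
Proof.
move=> hM hM' v; rewrite mcoeff_msupp mcoeffB => nz.
have [v1|v1] := boolP (v \in msupp M); have [v2|v2] := boolP (v \in msupp M').
- have [le h1] := hM v v1; have [_ h2] := hM' v v2; split=> //; exact: bihomogB.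
- rewrite (memN_msupp_eq0 v2) subr0; exact: hM.
- rewrite (memN_msupp_eq0 v1) sub0r; have [le h2] := hM' v v2; split=> //; exact: bihomogN.
by case/eqP: nz; rewrite (memN_msupp_eq0 v1) (memN_msupp_eq0 v2) subr0.
Qed.

Lemma st_bihomog_morley d (P Q : A) Mor : (4 <= d)%N -> morley_form d P Q Mor ->
  st_bihomog (d - 2) 2 Mor.
Proof.
move=> d4 [P0 [P1 [Q0 [Q1 [[hP0 hP1 hQ0 hQ1] _ _ ->]]]]].
have -> : (d - 2 = 1 + (d - 3))%N by move: d4; clear; lia.
by apply: (st_bihomogB (j := 1 + 1)); apply: st_bihomogM.
Qed.

Lemma bihomog_morley_coef d (P Q : A) Mor v : (4 <= d)%N -> morley_form d P Q Mor ->
  bihomog (d - 2 - mdeg v) 2 Mor@_v.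
Proof.
move=> d4 hM; have [/(st_bihomog_morley d4 hM) []//|v0] := boolP (v \in msupp Mor).
rewrite (memN_msupp_eq0 v0); exact: bihomog0.
Qed.

Lemma bihomog_sylv10 d (P Q : A) D : (4 <= d)%N -> sylvester_form d P Q 1 0 D ->
  bihomog (d - 3) 2 D.
Proof.
move=> d4 [P0 [P1 [Q0 [Q1 [[hP0 hP1 hQ0 hQ1] _ _ ->]]]]].
apply: bihomogB; [apply: (bihomog_cast (bihomogM hP0 hQ1))|
  apply: (bihomog_cast (bihomogM hP1 hQ0))] => //; by move: d4; clear; lia.
Qed.

Lemma bihomog_sylv01 d (P Q : A) D : (4 <= d)%N -> sylvester_form d P Q 0 1 D ->
  bihomog (d - 3) 2 D.
Proof.
move=> d4 [P0 [P1 [Q0 [Q1 [[hP0 hP1 hQ0 hQ1] _ _ ->]]]]].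
apply: bihomogB; [apply: (bihomog_cast (bihomogM hP0 hQ1))|
  apply: (bihomog_cast (bihomogM hP1 hQ0))] => //; by move: d4; clear; lia.
Qed.

Section BandDegrees.

Variables a b c : A.
Hypotheses (ha : bihomog 0 1 a) (hb : bihomog 0 1 b) (hc : bihomog 0 1 c).

Lemma bihomog_continuant j : bihomog 0 j (continuant a b c j.+1).
Proof.
suff : bihomog 0 j (continuant a b c j.+1) /\ bihomog 0 j.+1 (continuant a b c j.+2) by case.
elim: j => [|j [h1 h2]].
  split; first exact: bihomog1.
  rewrite continuantSS /= mulr1 mulr0 subr0; exact: bihomogN.
split; first exact: h2.
rewrite continuantSS; apply: bihomogB.
  apply: (bihomog_cast (bihomogM (bihomogN hb) h2)) => //.
apply: (bihomog_cast (bihomogM (bihomogM ha hc) h1)) => //.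
Qed.

Let bihomog_pow (x : A) k : bihomog 0 1 x -> bihomog 0 k (x ^+ k).
Proof. by move=> hx; apply: (bihomog_cast (bihomogX k hx)) => //; rewrite mul1n. Qed.

Lemma bihomog_band_minor n k m : (k <= n)%N -> (m <= n)%N ->
  bihomog 0 n.-1 (band_minor a b c n k m).
Proof.
have main p q : (p < q)%N -> (q <= n)%N ->
    bihomog 0 n.-1 (a ^+ p * continuant a b c (q - p) * c ^+ (n - q)).
  move=> pq qn; have -> : (q - p = (q - p).-1.+1)%N by move: pq; clear; lia.
  apply: (bihomog_cast (bihomogM (bihomogM (bihomog_pow p ha)
    (bihomog_continuant (q - p).-1)) (bihomog_pow (n - q) hc))) => //.
  by move: pq qn; clear; lia.
move=> kn mn; have [lt|lt|->] := ltngtP k m.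
- rewrite /band_minor ltnW //; exact: main.
- rewrite band_minor_anti /band_minor ltnW //; apply: bihomogN; exact: main.
rewrite band_minor_alt; exact: bihomog0.
Qed.

End BandDegrees.

Lemma bihomog_minor d (P Q : A) Mor (L0 Ls L1 : A) i n (k : 'I_n.+3) :
  (4 <= d)%N -> morley_form d P Q Mor ->
  bihomog 0 1 L0 -> bihomog 0 1 Ls -> bihomog 0 1 L1 -> GRing.lreg L0 ->
  (i + n.+2 = d - 2)%N -> bihomog i n.+3 (morley_minor (n := n.+2) L0 Ls L1 Mor k).
Proof.
move=> d4 hM h0 hs h1 reg0 iE.
rewrite (morley_minor_functional _ _ _ _ (ltn0Sn n.+1) reg0).
have sgn : bihomog 0 0 ((-1) ^+ n.+2 : A).
  exact: (bihomog_cast (bihomogX n.+2 (bihomogN (bihomog1 K)))).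
apply: (bihomogM sgn).
apply: bihomog_sum => m; have mn : (m <= n.+2)%N by rewrite -ltnS.
have kn : (k <= n.+2)%N by rewrite -ltnS.
apply: (bihomog_cast (bihomogM (bihomog_band_minor h0 hs h1 mn kn)
  (bihomog_morley_coef (bmon (n.+2 - m) m) d4 hM))).
  by rewrite mdeg_bmon; move: mn iE; clear; lia.
by rewrite addn2.
Qed.

End Bidegrees.

Lemma sign_shuffle (A : comNzRingType) n (x y : A) :
  x * - y = - (-1) ^+ n * (x * (-1) ^+ n * y).
Proof.
have e : (-1) ^+ n * (-1) ^+ n = 1 :> A by rewrite -exprD addnn -signr_odd odd_double.
by rewrite mulNr mulrN -(mulrA x) (mulrCA x) (mulrA ((-1) ^+ n)) e mul1r.
Qed.

Section Independence.

Variable K : closedFieldType.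
Local Notation A := {mpoly {mpoly K[2]}[3]}.
Local Notation t k := (tvar K k).
Variables (u : 'I_3 -> {mpoly K[2]}) (d : nat) (P Q : A).
Hypothesis PQ_basis : mu_basis u d 2 P Q.

Lemma thomog_const (c : K) : thomog 0 ((c%:MP)%:MP : A).
Proof. exact: (const_bihomog c).2. Qed.

Lemma const_eq0 (c : K) : (c%:MP)%:MP = 0 :> A -> c = 0.
Proof.
move=> c0; have := congr1 (fun x : A => (x@_0)@_0) c0.
by rewrite /= !mcoeff0 mcoeffC eqxx mulr1 mcoeffC eqxx mulr1.
Qed.

(** The residues are two distinct monomials outside (T_0^N, T_1^N). *)
Lemma sylvs_independent D D' (c c' : K) : sylvester_form d P Q 1 0 D ->
  sylvester_form d P Q 0 1 D' ->
  mem2 P Q ((c%:MP)%:MP * D + (c'%:MP)%:MP * D') -> c = 0 /\ c' = 0.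
Proof.
move=> D_syl D'_syl mem.
pose lam (k : nat) : A := ((if k == 0%N then c else c')%:MP)%:MP.
have hlam k : thomog 0 (lam k) by exact: thomog_const.
have resD := residueM ((c%:MP)%:MP) (residue_sylv10 0 D_syl).
have resD' := residueM ((c'%:MP)%:MP) (residue_sylv01 0 D'_syl).
have resDD := residueD resD resD'.
have E : tres 1 0 lam = (c%:MP)%:MP * tmon K 0 1 + (c'%:MP)%:MP * tmon K 1 0.
  exact: (sum_ord2 (fun k => lam k * tmon K (0 + k) (0 + (1 - k)))).
rewrite -E in resDD; have lam0 := tres_eq0 PQ_basis (n := 1) (r := 0) hlam resDD mem.
by split; apply: const_eq0; [exact: (lam0 0%N)|exact: (lam0 1%N)].
Qed.

Variable l : 'I_3 -> 'I_3 -> K.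
Local Notation L i := (lin_form (l i)).
Hypothesis P_eq : P = L 0 * tmon K 2 0 + L 1 * tmon K 1 1 + L 2 * tmon K 0 2.
Hypothesis l_indep : \det (\matrix_(i, j) l i j) != 0.
Variable Mor : {mpoly A[2]}.
Hypothesis Mor_morley : morley_form d P Q Mor.

Let reg_b := indep_forms_regular2 l_indep (i := 2) (j := 1) isT.
Let reg_a := indep_forms_regular3 l_indep (i := 1) (j := 2) (k := 0) isT isT isT.

Lemma const_mod_linear_forms (c : K) (p q r : A) :
  (c%:MP)%:MP = L 0 * p + L 1 * q + L 2 * r -> c = 0.
Proof.
move=> eq; have hL i : L i \is 1.-homog by exact: (bihomog_lin_form (l i)).1.
have at0 i (x : A) : (L i * x)@_0 = 0.
  rewrite mulrC; apply: (mcoeff_low x (hL i)); by rewrite mdeg0.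
have := congr1 (fun x : A => (x@_0)@_0) eq.
by rewrite /= !mcoeffD !at0 !mcoeff0 !addr0 mcoeffC eqxx mulr1 mcoeffC eqxx mulr1.
Qed.

(** A relation modulo (P, Q) is a relation among the rows of the band, and its
    rows are independent modulo the three forms, hence over K. *)
Lemma minors_independent n (c : 'I_n.+3 -> K) : (n.+2 < d - 2)%N ->
  mem2 P Q (\sum_k ((c k)%:MP)%:MP * morley_minor (n := n.+2) (L 0) (L 1) (L 2) Mor k) ->
  forall k, c k = 0.
Proof.
move=> n_lt mem.
pose x (k : nat) : A := ((c (inord k))%:MP)%:MP.
have resm := residue_minors PQ_basis P_eq l_indep Mor_morley n_lt 0 (fun k => ((c k)%:MP)%:MP).
pose lam (m : nat) : A := \sum_(k < n.+3) ((c k)%:MP)%:MP * (-1) ^+ n.+2 *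
  band_minor (L 0) (L 1) (L 2) n.+2 (minn m n.+2) k.
have lamE m : (m <= n.+2)%N -> lam m = \sum_(k < n.+3) ((c k)%:MP)%:MP * (-1) ^+ n.+2 *
  band_minor (L 0) (L 1) (L 2) n.+2 m k by move=> mn; rewrite /lam (minn_idPl mn).
have hlam m : thomog 0 (lam m).
  apply: thomog_sum => k; have kn : (k <= n.+2)%N by rewrite -ltnS.
  have hb := (bihomog_band_minor (bihomog_lin_form (l 0)) (bihomog_lin_form (l 1))
    (bihomog_lin_form (l 2)) (geq_minr m n.+2) kn).2.
  have hs : thomog 0 ((-1) ^+ n.+2 : A).
    exact: (bihomog_cast (bihomogX n.+2 (bihomogN (bihomog1 K))) (mul0n _) erefl).2.
  exact: (thomogM (thomogM (thomog_const (c k)) hs) hb).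
have resl : residue P Q (t 0 ^+ (n.+2 + 0).+1) (t 1 ^+ (n.+2 + 0).+1)
    (\sum_k ((c k)%:MP)%:MP * morley_minor (n := n.+2) (L 0) (L 1) (L 2) Mor k)
    (tres n.+2 0 lam).
  suff -> : tres n.+2 0 lam = tres n.+2 0 (fun m => \sum_(k < n.+3) ((c k)%:MP)%:MP * (-1) ^+ n.+2 *
    band_minor (L 0) (L 1) (L 2) n.+2 m k) by exact: resm.
  by apply: eq_bigr => m _; rewrite lamE // -ltnS.
have lam0 := tres_eq0 PQ_basis hlam resl mem.
have x0 : forall k, (k <= n.+2)%N -> x k = 0.
  apply: (band_minor_indep (indep_forms_reg l_indep (i := 0)) reg_b reg_a (ltn0Sn n.+1)).
    by move=> k p q r xk; rewrite /x (const_mod_linear_forms xk) !mpolyC0.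
  move=> m mn; transitivity (- (-1) ^+ n.+2 * lam m); last by rewrite (lam0 m mn) mulr0.
  rewrite (lamE m mn) mulr_sumr; apply: eq_bigr => k _; rewrite /x inord_val [in LHS]band_minor_anti.
  exact: sign_shuffle.
move=> k; have := x0 k; rewrite -ltnS => /(_ (ltn_ord k)) /const_eq0.
by rewrite inord_val.
Qed.

End Independence.

Lemma bihomog_uniq (K : fieldType) (x : {mpoly {mpoly K[2]}[3]}) i j i' j' :
  x != 0 -> bihomog i j x -> bihomog i' j' x -> i = i' /\ j = j'.
Proof.
move=> x0 [hx tx] [hx' tx'].
have m0 : mlead x \in msupp x by exact: mlead_supp.
split; last by rewrite -(mdeg_homog hx m0) (mdeg_homog hx' m0).
have c0 : x@_(mlead x) != 0 by rewrite -mcoeff_msupp.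
have m1 : mlead x@_(mlead x) \in msupp x@_(mlead x) by exact: mlead_supp.
by rewrite -(mdeg_homog (tx _) m1) (mdeg_homog (tx' _) m1).
Qed.

Lemma double_sumn_iota c a e : (a + e <= c.+1)%N ->
  (sumn [seq (c - i).+1 | i <- iota a e]).*2 = (e * (2 * (c - a) + 3 - e))%N.
Proof.
elim: e a => [|e IHe] a le; first by [].
rewrite /= doubleD IHe; last by rewrite addSnnS.
have [f ->] : exists f, c = (f + a + e)%N by exists (c - a - e)%N; lia.
have -> : (f + a + e - a.+1 = f + e - 1)%N by lia.
have -> : (f + a + e - a = f + e)%N by lia.
case: e {IHe le} => [|e]; first by lia.
have -> : (2 * (f + e.+1 - 1) + 3 - e.+1 = 2 * f + e + 2)%N by lia.
have -> : (2 * (f + e.+1) + 3 - e.+2 = 2 * f + e + 3)%N by lia.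
nia.
Qed.

Section MinimalGenerators.

Variable K : closedFieldType.
Local Notation A := {mpoly {mpoly K[2]}[3]}.
Variables (u : 'I_3 -> {mpoly K[2]}) (d : nat) (P Q D10 D01 : A).
Variables (E : {mpoly K[3]}) (Mor : {mpoly A[2]}).
Hypothesis u_homog : forall i, u i \is d.-homog.
Hypothesis u_coprime : no_common_factor u.
Hypothesis E_curve : defines_image u d E.
Hypothesis PQ_basis : mu_basis u d 2 P Q.
Variable l : 'I_3 -> 'I_3 -> K.
Local Notation L i := (lin_form (l i)).
Hypothesis P_eq : P = L 0 * tmon K 2 0 + L 1 * tmon K 1 1 + L 2 * tmon K 0 2.
Hypothesis l_indep : (5 <= d)%N -> \det (\matrix_(i, j) l i j) != 0.
Hypothesis D10_syl : sylvester_form d P Q 1 0 D10.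
Hypothesis D01_syl : sylvester_form d P Q 0 1 D01.
Hypothesis Mor_morley : morley_form d P Q Mor.

Let d_ge4 : (4 <= d)%N.
Proof. by case: PQ_basis. Qed.

Local Notation minor := (morley_minor (L 0) (L 1) (L 2) Mor).

Variant generator : A -> nat -> nat -> Prop :=
| GenE : generator (x_poly E) 0 d
| GenP : generator P 2 1
| GenQ : generator Q (d - 2) 1
| GenD10 : generator D10 (d - 3) 2
| GenD01 : generator D01 (d - 3) 2
| GenMinor i n (k : 'I_n.+1) of (0 < i)%N & (1 < n)%N & (i + n = d - 2)%N :
    generator (minor k) i n.+1.

Let gens : seq A :=
  [:: x_poly E; P; Q; D10; D01] ++ morley_minors d (L 0) (L 1) (L 2) Mor.

Lemma gensP g : g \in gens <-> exists i j, generator g i j.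
Proof.
split.
  rewrite mem_cat !inE => /orP[/orP[/eqP ->|/orP[/eqP ->|/orP[/eqP ->|/orP[/eqP ->|/eqP ->]]]]|].
  - by exists 0%N, d; constructor.
  - by exists 2%N, 1%N; constructor.
  - by exists (d - 2)%N, 1%N; constructor.
  - by exists (d - 3)%N, 2%N; constructor.
  - by exists (d - 3)%N, 2%N; constructor.
  move=> /allpairsPdep [i [k [ii _ ->]]]; exists i, (d - 2 - i).+1.
  move: ii; rewrite mem_iota => /andP[i0 ii].
  constructor=> //; move: d_ge4 ii; clear; lia.
rewrite mem_cat => -[i [j gen]]; apply/orP.
case: gen => [|||||i' n k i0 n1 iE]; try by left; rewrite !inE eqxx ?orbT.
right; have nE : n = (d - 2 - i')%N by move: iE; clear; lia.
move: k; rewrite nE => k; apply: allpairs_f_dep; last by rewrite mem_enum.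
rewrite mem_iota i0; move: iE n1; clear; lia.
Qed.

Lemma generator_bihomog g i j : generator g i j -> bihomog i j g.
Proof.
case=> [|||||i' n k i0 n1 iE].
- by case: E_curve => hE _ _; exact: bihomog_x.
- exact: P_bihomog PQ_basis.
- exact: Q_bihomog PQ_basis.
- exact: bihomog_sylv10 d_ge4 D10_syl.
- exact: bihomog_sylv01 d_ge4 D01_syl.
have d5 : (5 <= d)%N by move: i0 n1 iE; clear; lia.
case: n k n1 iE => [|[|n]] // k _ iE.
exact: (bihomog_minor k d_ge4 Mor_morley (bihomog_lin_form (l 0)) (bihomog_lin_form (l 1))
  (bihomog_lin_form (l 2)) (indep_forms_reg (l_indep d5) (i := 0)) iE).
Qed.

Lemma generator_ker g i j : generator g i j -> rees_ker u g.
Proof.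
case=> [|||||i' n k i0 n1 iE].
- have hE : bihomog 0 d (x_poly E) by exact: generator_bihomog GenE.
  apply/(rees_ker_homog u hE.1).
  by apply: (on_curve_equation u_homog _ E_curve); apply: leq_trans d_ge4.
- exact: P_ker PQ_basis.
- exact: Q_ker PQ_basis.
- exact: (ker_sylv10 PQ_basis D10_syl).
- exact: (ker_sylv01 PQ_basis D01_syl).
have d5 : (5 <= d)%N by move: i0 n1 iE; clear; lia.
have n_lt : (n < d - 2)%N by move: i0 iE; clear; lia.
case: n k n1 iE n_lt => [|[|n]] // k _ iE n_lt.
exact: (ker_minor PQ_basis P_eq (l_indep d5) Mor_morley n_lt k).
Qed.

Lemma gens_generate : generates (rees_ker u) gens.
Proof.
move=> p; split; last first.
  apply: in_ideal_sub; [exact: rees_ker0|exact: rees_kerD|exact: rees_kerM|].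
  by move=> g /gensP [i [j gen]]; exact: generator_ker gen.
have mem g i j : generator g i j -> in_ideal gens g.
  by move=> gen; apply: in_ideal_mem; apply/gensP; exists i, j.
apply: (ker_generated u_homog u_coprime E_curve PQ_basis P_eq l_indep D10_syl
  D01_syl Mor_morley (in_ideal0 _) (@in_idealD _ _) (@in_idealM _ _)).
- exact: mem GenE.
- exact: mem GenP.
- exact: mem GenQ.
- exact: mem GenD10.
- exact: mem GenD01.
by move=> i n i0 iE k; exact: (mem _ _ _ (GenMinor k i0 (isT : (1 < n.+2)%N) iE)).
Qed.

(** Whether a bihomogeneous element lies in an ideal is decided in its own
    bidegree. *)
Lemma in_ideal_bidegree (J : A -> Prop) s i j g : J 0 ->
  (forall x y, J x -> J y -> J (x + y)) -> bihomog i j g -> in_ideal s g ->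
  (forall h a, h \in s -> J (bicomp i j (a * h))) -> J g.
Proof.
move=> J0 JD hg [c gE] Js; rewrite -(bicomp_id hg) gE raddf_sum.
by apply: big_ind => // k _; apply: Js; exact: mem_nth.
Qed.

Let bicomp_low i j k m (h a : A) : bihomog k m h -> ~~ ((k <= i) && (m <= j))%N ->
  bicomp i j (a * h) = 0.
Proof. by move=> hh /negbTE lt; rewrite (bicomp_Mr _ _ _ hh) lt. Qed.

Let bicomp_same i j (h a : A) : bihomog i j h -> exists c : K,
  bicomp i j (a * h) = (c%:MP)%:MP * h.
Proof.
move=> hh; rewrite (bicomp_Mr _ _ _ hh) !leqnn !subnn.
have [c ->] := bihomog00_const (bihomog_bicomp 0 0 a); by exists c.
Qed.

Let bicomp_sameX i j m (h a : A) : bihomog m j h -> exists c : {mpoly K[2]},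
  bicomp i j (a * h) = c%:MP * h.
Proof.
move=> hh; rewrite (bicomp_Mr _ _ _ hh) leqnn subnn; case: ifP => _.
  have [c ->] := bihomog_X0_const (bihomog_bicomp (i - m) 0 a); by exists c.
by exists 0; rewrite mpolyC0 mul0r.
Qed.

Let bicomp_P i j (a : A) : mem2 P Q (bicomp i j (a * P)).
Proof.
rewrite (bicomp_Mr _ _ _ (P_bihomog PQ_basis)); case: ifP => _; [exact: mem2l|exact: mem2_0].
Qed.

Let bicomp_Q i j (a : A) : mem2 P Q (bicomp i j (a * Q)).
Proof.
rewrite (bicomp_Mr _ _ _ (Q_bihomog PQ_basis)); case: ifP => _; [exact: mem2r|exact: mem2_0].
Qed.

Local Notation others g := [seq h <- gens | h != g].

(** All other generators have positive T-degree. *)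
Let E_not_generated : ~ in_ideal (others (x_poly E)) (x_poly E).
Proof.
move=> gE; have E0 : x_poly E = 0.
  apply: (in_ideal_bidegree (J := fun x : A => x = 0) _ _ (generator_bihomog GenE) gE) => //.
    by move=> x y -> ->; rewrite addr0.
  move=> h a; rewrite mem_filter => /andP[hE /gensP [i [j gen]]].
  apply: (bicomp_low _ (generator_bihomog gen)).
  case: gen hE => [|||||i' n k i0 n1 iE]; rewrite ?eqxx // => _.
  - by move: d_ge4; clear; lia.
  - by move: d_ge4; clear; lia.
  - by move: d_ge4; clear; lia.
  by move: i0; clear; lia.
case: E_curve => _ [/eqP E_neq0 _ _] _; apply: E_neq0.
apply: x_poly_inj; rewrite E0; apply/esym; exact: (rmorph0 (@x_poly K)).
Qed.

(** In bidegrees with only one other generator h to be considered, the ideal of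
    the others reduces to the multiples of h. *)
Let mem_line (h : A) i j g : bihomog i j g -> in_ideal (others g) g ->
  (forall x, x \in others g -> forall a, exists c : {mpoly K[2]},
    bicomp i j (a * x) = c%:MP * h) ->
  exists c : {mpoly K[2]}, g = c%:MP * h.
Proof.
move=> hg gg H.
apply: (in_ideal_bidegree (J := fun x : A => exists c : {mpoly K[2]}, x = c%:MP * h) _ _ hg gg).
- by exists 0; rewrite mpolyC0 mul0r.
- by move=> x y [c ->] [c' ->]; exists (c + c'); rewrite mpolyCD mulrDl.
by move=> x a xs; exact: H.
Qed.

Let P_not_generated : ~ in_ideal (others P) P.
Proof.
move=> gP; have [|c PE] := mem_line (h := Q) (generator_bihomog GenP) gP.
  move=> x; rewrite mem_filter => /andP[xP /gensP [i [j gen]]] a.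
  have [xQ|xQ] := eqVneq x Q; first by rewrite xQ; exact: bicomp_sameX (Q_bihomog PQ_basis).
  exists 0; rewrite mpolyC0 mul0r; apply: (bicomp_low _ (generator_bihomog gen)).
  case: gen xP xQ => [|||||i' n k i0 n1 iE]; rewrite ?eqxx // => _ _.
  - by move: d_ge4; clear; lia.
  - by rewrite andbF.
  - by rewrite andbF.
  by move: n1; clear; lia.
have [|/eqP] := basis_free PQ_basis (a := 1) (b := - c).
  rewrite mpolyC1 mul1r mpolyCN mulNr -PE; exact: subrr.
by rewrite oner_eq0.
Qed.

Let Q_not_generated : ~ in_ideal (others Q) Q.
Proof.
move=> gQ; have [|c QE] := mem_line (h := P) (generator_bihomog GenQ) gQ.
  move=> x; rewrite mem_filter => /andP[xQ /gensP [i [j gen]]] a.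
  have [xP|xP] := eqVneq x P; first by rewrite xP; exact: bicomp_sameX (P_bihomog PQ_basis).
  exists 0; rewrite mpolyC0 mul0r; apply: (bicomp_low _ (generator_bihomog gen)).
  case: gen xP xQ => [|||||i' n k i0 n1 iE]; rewrite ?eqxx // => _ _.
  - by move: d_ge4; clear; lia.
  - by rewrite andbF.
  - by rewrite andbF.
  by move: n1; clear; lia.
have [|_ /eqP] := basis_free PQ_basis (a := - c) (b := 1).
  rewrite mpolyC1 mul1r mpolyCN mulNr -QE; exact: addNr.
by rewrite oner_eq0.
Qed.

(** The analogue modulo (P, Q), with coefficients in K. *)
Let mem_pencil (h : A) i j g : bihomog i j g -> in_ideal (others g) g ->
  (forall x, x \in others g -> forall a, exists c : K,
    mem2 P Q (bicomp i j (a * x) - (c%:MP)%:MP * h)) ->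
  exists c : K, mem2 P Q (g - (c%:MP)%:MP * h).
Proof.
move=> hg gg H.
apply: (in_ideal_bidegree (J := fun x : A => exists c : K,
  mem2 P Q (x - (c%:MP)%:MP * h)) _ _ hg gg).
- by exists 0; rewrite !mpolyC0 mul0r subr0; exact: mem2_0.
- move=> x y [c mc] [c' mc']; exists (c + c').
  rewrite !mpolyCD mulrDl opprD addrACA; exact: mem2D.
by move=> x a xs; exact: H.
Qed.

Let sylv_pencil (h g x a : A) : generator g (d - 3) 2 -> generator h (d - 3) 2 ->
  (forall y, generator y (d - 3) 2 -> y = g \/ y = h) ->
  x \in others g -> exists c : K,
  mem2 P Q (bicomp (d - 3) 2 (a * x) - (c%:MP)%:MP * h).
Proof.
move=> gg gh gy; rewrite mem_filter => /andP[xg /gensP [i [j gen]]].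
have zero : mem2 P Q (bicomp (d - 3) 2 (a * x)) -> exists c : K,
    mem2 P Q (bicomp (d - 3) 2 (a * x) - (c%:MP)%:MP * h).
  by move=> mem; exists 0; rewrite !mpolyC0 mul0r subr0.
have low : ~~ ((i <= d - 3) && (j <= 2))%N -> exists c : K,
    mem2 P Q (bicomp (d - 3) 2 (a * x) - (c%:MP)%:MP * h).
  by move=> ij; apply: zero; rewrite (bicomp_low _ (generator_bihomog gen) ij); exact: mem2_0.
have same : generator x (d - 3) 2 -> exists c : K,
    mem2 P Q (bicomp (d - 3) 2 (a * x) - (c%:MP)%:MP * h).
  move=> /gy [xE|->]; first by rewrite xE eqxx in xg.
  have [c ->] := bicomp_same a (generator_bihomog gh).
  exists c; rewrite subrr; exact: mem2_0.
case: gen zero low same => [|||||i' n k i0 n1 iE] zero low same.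
- by apply: low; move: d_ge4; clear; lia.
- by apply: zero; exact: bicomp_P.
- by apply: zero; exact: bicomp_Q.
- by apply: same; constructor.
- by apply: same; constructor.
by apply: low; move: n1; clear; lia.
Qed.

Let sylv_generators y : generator y (d - 3) 2 -> y = D10 \/ y = D01.
Proof.
suff inv i j : generator y i j -> i = (d - 3)%N -> j = 2 -> y = D10 \/ y = D01.
  by move=> gen; exact: inv gen erefl erefl.
case=> [|||||i' n k i0 n1 iE].
- by move=> _ dE; move: dE d_ge4; clear; lia.
- by [].
- by [].
- by left.
- by right.
by move=> _ nE; move: nE n1; clear; lia.
Qed.

Let D10_not_generated : ~ in_ideal (others D10) D10.
Proof.
move=> gD; have [|c mem] := mem_pencil (h := D01) (generator_bihomog GenD10) gD.
  move=> x xs a; exact: (sylv_pencil a GenD10 GenD01 sylv_generators xs).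
have [|/eqP] := sylvs_independent PQ_basis (c := 1) (c' := - c) D10_syl D01_syl.
  rewrite !mpolyC1 mul1r !mpolyCN mulNr; exact: mem.
by rewrite oner_eq0.
Qed.

Let D01_not_generated : ~ in_ideal (others D01) D01.
Proof.
move=> gD; have [|c mem] := mem_pencil (h := D10) (generator_bihomog GenD01) gD.
  move=> x xs a; apply: (sylv_pencil a GenD01 GenD10 _ xs).
  by move=> y /sylv_generators []; [right|left].
have [|_ /eqP] := sylvs_independent PQ_basis (c := - c) (c' := 1) D10_syl D01_syl.
  rewrite !mpolyC1 mul1r !mpolyCN mulNr addrC; exact: mem.
by rewrite oner_eq0.
Qed.

(** In the bidegree of a Morley minor, the other generators contribute only
    elements of (P, Q) and constant multiples of the minors for the same i. *)
Let minor_not_generated i n (k : 'I_n.+1) : (0 < i)%N -> (1 < n)%N ->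
  (i + n = d - 2)%N -> ~ in_ideal (others (minor k)) (minor k).
Proof.
move=> i0 n1 iE gm.
have n_lt : (n < d - 2)%N by move: i0 iE; clear; lia.
have d5 : (5 <= d)%N by move: i0 n1 iE; clear; lia.
have [c [ck mem]] : exists c : 'I_n.+1 -> K, c k = 0 /\
    mem2 P Q (minor k - \sum_m ((c m)%:MP)%:MP * minor m).
  have zero (x : A) : mem2 P Q x -> exists c : 'I_n.+1 -> K, c k = 0 /\
      mem2 P Q (x - \sum_m ((c m)%:MP)%:MP * minor m).
    move=> mx; exists (fun=> 0); split=> //.
    rewrite [X in _ - X]big1 ?subr0 // => m _; rewrite !mpolyC0; exact: mul0r.
  apply: (in_ideal_bidegree (J := fun x : A => exists c : 'I_n.+1 -> K, c k = 0 /\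
    mem2 P Q (x - \sum_m ((c m)%:MP)%:MP * minor m)) _ _
    (generator_bihomog (GenMinor k i0 n1 iE)) gm).
  - apply: zero; exact: mem2_0.
  - move=> x y [c [ck mc]] [c' [ck' mc']]; exists (fun m => c m + c' m).
    split; first by rewrite ck ck' addr0.
    rewrite (eq_bigr (fun m => ((c m)%:MP)%:MP * minor m + ((c' m)%:MP)%:MP * minor m)).
      rewrite big_split opprD addrACA; exact: mem2D.
    move=> m _; rewrite !mpolyCD; exact: mulrDl.
  move=> x a; rewrite mem_filter => /andP[xk /gensP [i' [j' gen]]].
  have low : ~~ ((i' <= i) && (j' <= n.+1))%N -> exists c : 'I_n.+1 -> K, c k = 0 /\
      mem2 P Q (bicomp i n.+1 (a * x) - \sum_m ((c m)%:MP)%:MP * minor m).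
    by move=> ij; apply: zero; rewrite (bicomp_low _ (generator_bihomog gen) ij); exact: mem2_0.
  case: gen xk low => [|||||i'' n' k' i0' n1' iE'] xk low.
  - by apply: low; move: n_lt; clear; lia.
  - by apply: zero; exact: bicomp_P.
  - by apply: zero; exact: bicomp_Q.
  - by apply: low; move: n1 iE d_ge4; clear; lia.
  - by apply: low; move: n1 iE d_ge4; clear; lia.
  case: (eqVneq n' n) => [nE|nn]; last first.
    by apply: low; move: iE iE' nn; clear; lia.
  clear low; move: k' xk; rewrite nE => k' xk.
  have [c ->] := bicomp_same a (generator_bihomog (GenMinor k' i0 n1 iE)).
  exists (fun m => if m == k' then c else 0); split.
    by case: (eqVneq k k') xk => // ->; rewrite eqxx.
  rewrite (bigD1 k') // eqxx [X in _ - (_ + X)]big1; last first.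
    by move=> m /negbTE ->; rewrite !mpolyC0; exact: mul0r.
  rewrite addr0 subrr; exact: mem2_0.
case: n k n1 iE n_lt c ck mem {gm} => [|[|n]] // k _ iE n_lt c ck mem.
pose c' m := (if m == k then 1 else 0) - c m.
have mem' : mem2 P Q (\sum_m ((c' m)%:MP)%:MP * minor m).
  rewrite (eq_bigr (fun m => ((if m == k then 1 else 0 : K)%:MP)%:MP * minor m
    - ((c m)%:MP)%:MP * minor m)); last first.
    move=> m _; rewrite /c' !mpolyCB; exact: mulrBl.
  rewrite big_split /= sumrN (bigD1 k isT) /= eqxx [X in (_ + X) - _]big1; last first.
    move=> m /negbTE ->; rewrite !mpolyC0; exact: mul0r.
  rewrite addr0 !mpolyC1 mul1r; exact: mem.
have /eqP := minors_independent PQ_basis P_eq (l_indep d5) Mor_morley n_lt mem' k.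
by rewrite /c' eqxx ck subr0 oner_eq0.
Qed.

Lemma gens_irredundant g : g \in gens -> ~ in_ideal (others g) g.
Proof.
move=> /gensP [i [j gen]]; case: gen => [|||||i' n k i0 n1 iE].
- exact: E_not_generated.
- exact: P_not_generated.
- exact: Q_not_generated.
- exact: D10_not_generated.
- exact: D01_not_generated.
exact: minor_not_generated i0 n1 iE.
Qed.

Lemma gens_minimal : minimal_generating_set (rees_ker u) gens.
Proof. exact: minimal_of_not_in_ideal gens_generate gens_irredundant. Qed.

Let generator_bidegree g i j i' j' : generator g i j -> generator g i' j' ->
  i = i' /\ j = j'.
Proof.
move=> gen gen'; apply: (bihomog_uniq _ (generator_bihomog gen) (generator_bihomog gen')).
have : g \in gens by apply/gensP; exists i, j.
move=> /gens_irredundant irr; apply/eqP => g0; apply: irr; rewrite g0; exact: in_ideal0.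
Qed.

Let minor_inj n : (1 < n)%N -> (n < d - 2)%N -> injective (fun k : 'I_n.+1 => minor k).
Proof.
move=> n1 n_lt k k' /= eq; apply/eqP; apply: contraT => kk'.
have d5 : (5 <= d)%N by move: n1 n_lt; clear; lia.
have [n' nE] : exists n', n = n'.+2 by exists (n - 2)%N; move: n1; clear; lia.
subst n; clear n1.
pose c m : K := (m == k)%:R - (m == k')%:R.
have ck : c k = 1 by rewrite /c eqxx (negbTE kk') subr0.
have ck' : c k' = -1 by rewrite /c eqxx eq_sym (negbTE kk') sub0r.
have cm m : m != k -> m != k' -> c m = 0.
  by move=> /negbTE mk /negbTE mk'; rewrite /c mk mk' subr0.
clearbody c; have mem : mem2 P Q (\sum_m ((c m)%:MP)%:MP * minor m).
  rewrite (bigD1 k isT) (bigD1 k') /=; last by rewrite eq_sym.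
  rewrite [X in _ + (_ + X)]big1; last first.
    move=> m /andP[mk mk']; rewrite (cm _ mk mk') !mpolyC0; exact: mul0r.
  rewrite ck ck' !mpolyCN !mpolyC1 [X in _ + X]addr0 mul1r mulN1r eq subrr.
  exact: mem2_0.
have := minors_independent PQ_basis P_eq (l_indep d5) Mor_morley n_lt mem k.
by rewrite ck => /eqP; rewrite oner_eq0.
Qed.

Lemma minors_uniq : uniq (morley_minors d (L 0) (L 1) (L 2) Mor).
Proof.
apply: allpairs_uniq_dep; first exact: iota_uniq.
  move=> i _; exact: enum_uniq.
move=> p p' /allpairsPdep [i [k [ii _ ->]]] /allpairsPdep [i' [k' [ii' _ ->]]] /= eq.
move: ii ii'; rewrite !mem_iota => /andP[i0 ii] /andP[i0' ii'].
have gen : generator (minor k) i (d - 2 - i).+1.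
  constructor; [exact: i0|move: d_ge4 ii; clear; lia|move: d_ge4 ii; clear; lia].
have gen' : generator (minor k') i' (d - 2 - i').+1.
  constructor; [exact: i0'|move: d_ge4 ii'; clear; lia|move: d_ge4 ii'; clear; lia].
have [iE _] : i = i' /\ (d - 2 - i).+1 = (d - 2 - i').+1.
  by apply: (generator_bidegree gen); rewrite eq.
move: k' eq {gen gen' ii'}; rewrite -iE => k' eq.
congr (Tagged _ _); apply: (minor_inj _ _ eq); move: d_ge4 ii i0; clear; lia.
Qed.

Lemma gens_uniq : uniq gens.
Proof.
have neq g g' i j i' j' : generator g i j -> generator g' i' j' ->
    (i, j) != (i', j') -> g != g'.
  move=> gen gen'; apply: contraNneq => gg'; rewrite -gg' in gen'.
  by have [-> ->] := generator_bidegree gen gen'.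
have PQ : P != Q.
  apply/eqP => PQ; have [|/eqP] := basis_free PQ_basis (a := 1) (b := -1).
    rewrite mpolyCN mpolyC1 mul1r mulN1r PQ; exact: subrr.
  by rewrite oner_eq0.
have DD : D10 != D01.
  apply/eqP => DD.
  have [|/eqP] := sylvs_independent PQ_basis (c := 1) (c' := -1) D10_syl D01_syl.
    rewrite !mpolyCN !mpolyC1 mul1r mulN1r DD subrr; exact: mem2_0.
  by rewrite oner_eq0.
rewrite cat_uniq minors_uniq andbT; apply/andP; split.
  rewrite /= !inE !negb_or PQ DD /= !andbT.
  have dd : (d == 1%N) = false /\ (d == 2) = false by move: d_ge4; clear; lia.
  rewrite (neq _ _ _ _ _ _ GenE GenP) ?(neq _ _ _ _ _ _ GenE GenQ)
    ?(neq _ _ _ _ _ _ GenE GenD10) ?(neq _ _ _ _ _ _ GenE GenD01)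
    ?(neq _ _ _ _ _ _ GenP GenD10) ?(neq _ _ _ _ _ _ GenP GenD01)
    ?(neq _ _ _ _ _ _ GenQ GenD10) ?(neq _ _ _ _ _ _ GenQ GenD01)
    // xpair_eqE ?dd.1 ?dd.2 ?andbF //.
apply/hasPn => g /allpairsPdep [i [k [ii _ gE]]].
move: ii; rewrite mem_iota => /andP[i0 ii].
have gen : generator g i (d - 2 - i).+1.
  rewrite gE; constructor; [exact: i0|move: d_ge4 ii; clear; lia|move: d_ge4 ii; clear; lia].
rewrite !inE; apply/negP => /orP[|/orP[|/orP[|/orP[|]]]]; apply/negP.
- apply: (neq _ _ _ _ _ _ gen GenE); rewrite xpair_eqE; move: i0; clear; lia.
- apply: (neq _ _ _ _ _ _ gen GenP); rewrite xpair_eqE; move: d_ge4 ii; clear; lia.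
- apply: (neq _ _ _ _ _ _ gen GenQ); rewrite xpair_eqE; move: d_ge4 ii; clear; lia.
- apply: (neq _ _ _ _ _ _ gen GenD10); rewrite xpair_eqE; move: d_ge4 ii; clear; lia.
- apply: (neq _ _ _ _ _ _ gen GenD01); rewrite xpair_eqE; move: d_ge4 ii; clear; lia.
Qed.

Lemma size_gens : size gens = ((d + 1) * (d - 4) %/ 2 + 5)%N.
Proof.
rewrite size_cat addnC size_allpairs_dep; congr (_ + _)%N.
under eq_map do rewrite size_enum_ord.
have [e dE] : exists e, d = (e + 4)%N by exists (d - 4)%N; move: d_ge4; clear; lia.
have le : (1 + (d - 4) <= (d - 2).+1)%N by move: d_ge4; clear; lia.
have := double_sumn_iota le; rewrite -muln2 => sE.
rewrite -[LHS](mulnK _ (isT : (0 < 2)%N)) sE; congr (_ %/ 2)%N.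
rewrite dE; clear; nia.
Qed.

End MinimalGenerators.

Theorem theorem5p4 (K : closedFieldType) (d : nat) (u : 'I_3 -> KT K)
    (E : KX K) (P Q L0 L1 Ls D10 D01 : KTX K) (Mor : KSTX K)
    (d_gt0 : (0 < d)%N)
    (u_homog : forall i, u i \is d.-homog)
    (u_coprime : no_common_factor u)
    (u_proper : birational_onto_image u)
    (E_curve : defines_image u d E)
    (PQ_basis : mu_basis u d 2 P Q)
    (L_linear : [/\ bihomog 0 1 L0, bihomog 0 1 L1 & bihomog 0 1 Ls])
    (P_eq : P = tvar K 0 ^+ 2 * L0 + tvar K 1 ^+ 2 * L1
                + tvar K 0 * tvar K 1 * Ls)
    (D10_syl : sylvester_form d P Q 1 0 D10)
    (D01_syl : sylvester_form d P Q 0 1 D01)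
    (Mor_morley : morley_form d P Q Mor)
    (sing_double : singularities_are_double E) :
  let gens := [:: x_poly E; P; Q; D10; D01] ++ morley_minors d L0 Ls L1 Mor in
  [/\ size gens = ((d + 1) * (d - 4) %/ 2 + 5)%N,
      uniq gens
    & minimal_generating_set (rees_ker u) gens].
Proof.
move=> gens.
case: L_linear => /tconst_linear [l0 L0E] /tconst_linear [l1 L1E] /tconst_linear [ls LsE].
pose l (i : 'I_3) : 'I_3 -> K := if i == 0 then l0 else if i == 1 then ls else l1.
have P_eq' : P = lin_form (l 0) * tmon K 2 0 + lin_form (l 1) * tmon K 1 1
    + lin_form (l 2) * tmon K 0 2.
  rewrite P_eq L0E L1E LsE /tmon /l /= !expr0 !expr1 mulr1 mul1r.
  rewrite addrAC; congr (_ + _ + _); exact: mulrC.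
have l_indep : (5 <= d)%N -> \det (\matrix_(i, j) l i j) != 0.
  move=> d5; exact: (coefficients_independent d5 u_homog E_curve PQ_basis sing_double P_eq').
rewrite /gens L0E LsE L1E; split.
- exact: (size_gens D10 D01 E Mor PQ_basis l).
- exact: (gens_uniq E_curve PQ_basis P_eq' l_indep D10_syl D01_syl Mor_morley).
exact: (gens_minimal u_homog u_coprime E_curve PQ_basis P_eq' l_indep D10_syl D01_syl Mor_morley).
Qed.
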